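(* Let $T\sim\{X_n\}_{n=1}^\infty$ be a random weighted shift on $\mathcal H$ with $0<r<R=1$, where $r=\min\operatorname{essran}X_1$ and $R=\max\operatorname{essran}X_1$. Then: (i) $T$ is almost surely reflexive; (ii) almost surely $T$ has invariant subspaces with an index of any finite number or infinity, i.e. for every $n\in\{1,2,3,\dots\}\cup\{\infty\}$ there is $\mathcal M\in\operatorname{Lat}(T)$ of index $n$; (iii) if $A$ is a strict contraction on a separable Hilbert space (that is, $\|A\|<1$), then almost surely there exist $\mathcal N,\mathcal M\in\operatorname{Lat}(T)$ with $\mathcal N\subset\mathcal M$ such that the compression of $T$ to $\mathcal M\ominus\mathcal N$ is unitarily equivalent to $A$.
   Context: $\mathcal H$ is a complex separable infinite-dimensional Hilbert space with orthonormal basis $\{e_n\}_{n=1}^\infty$. $\{X_n\}_{n=1}^\infty$ are nonnegative, bounded, i.i.d. random variables on a probability space $(\Omega,\mathcal F,\mathbb P)$. Writing $T\sim\{X_n\}$ means that $T=T(\omega)$ is the random unilateral weighted shift $T(\omega)e_n=X_n(\omega)e_{n+1}$, $n\ge1$. $\operatorname{essran}X_1$ is the essential range of $X_1$ (closed support of its law). For a bounded operator $B$ on $\mathcal H$, $\operatorname{Lat}(B)$ is the lattice of closed subspaces invariant under $B$. $B$ is reflexive if $\{Z\in\mathcal B(\mathcal H):\operatorname{Lat}(B)\subset\operatorname{Lat}(Z)\}$ coincides with the weakly closed algebra generated by $B$ (closure, in the weak operator topology, of the polynomials in $B$). The index of $\mathcal M\in\operatorname{Lat}(B)$ is $\dim\big(\mathcal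 M\cap(B\mathcal M)^\perp\big)$. The compression of $T$ to $\mathcal L=\mathcal M\ominus\mathcal N$ is $P_{\mathcal L}T|_{\mathcal L}$, with $P_{\mathcal L}$ the orthogonal projection onto $\mathcal L$. *)

(* Defs.v *)
From HB Require Import structures.
From mathcomp Require Import all_boot all_order all_algebra.
From mathcomp Require Import complex.
From mathcomp Require Import all_classical all_reals all_analysis.

Set Implicit Arguments.
Unset Strict Implicit.
Unset Printing Implicit Defensive.

Import Order.TTheory GRing.Theory Num.Theory.
Import numFieldNormedType.Exports.

Local Open Scope classical_set_scope.
Local Open Scope ring_scope.
Local Open Scope complex_scope.

(* The inner product is linear in its first argument. *)
HB.mixin Record NormedModule_isHilbert (R : realType) H
    of CompleteNormedModule R[i] H := {
  dot : {dot H for (@Num.conj R[i])} ;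
  dot_norm : forall x : H, dot x x = `|x| ^+ 2
}.

#[short(type="hilbertType")]
HB.structure Definition Hilbert (R : realType) :=
  {H of NormedModule_isHilbert R H & CompleteNormedModule R[i] H}.

Section Subspaces.
Context {R : realType} {H : hilbertType R}.
Implicit Types (M L : set H) (e : nat -> H).

Definition separable : Prop :=
  exists D : set H, countable D /\ dense D.

Definition closed_subspace M : Prop :=
  [/\ M 0, forall (a : R[i]) x y, M x -> M y -> M (a *: x + y) & closed M].

Definition orthocomplement (S : set H) : set H :=
  [set y | forall x, S x -> dot y x = 0].

Definition orthonormal_basis_of (D : set nat) e L : Prop :=
  (forall i j, D i -> D j -> dot (e i) (e j) = (i == j)%:R) /\
  smallest closed_subspace (e @` D) = L.

(* Hilbert dimension of a separable subspace; None stands for aleph_0. *)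
Definition has_dimension L (n : option nat) : Prop :=
  exists e, orthonormal_basis_of (if n is Some k then `I_k else setT) e L.

Definition orthoproj L (x : H) : H :=
  xget 0 [set y | L y /\ orthocomplement L (x - y)].

End Subspaces.
Arguments separable {R} H.

Section Operators.
Context {R : realType} {H : hilbertType R}.
Implicit Types (B Z : H -> H) (M N L : set H).

Definition bounded_operator B : Prop :=
  linear B /\ exists C : R, forall x, `|B x| <= C%:C * `|x|.

Definition opnorm B : R :=
  sup [set complex.Re `|B x| | x in [set x : H | `|x| <= 1]].

Definition Lat B : set (set H) :=
  [set M | closed_subspace M /\ B @` M `<=` M].

Definition poly_op (p : {poly R[i]}) B : H -> H :=
  fun x => \sum_(i < size p) p`_i *: iter i B x.

Definition matrix_coefficients Z : {ptws H * H -> R[i]^o} :=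
  fun xy => dot (Z xy.1) xy.2.

(* Weak operator topology, here on all maps H -> H. *)
Definition WOT : topologicalType := initial_topology matrix_coefficients.

(* The closure is taken in all of WOT and then traced on the bounded operators,
   which is the closure in the subspace topology of B(H). *)
Definition weakly_closed_algebra B : set (H -> H) :=
  [set Z | bounded_operator Z /\
           closure ([set poly_op p B | p in setT] : set WOT) Z].

Definition reflexive_operator B : Prop :=
  [set Z | bounded_operator Z /\ Lat B `<=` Lat Z] = weakly_closed_algebra B.

Definition has_index B M (n : option nat) : Prop :=
  has_dimension (M `&` orthocomplement (B @` M)) n.

Definition compression L B : H -> H := fun x => orthoproj L (B x).

(* [C] is only looked at on [L]. *)
Definition unitarily_equivalent {K : hilbertType R} L (C : H -> H)
    (A : K -> K) : Prop :=
  exists U : K -> H,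
    [/\ linear U, isometry dot dot U, range U = L &
        forall x, C (U x) = U (A x)].

End Operators.

Section RandomShift.
Context {R : realType} {d : measure_display} {Omega : measurableType d}
        {P : probability Omega R}.
Implicit Types (X : nat -> {RV P >-> R}).

Definition essran (Y : {RV P >-> R}) : set R :=
  [set x | forall U : set R, open U -> U x -> (0 < distribution P Y U)%E].

Definition identically_distributed X : Prop :=
  forall n (A : set R), measurable A ->
    distribution P (X n) A = distribution P (X 0%N) A.

Definition mutually_independent X : Prop :=
  forall (s : seq nat) (A : nat -> set R), uniq s ->
    (forall i, measurable (A i)) ->
    P (\bigcap_(i in [set` s]) (X i @^-1` A i)) =
    (\prod_(i <- s) P (X i @^-1` A i))%E.

Definition ae_nonnegative X : Prop := forall n, {ae P, forall w, 0 <= X n w}.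

Definition ae_bounded X : Prop :=
  forall n, exists C : R, {ae P, forall w, `|X n w| <= C}.

(* T(w) is a bounded operator only for almost every w, since the X_n need not
   be uniformly bounded on the exceptional null set. *)
Definition weighted_shift_of {H : hilbertType R} (e : nat -> H) X
    (T : Omega -> H -> H) : Prop :=
  {ae P, forall w, bounded_operator (T w) /\
                   forall n, T w (e n) = (X n w)%:C *: e n.+1}.

End RandomShift.

(* Main.v *)
Require Import Defs.
From mathcomp Require Import all_boot all_order all_algebra.
From mathcomp Require Import complex.
From mathcomp Require Import all_classical all_reals all_analysis.
From mathcomp Require Import ring lra zify measurable_realfun.

Set Implicit Arguments.
Unset Strict Implicit.
Unset Printing Implicit Defensive.

Import Order.TTheory GRing.Theory Num.Theory.
Import numFieldNormedType.Exports.

Local Open Scope classical_set_scope.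
Local Open Scope ring_scope.

Local Notation Re := complex.Re.
Local Notation "x %:C" := (real_complex _ x) (format "x %:C") : ring_scope.

(** Almost surely all weights lie in [rmin, 1] and, by independence, every
pattern of positive probability occurs arbitrarily far out; in particular long
stretches of weights below some r < 1 are followed by long stretches of weights
close to 1. The three claims hold for every single shift T with these two
properties, so only [pattern_recurs] and [ae_essran] are about probability.

The core is [power_dilation]: for every strict contraction A on a separable
space K there is a linear U : K -> H with <T^k U f, U g> = <A^k f, g> for all
k >= 0. In particular U is isometric, and then (as Sarason observed) its range
is semi-invariant: with M the closed span of the orbits of the range of U, and N
the part of M orthogonal to that range, T compresses to A on M - N
([compression_of_dilation]). Taking K = H and A = 0 gives orthonormal vectors
x_i with <T^k x_i, x_j> = 0 for k > 0; any n of them generate an invariant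
subspace whose wandering space they span, so that its index is n
([index_of_wandering]).

U is built as a series of finite pieces. Write U f as the sum of u_n(f) e_n with
functionals u_n, finitely many of them nonzero at each stage, and let the
remainder be the kernel R_k(f, g) = <A^k f, g> - <T^k U f, U g>. The invariant is
that the Toeplitz form with entries R_(m-n) is bounded below by a positive
multiple of the identity; it holds at the start because A is a strict
contraction ([coercive_start]). On a stretch of weights close to 1 the shift T
looks like an isometric shift, so vectors supported there can realise any finite
sum of Gram kernels up to a small error, and a preceding stretch of small weights
decouples them from everything before ([add_block]). Gram-Schmidt on sequences of
length l ([sum_of_squares]) provides Gram kernels whose window averages lie below
half a Fejer mean of the remainder, hence nearly below half the remainder, but
which use up half of R_0(f, f) for a prescribed f ([absorb_half]). The invariant
thus persists while R_0(f, f) shrinks geometrically along the times devoted to f;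
as 2|R_k(f, g)| <= R_0(f, f) + R_0(g, g), everything tends to zero.

Reflexivity uses only that the weights are bounded below. The adjoint of T then
has eigenvectors for all small eigenvalues, their complements are in Lat T, and
these eigenvectors are total; an operator leaving Lat T invariant therefore
commutes with T ([commutes_of_Lat]). An operator commuting with T is a formal
power series in T, and its Fejer means are polynomials in T that are bounded by
its norm and converge to it weakly ([fejer_cvg]). *)

(** * Real-valued norms and inner products *)

Section RealNorm.
Context {R : realType}.
Notation C := R[i].
Implicit Types (z w : C).

Lemma ReD z w : Re (z + w) = Re z + Re w.
Proof. by case: z w => [a b] [c d]. Qed.

Lemma ReN z : Re (- z) = - Re z.
Proof. by case: z. Qed.

Lemma Re_sum I (s : seq I) (p : pred I) (F : I -> C) :
  Re (\sum_(i <- s | p i) F i) = \sum_(i <- s | p i) Re (F i).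
Proof. by elim/big_rec2: _ => // i x y _ <-; rewrite ReD. Qed.

Lemma conjE z : z^* = conjc z.
Proof. by []. Qed.

Lemma ReR (r : R) : Re r%:C = r.
Proof. by []. Qed.

Lemma ReJ z : Re z^* = Re z.
Proof. by case: z. Qed.

Lemma Re_scale (r : R) z : Re (r%:C * z) = r * Re z.
Proof. by case: z => a b /=; ring. Qed.

Lemma conjR (r : R) : (r%:C)^* = r%:C :> C.
Proof. by rewrite conjE conjc_real. Qed.

Lemma rcD (a b : R) : (a + b)%:C = a%:C + b%:C :> C.
Proof. exact: rmorphD. Qed.

Lemma rcB (a b : R) : (a - b)%:C = a%:C - b%:C :> C.
Proof. exact: rmorphB. Qed.

Lemma rcM (a b : R) : (a * b)%:C = a%:C * b%:C :> C.
Proof. exact: rmorphM. Qed.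

Lemma rcV (a : R) : (a^-1)%:C = a%:C^-1 :> C.
Proof. exact: fmorphV. Qed.

Lemma rc_nat n : n%:R%:C = n%:R :> C.
Proof. exact: rmorph_nat. Qed.

Lemma rc_sum I (s : seq I) (p : pred I) (F : I -> R) :
  (\sum_(i <- s | p i) F i)%:C = \sum_(i <- s | p i) (F i)%:C :> C.
Proof. exact: rmorph_sum. Qed.

Lemma conjM z w : (z * w)^* = z^* * w^*.
Proof. exact: rmorphM. Qed.

Lemma conjD z w : (z + w)^* = z^* + w^*.
Proof. exact: rmorphD. Qed.

Lemma conjN z : (- z)^* = - z^*.
Proof. exact: rmorphN. Qed.

Lemma conjK z : (z^*)^* = z.
Proof. exact: conjCK. Qed.

Lemma conj0 : (0 : C)^* = 0.
Proof. exact: conjc0. Qed.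

Lemma conj_nat n : (n%:R : C)^* = n%:R.
Proof. exact: conjc_nat. Qed.

Lemma conjV z : (z^-1)^* = (z^*)^-1.
Proof. exact: fmorphV. Qed.

Lemma conj_sum I (s : seq I) (p : pred I) (F : I -> C) :
  (\sum_(i <- s | p i) F i)^* = \sum_(i <- s | p i) (F i)^*.
Proof. exact: rmorph_sum. Qed.

(** The norm of a complex normed space takes values in R[i], where the order is
only partial; its real part is the same number as an element of R. *)
Definition nrm {V : normedZmodType C} (x : V) : R := Re `|x|.

Lemma nrmE (V : normedZmodType C) (x : V) : `|x| = (nrm x)%:C.
Proof. by rewrite /nrm RRe_real // ger0_real. Qed.

Lemma nrm_ge0 (V : normedZmodType C) (x : V) : 0 <= nrm x.
Proof. by rewrite -ler0c -nrmE. Qed.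

Lemma nrm_eq0 (V : normedZmodType C) (x : V) : (nrm x == 0) = (x == 0).
Proof. by rewrite -(normr_eq0 x) nrmE; apply/eqP/eqP => [->|[]]. Qed.

Lemma nrm0 (V : normedZmodType C) : nrm (0 : V) = 0.
Proof. by apply/eqP; rewrite nrm_eq0. Qed.

Lemma nrmN (V : normedZmodType C) (x : V) : nrm (- x) = nrm x.
Proof. by rewrite /nrm normrN. Qed.

Lemma nrmB (V : normedZmodType C) (x y : V) : nrm (x - y) = nrm (y - x).
Proof. by rewrite /nrm distrC. Qed.

Lemma nrmD (V : normedZmodType C) (x y : V) : nrm (x + y) <= nrm x + nrm y.
Proof. by rewrite -lecR rmorphD /= -!nrmE ler_normD. Qed.

Lemma nrm_triangle (V : normedZmodType C) (z x y : V) :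
  nrm (x - y) <= nrm (x - z) + nrm (z - y).
Proof. by rewrite -[x - y](subrKA z) nrmD. Qed.

Lemma nrm_sum (V : normedZmodType C) I (s : seq I) (p : pred I) (F : I -> V) :
  nrm (\sum_(i <- s | p i) F i) <= \sum_(i <- s | p i) nrm (F i).
Proof.
elim/big_rec2: _ => [|i x y _ le]; first by rewrite nrm0.
by apply: le_trans (nrmD _ _) _; rewrite lerD2l.
Qed.

Lemma nrmZ (V : normedModType C) (a : C) (x : V) :
  nrm (a *: x) = nrm a * nrm x.
Proof. by apply: complexI; rewrite rmorphM /= -!nrmE normrZ. Qed.

Lemma nrmM z w : nrm (z * w) = nrm z * nrm w.
Proof. by apply: complexI; rewrite rmorphM /= -!nrmE normrM. Qed.

Lemma nrmJ z : nrm z^* = nrm z.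
Proof. by rewrite /nrm norm_conjC. Qed.

Lemma nrmR (r : R) : nrm r%:C = `|r|.
Proof. by rewrite /nrm normc_def /= expr0n addr0 sqrtr_sqr. Qed.

Lemma nrm_nat n : nrm (n%:R : C) = n%:R.
Proof. by rewrite /nrm normr_nat -(rmorph_nat (real_complex R)). Qed.

Lemma mulJ z : z * z^* = (nrm z ^+ 2)%:C.
Proof. by rewrite -normCK nrmE rmorphXn. Qed.

Lemma nrm_Re z : `|Re z| <= nrm z.
Proof.
rewrite /nrm normc_def /= -sqrtr_sqr ler_wsqrtr //.
by rewrite lerDl sqr_ge0.
Qed.

Lemma le_Re_nrm z : Re z <= nrm z.
Proof. exact: le_trans (ler_norm _) (nrm_Re z). Qed.

Lemma ge_Re_nrm z : - nrm z <= Re z.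
Proof. by have := nrm_Re z; rewrite ler_norml => /andP[]. Qed.

(** The constant c spares the choice of an optimal tolerance in limit arguments. *)
Lemma nrm_le_eps (V : normedZmodType C) (x : V) (c : R) :
  (forall eps : R, 0 < eps -> nrm x <= c * eps) -> x = 0.
Proof.
move=> le0; apply/eqP; rewrite -nrm_eq0; apply/eqP/le_anti; rewrite nrm_ge0 andbT.
have c1 : 0 < `|c| + 1 by rewrite ltr_wpDl.
apply/ler_addgt0Pl => e e0; rewrite addr0.
have := le0 (e / (`|c| + 1)) (divr_gt0 e0 c1); move/le_trans; apply.
rewrite mulrA ler_pdivrMr // mulrC ler_wpM2l ?(ltW e0) //.
by apply: le_trans (ler_norm _) _; rewrite lerDl.
Qed.

End RealNorm.

Section Dot.
Context {R : realType} {H : hilbertType R}.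
Implicit Types (x y z : H) (a : R[i]).

Lemma dotxx x : dot x x = (nrm x ^+ 2)%:C.
Proof. by rewrite dot_norm nrmE rmorphXn. Qed.

Lemma dotC x y : dot x y = (dot y x)^*.
Proof. by rewrite (hermC dot) expr0 mul1r. Qed.

Lemma dotDl x y z : dot (x + y) z = dot x z + dot y z.
Proof. exact: linearDl. Qed.

Lemma dotBl x y z : dot (x - y) z = dot x z - dot y z.
Proof. exact: linearBl. Qed.

Lemma dotZl a x y : dot (a *: x) y = a * dot x y.
Proof. exact: linearZl_LR. Qed.

Lemma dotDr x y z : dot x (y + z) = dot x y + dot x z.
Proof. exact: linearDr. Qed.

Lemma dotBr x y z : dot x (y - z) = dot x y - dot x z.
Proof. exact: linearBr. Qed.

Lemma dotZr a x y : dot x (a *: y) = a^* * dot x y.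
Proof. exact: linearZr_LR. Qed.

Lemma dot0l x : dot 0 x = 0. Proof. exact: linear0l. Qed.
Lemma dot0r x : dot x 0 = 0. Proof. exact: linear0r. Qed.

Lemma dot_suml I (s : seq I) (p : pred I) (F : I -> H) y :
  dot (\sum_(i <- s | p i) F i) y = \sum_(i <- s | p i) dot (F i) y.
Proof. exact: linear_sumlz. Qed.

Lemma dot_sumr I (s : seq I) (p : pred I) (F : I -> H) y :
  dot y (\sum_(i <- s | p i) F i) = \sum_(i <- s | p i) dot y (F i).
Proof. exact: linear_sumr. Qed.

(** Cauchy-Schwarz. *)
Lemma nrm_dot x y : nrm (dot x y) <= nrm x * nrm y.
Proof.
have [->|y0] := eqVneq y 0; first by rewrite dot0r !nrm0 mulr0.
have ny : nrm y != 0 by rewrite nrm_eq0.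
pose b := dot x y / (nrm y ^+ 2)%:C.
have y2 : (nrm y ^+ 2)%:C != 0 :> R[i].
  by apply/eqP => -[] /eqP; rewrite sqrf_eq0 (negPf ny).
have E : dot (x - b *: y) (x - b *: y) =
    (nrm x ^+ 2 - nrm (dot x y) ^+ 2 / nrm y ^+ 2)%:C.
  rewrite !(dotBl, dotBr, dotZl, dotZr) !dotxx.
  have bJ : b^* = dot y x / (nrm y ^+ 2)%:C.
    by rewrite conjM conjV conjR -dotC.
  rewrite bJ divfK // subrr subr0 mulrAC (dotC y x) [_^* * _]mulrC mulJ.
  by rewrite rcB rcM rcV.
have : 0 <= nrm x ^+ 2 - nrm (dot x y) ^+ 2 / nrm y ^+ 2.
  by rewrite -ler0c -E dotxx ler0c sqr_ge0.
rewrite subr_ge0 ler_pdivrMr; last by rewrite lt_def sqr_ge0 sqrf_eq0 ny.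
rewrite -exprMn ler_pXn2r // ?nnegrE ?mulr_ge0 ?nrm_ge0 //.
Qed.

Lemma nrm2D x y : nrm (x + y) ^+ 2 = nrm x ^+ 2 + nrm y ^+ 2 + 2 * Re (dot x y).
Proof.
apply: complexI; rewrite -dotxx !(dotDl, dotDr) !dotxx (dotC y x).
rewrite rcD rcD (rcM 2) rc_nat -addcJ -conjE; ring.
Qed.

Lemma nrm2D_orth x y : dot x y = 0 -> nrm (x + y) ^+ 2 = nrm x ^+ 2 + nrm y ^+ 2.
Proof. by rewrite nrm2D => -> /=; rewrite mulr0 addr0. Qed.

(** The parallelogram law. *)
Lemma nrm2_par x y :
  nrm (x + y) ^+ 2 + nrm (x - y) ^+ 2 = 2 * (nrm x ^+ 2 + nrm y ^+ 2).
Proof.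
rewrite !nrm2D nrmN (_ : dot x (- y) = - dot x y) ?ReN; first by ring.
exact: linearNr.
Qed.

Lemma dot_eq0C x y : dot x y = 0 -> dot y x = 0.
Proof. by rewrite dotC => /eqP; rewrite conjC_eq0 => /eqP. Qed.

Lemma dot_self_eq0 x : dot x x = 0 -> x = 0.
Proof.
by rewrite dotxx => -[] /eqP; rewrite sqrf_eq0 nrm_eq0 => /eqP.
Qed.

End Dot.

(** * Closed subspaces and orthogonal projections *)

Section Metric.
Context {R : realType} {H : hilbertType R}.
Implicit Types (x y z : H) (M L : set H).

Lemma gt0_rc (e : R[i]) : 0 < e -> e = (Re e)%:C /\ 0 < Re e.
Proof.
move=> e0; have eE : e = (Re e)%:C by rewrite RRe_real // gtr0_real.
by split=> //; rewrite -ltcR -eE.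
Qed.

Lemma closed_approx M x : closed M ->
  (forall eps : R, 0 < eps -> exists2 y, M y & nrm (x - y) < eps) -> M x.
Proof.
move=> cM ap; apply: cM => B /nbhs_ballP[e /= /gt0_rc[eE e0] sB].
have [y My xy] := ap _ e0; exists y; split => //; apply: sB.
by rewrite -ball_normE /= nrmE eE ltcR.
Qed.

Lemma approx_closed M :
  (forall x, (forall eps : R, 0 < eps -> exists2 y, M y & nrm (x - y) < eps) ->
    M x) -> closed M.
Proof.
move=> ap x clx; apply: ap => eps e0.
have e0C : 0 < eps%:C :> R[i] by rewrite ltcR.
have [y [My]] := clx _ (nbhsx_ballx x (PosNum e0C)%:num (gt0 _)).
by rewrite -ball_normE /= nrmE ltcR; exists y.
Qed.

Lemma hilbert_complete (u : nat -> H) :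
  (forall eps : R, 0 < eps ->
     exists N, forall m n, (N <= m)%N -> (N <= n)%N -> nrm (u m - u n) < eps) ->
  exists l, forall eps : R, 0 < eps ->
     exists N, forall n, (N <= n)%N -> nrm (l - u n) < eps.
Proof.
move=> cau.
have cu : cvg (u @ \oo).
  apply/cauchy_cvgP/cauchy_exP => e /gt0_rc[eE e0].
  have [N uN] := cau _ e0; exists (u N).
  exists N => // n /= Nn; rewrite -ball_normE /= nrmE eE ltcR.
  exact: uN.
exists (lim (u @ \oo)) => eps e0.
have e0C : 0 < eps%:C :> R[i] by rewrite ltcR.
have /cvgrPdist_lt /(_ _ e0C)[N _ uN] := cu.
by exists N => n /uN /=; rewrite nrmE ltcR.
Qed.

Lemma smallest_closed_subspace (S : set H) :
  closed_subspace (smallest closed_subspace S).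
Proof.
split.
- by move=> M [[]].
- move=> a x y Sx Sy M [cM SM].
  by case: (cM) => _ lM _; apply: lM; [apply: Sx|apply: Sy].
- by apply: closed_bigI => M [[]].
Qed.

Lemma closed_subspaceD M x y : closed_subspace M -> M x -> M y -> M (x + y).
Proof. by move=> [_ lM _] Mx My; rewrite -[x]scale1r; apply: lM. Qed.

Lemma closed_subspaceZ M a x : closed_subspace M -> M x -> M (a *: x).
Proof. by move=> [M0 lM _] Mx; rewrite -[_ *: _]addr0; apply: lM. Qed.

Lemma closed_subspaceB M x y : closed_subspace M -> M x -> M y -> M (x - y).
Proof.
by move=> cM Mx My; apply: closed_subspaceD; rewrite // -scaleN1r; apply: closed_subspaceZ.
Qed.

Lemma closed_subspace_ker (phi : H -> R[i]) (c : R) :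
  (forall a x y, phi (a *: x + y) = a * phi x + phi y) ->
  (forall x, nrm (phi x) <= c * nrm x) ->
  closed_subspace [set x | phi x = 0].
Proof.
move=> lphi bphi; split => /=.
- have := lphi 0 0 0; rewrite scaler0 addr0 mul0r add0r => /=.
  have := lphi 1 0 0; rewrite scaler0 addr0 mul1r => /eqP.
  by rewrite -subr_eq0 opprD addNKr oppr_eq0 => /eqP.
- by move=> a x y px py; rewrite lphi px py mulr0 addr0.
- apply: approx_closed => x ap; apply: (@nrm_le_eps _ _ _ `|c|) => e /ap[y /= py xy].
  have -> : phi x = phi (x - y).
    by rewrite -scaleN1r addrC lphi py mulr0 add0r.
  apply: le_trans (bphi _) _; apply: (@le_trans _ _ (`|c| * nrm (x - y))).
    by rewrite ler_wpM2r ?nrm_ge0 // ler_norm.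
  by rewrite ler_wpM2l // ltW.
Qed.

Lemma dot_kerl y : closed_subspace [set x | dot x y = 0].
Proof.
apply: (@closed_subspace_ker _ (nrm y)); first by move=> a x z; rewrite dotDl dotZl.
by move=> x; rewrite mulrC nrm_dot.
Qed.

Lemma closed_subspace_cap M N : closed_subspace M -> closed_subspace N ->
  closed_subspace (M `&` N).
Proof.
move=> [M0 lM cM] [N0 lN cN]; split=> //; last exact: closedI.
by move=> a x y [Mx Nx] [My Ny]; split; [apply: lM|apply: lN].
Qed.

Lemma orthocomplement_closed (S : set H) : closed_subspace (orthocomplement S).
Proof.
rewrite (_ : orthocomplement S = \bigcap_(y in S) [set x | dot x y = 0]) //.
split.
- by move=> y _; apply: dot0l.
- by move=> a x z Sx Sz y Sy /=; rewrite dotDl dotZl Sx // Sz // mulr0 addr0.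
- by apply: closed_bigI => y _; case: (dot_kerl y).
Qed.

(** The minimizing sequence is Cauchy by the parallelogram law. *)
Lemma projection_theorem M x : closed_subspace M ->
  exists2 p, M p & orthocomplement M (x - p).
Proof.
move=> cM; have [M0 lM clM] := cM.
pose D := [set nrm (x - y) ^+ 2 | y in M].
have infD : has_inf D.
  split; first by exists (nrm (x - 0) ^+ 2), 0.
  by exists 0 => _ [y _ <-]; apply: sqr_ge0.
have lb y : M y -> inf D <= nrm (x - y) ^+ 2.
  by move=> My; apply: ge_inf; [case: infD|exists y].
have near_inf (e : R) : 0 < e -> exists2 y, M y & nrm (x - y) ^+ 2 < inf D + e.
  move=> e0; have [_ [y My <-] ye] := inf_adherent e0 infD.
  by exists y.
have [u uP] : {u : nat -> H & forall n, M (u n) /\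
    nrm (x - u n) ^+ 2 < inf D + n.+1%:R^-1}.
  apply: (@choice nat H (fun n y => M y /\ nrm (x - y) ^+ 2 < inf D + n.+1%:R^-1)).
  move=> n; have [y My ye] := near_inf n.+1%:R^-1 (ltac:(by rewrite invr_gt0)).
  by exists y.
have par y z : M y -> M z ->
    nrm (y - z) ^+ 2 <= 2 * (nrm (x - y) ^+ 2 + nrm (x - z) ^+ 2) - 4 * inf D.
  move=> My Mz.
  have := nrm2_par (x - y) (x - z).
  have -> : x - y - (x - z) = z - y by rewrite opprB addrC addrA subrK.
  have -> : x - y + (x - z) = 2%:C *: (x - 2^-1%:C *: (y + z)).
    rewrite scalerBr scalerA -rcM mulfV // scale1r rc_nat scaler_nat mulr2n.
    by rewrite opprD addrACA.
  rewrite nrmZ nrmR exprMn (nrmB z y) ger0_norm // => E.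
  have h : M (2^-1%:C *: (y + z)).
    by apply: closed_subspaceZ => //; apply: closed_subspaceD.
  have := lb _ h; lra.
have small (e : R) : 0 < e -> exists N, forall n, (N <= n)%N -> n.+1%:R^-1 < e.
  move=> e0; exists (Num.truncn e^-1) => n Nn.
  rewrite invf_plt ?posrE //.
  by apply: lt_le_trans (truncnS_gt _) _; rewrite ler_nat ltnS.
have [l lP] : exists l, forall eps : R, 0 < eps ->
     exists N, forall n, (N <= n)%N -> nrm (l - u n) < eps.
  apply: hilbert_complete => eps e0.
  have [N NP] := small (eps ^+ 2 / 4) (ltac:(by rewrite divr_gt0 // exprn_gt0)).
  exists N => m n /NP Nm /NP Nn.
  rewrite -(ltr_pXn2r (_ : (0 < 2)%N)) ?nnegrE ?nrm_ge0 ?ltW //.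
  have [Mm um] := uP m; have [Mn un] := uP n.
  move: Nm um Nn un (par _ _ Mm Mn); move: (m.+1%:R^-1) (n.+1%:R^-1) => a b; lra.
have Ml : M l.
  apply: closed_approx => // eps /lP[N /(_ N (leqnn N)) lN].
  by exists (u N) => //; case: (uP N).
exists l => // y My.
have minl : nrm (x - l) ^+ 2 <= inf D.
  have nl : nrm (x - l) <= Num.sqrt (inf D).
    apply/ler_addgt0Pl => e e0.
    have [N1 N1P] := lP (e / 2) (ltac:(by rewrite divr_gt0)).
    have [N2 N2P] := small (e ^+ 2 / 4) (ltac:(by rewrite divr_gt0 // exprn_gt0)).
    pose n := maxn N1 N2.
    have ln := N1P n (leq_maxl _ _); have un := N2P n (leq_maxr _ _).
    have [_ xu] := uP n.
    have D0 : 0 <= inf D.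
      by apply: lb_le_inf; [case: infD|move=> _ [z _ <-]; apply: sqr_ge0].
    have xu' : nrm (x - u n) <= Num.sqrt (inf D) + e / 2.
      rewrite -(ler_pXn2r (_ : (0 < 2)%N)) ?nnegrE ?nrm_ge0 ?addr_ge0 ?sqrtr_ge0 ?divr_ge0 ?ltW //.
      rewrite sqrrD sqr_sqrtr //.
      have : 0 <= Num.sqrt (inf D) * (e / 2) *+ 2.
        by rewrite mulrn_wge0 // mulr_ge0 ?sqrtr_ge0 // divr_ge0 // ltW.
      have -> : (e / 2) ^+ 2 = e ^+ 2 / 4 by field.
      move: un xu; move: (n.+1%:R^-1) => c; lra.
    have := nrm_triangle (u n) x l; rewrite (nrmB (u n) l).
    lra.
  have D0 : 0 <= inf D.
    by apply: lb_le_inf; [case: infD|move=> _ [z _ <-]; apply: sqr_ge0].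
  rewrite -[leRHS]sqr_sqrtr // ler_pXn2r ?nnegrE ?nrm_ge0 ?sqrtr_ge0 //.
(* Moving from l by the component of x - l along y cannot decrease the
   distance to x, so that component vanishes. *)
have [->|y0] := eqVneq y 0; first by rewrite dot0r.
have ny : 0 < nrm y ^+ 2 by rewrite exprn_gt0 // lt_def nrm_ge0 nrm_eq0 y0.
have nyV : 0 <= (nrm y ^+ 2)^-1 by rewrite invr_ge0 ltW.
pose d := dot (x - l) y.
pose b := d / (nrm y ^+ 2)%:C.
have Mb : M (l + b *: y) by apply: closed_subspaceD => //; apply: closed_subspaceZ.
have := lb _ Mb; rewrite opprD addrA nrm2D nrmN nrmZ.
have -> : dot (x - l) (- (b *: y)) = - ((nrm d ^+ 2)%:C / (nrm y ^+ 2)%:C).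
  rewrite -scaleNr dotZr -/d conjN mulNr; congr (- _).
  by rewrite /b conjM conjV conjR mulrAC (mulrC _ d) mulJ.
rewrite -rcV -rcM ReN [Re _%:C]/=.
rewrite /b nrmM -rcV nrmR (ger0_norm nyV).
have -> : (nrm d / nrm y ^+ 2 * nrm y) ^+ 2 = nrm d ^+ 2 / nrm y ^+ 2.
  by field; move: ny; case: (nrm y =P 0) => [->|/eqP//]; rewrite expr0n ltxx.
move=> h.
have : nrm d ^+ 2 / nrm y ^+ 2 <= 0 by lra.
rewrite ler_pdivrMr // mul0r => d0.
apply/eqP; rewrite -/d -nrm_eq0 -sqrf_eq0 eq_le d0 sqr_ge0 //.
Qed.

Lemma orthocomplementK M x : closed_subspace M ->
  (forall y, orthocomplement M y -> dot x y = 0) -> M x.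
Proof.
move=> cM xo; have [p Mp op] := projection_theorem x cM.
suff -> : x = p by [].
apply/eqP; rewrite -subr_eq0; apply/eqP/dot_self_eq0.
by rewrite dotBl xo // (dot_eq0C (op _ Mp)) subrr.
Qed.

Lemma orthoproj_eq L x y : L y -> orthocomplement L (x - y) ->
  closed_subspace L -> orthoproj L x = y.
Proof.
move=> Ly oy cL; rewrite /orthoproj.
have [] := @xgetI _ 0 [set y | L y /\ orthocomplement L (x - y)] y (conj Ly oy).
move: (xget _ _) => z Lz oz.
have Lzy : L (z - y) by apply: closed_subspaceB.
have zyE : z - y = (x - y) - (x - z) by rewrite opprB [RHS]addrC subrKA.
apply/eqP; rewrite -subr_eq0; apply/eqP; apply: dot_self_eq0.
by rewrite {1}zyE dotBl oy // oz // subrr.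
Qed.

End Metric.

Lemma onb_eq0 {R : realType} (H : hilbertType R) (e : nat -> H) x :
  smallest closed_subspace (e @` setT) = setT ->
  (forall n, dot x (e n) = 0) -> x = 0.
Proof.
move=> se xe; apply: dot_self_eq0.
have : smallest closed_subspace (e @` setT) x by rewrite se.
have sub : e @` setT `<=` [set y | dot y x = 0].
  by move=> _ [n _ <-]; apply: dot_eq0C.
exact: (smallest_sub (dot_kerl x) sub).
Qed.

(** * Semi-definite sesquilinear forms *)

Section Sesquilinear.
Context {R : realType} {V : lmodType R[i]}.
Notation C := R[i].
Implicit Types (phi : V -> C) (q : V -> V -> C).

Definition linear_functional phi :=
  forall a x y, phi (a *: x + y) = a * phi x + phi y.

Definition sesquilinear q :=
  (forall z, linear_functional (q^~ z)) /\
  (forall a x y z, q z (a *: x + y) = a^* * q z x + q z y).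

Definition hermitian_form q := forall x y, q x y = (q y x)^*.

Lemma linear_functional0 phi : linear_functional phi -> phi 0 = 0.
Proof.
move=> lphi; have := lphi 1 0 0; rewrite scaler0 addr0 mul1r => /eqP.
by rewrite -subr_eq0 opprD addNKr oppr_eq0 => /eqP.
Qed.

Lemma linear_functionalD phi x y :
  linear_functional phi -> phi (x + y) = phi x + phi y.
Proof. by move=> lphi; have := lphi 1 x y; rewrite scale1r mul1r. Qed.

Lemma linear_functionalZ phi a x :
  linear_functional phi -> phi (a *: x) = a * phi x.
Proof.
by move=> lphi; have := lphi a x 0; rewrite (linear_functional0 lphi) !addr0.
Qed.

Lemma linear_functional_sum phi I (s : seq I) (p : pred I) (F : I -> V) :
  linear_functional phi ->
  phi (\sum_(i <- s | p i) F i) = \sum_(i <- s | p i) phi (F i).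
Proof.
move=> lphi; elim/big_rec2: _ => [|i y z _ <-]; first exact: linear_functional0.
by rewrite linear_functionalD.
Qed.

Lemma sesq_suml q I (s : seq I) (p : pred I) (b : I -> C) (F : I -> V) z :
  sesquilinear q ->
  q (\sum_(i <- s | p i) b i *: F i) z = \sum_(i <- s | p i) b i * q (F i) z.
Proof.
move=> [lq _]; rewrite (linear_functional_sum _ _ _ (lq z)).
by apply: eq_bigr => i _; rewrite (linear_functionalZ _ _ (lq z)).
Qed.

Lemma sesq0r q z : sesquilinear q -> q z 0 = 0.
Proof.
move=> [_ rq]; have := rq 1 0 0 z.
rewrite scaler0 addr0 conjE conjc1 mul1r => /eqP.
by rewrite -subr_eq0 opprD addNKr oppr_eq0 => /eqP.
Qed.

Lemma sesqDr q z x y : sesquilinear q -> q z (x + y) = q z x + q z y.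
Proof. by move=> [_ rq]; rewrite -[x]scale1r rq conjE conjc1 mul1r scale1r. Qed.

Lemma sesqZr q z a x : sesquilinear q -> q z (a *: x) = a^* * q z x.
Proof.
by move=> sq; case: (sq) => _ rq; rewrite -[a *: x]addr0 rq sesq0r // addr0.
Qed.

Lemma sesq_sumr q I (s : seq I) (p : pred I) (b : I -> C) (F : I -> V) z :
  sesquilinear q ->
  q z (\sum_(i <- s | p i) b i *: F i) = \sum_(i <- s | p i) (b i)^* * q z (F i).
Proof.
move=> sq; elim/big_rec2: _ => [|i x y _ <-]; first exact: sesq0r.
by rewrite sesqDr // sesqZr.
Qed.

Lemma rank_one_sesquilinear phi psi : linear_functional phi ->
  linear_functional psi -> sesquilinear (fun x y => phi x * (psi y)^*).
Proof.
move=> lphi lpsi; split=> [z a x y|a x y z] /=; first by rewrite lphi; ring.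
by rewrite lpsi conjD conjM; ring.
Qed.

(** Gram-Schmidt for a semi-definite form: subtracting from q the square of the
functional q(-,v)/sqrt(q(v,v)) leaves, by Cauchy-Schwarz, a semi-definite form
that vanishes at v, and this can be repeated. *)
Lemma sum_of_squares (vs : seq V) q : sesquilinear q -> hermitian_form q ->
  (forall x, 0 <= Re (q x x)) ->
  exists cs : seq (V -> C),
    [/\ forall c, List.In c cs -> linear_functional c,
        forall x, \sum_(c <- cs) nrm (c x) ^+ 2 <= Re (q x x) &
        forall v, List.In v vs -> \sum_(c <- cs) nrm (c v) ^+ 2 = Re (q v v)].
Proof.
elim: vs q => [|v vs IH] q sq hq pq.
  by exists [::]; split=> // x; rewrite big_nil.
have [lq rq] := sq.
have qreal x : q x x = (Re (q x x))%:C.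
  by rewrite RRe_real //; apply/CrealP; rewrite -hq.
pose t := Re (q v v).
have t0 : 0 <= t by exact: pq.
pose c x := (Num.sqrt t)^-1%:C * q x v.
have lc : linear_functional c.
  by move=> a x y; rewrite /c (lq v); ring.
pose q' x y := q x y - c x * (c y)^*.
have sq' : sesquilinear q'.
  have [l1 r1] := rank_one_sesquilinear lc lc.
  split=> [z a x y|a x y z]; rewrite /q' ?(lq z) ?(l1 z) ?rq ?r1; ring.
have hq' : hermitian_form q'.
  by move=> x y; rewrite /q' conjD conjN (conjM (c y)) conjK -hq [_^* * _]mulrC.
have cc x : nrm (c x) ^+ 2 = t^-1 * nrm (q x v) ^+ 2.
  rewrite /c nrmM nrmR exprMn ger0_norm ?invr_ge0 ?sqrtr_ge0 //.
  by rewrite exprVn sqr_sqrtr.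
have q'xx x : Re (q' x x) = Re (q x x) - t^-1 * nrm (q x v) ^+ 2.
  by rewrite /q' mulJ ReD ReN /= cc.
have quad x (r : R) : 0 <= Re (q x x) - 2 * r * nrm (q x v) ^+ 2
      + r ^+ 2 * nrm (q x v) ^+ 2 * t.
  pose b := - (r%:C * q x v).
  have := pq (b *: v + x); rewrite (lq _) rq sesqDr // sesqZr //.
  have -> : b * (b^* * q v v + q v x) + (b^* * q x v + q x x) =
      b * b^* * q v v + b * q v x + (b * q v x)^* + q x x.
    by rewrite (hq x v) [(b * q v x)^*]conjM; ring.
  have -> : b * q v x = - (r * nrm (q x v) ^+ 2)%:C.
    by rewrite /b (hq v x) mulNr -mulrA mulJ -rcM.
  have -> : b * b^* * q v v = (nrm b ^+ 2 * t)%:C by rewrite mulJ (qreal v) -/t rcM.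
  rewrite ReD ReD ReD ReJ ReN !ReR.
  have -> : nrm b ^+ 2 = r ^+ 2 * nrm (q x v) ^+ 2.
    by rewrite /b nrmN nrmM nrmR exprMn real_normK ?num_real.
  lra.
have CS x : t = 0 -> nrm (q x v) = 0.
  move=> tz; apply/eqP; rewrite -sqrf_eq0; apply/negPn/negP => n0.
  have np : 0 < nrm (q x v) ^+ 2 by rewrite lt_def n0 sqr_ge0.
  have := quad x ((Re (q x x) + 1) / nrm (q x v) ^+ 2).
  rewrite tz mulr0 addr0 -mulrA divfK ?gt_eqF //.
  have := pq x; lra.
have pq' x : 0 <= Re (q' x x).
  rewrite q'xx; have [tz|tn] := eqVneq t 0.
    by rewrite CS // expr0n mulr0 subr0.
  have := quad x t^-1.
  have -> : t^-1 ^+ 2 * nrm (q x v) ^+ 2 * t = t^-1 * nrm (q x v) ^+ 2 by field.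
  lra.
have [cs [lcs le_cs eq_cs]] := IH q' sq' hq' pq'.
have tot x : Re (q x x) = nrm (c x) ^+ 2 + Re (q' x x).
  by rewrite q'xx cc; ring.
exists (c :: cs); split.
- by move=> d /= [<-|/lcs].
- by move=> x; rewrite big_cons tot lerD2l.
move=> w /= [<-|/eq_cs E]; rewrite big_cons tot; last by rewrite E.
congr (_ + _).
have q'v : Re (q' v v) = 0.
  rewrite q'xx (qreal v) -/t nrmR real_normK ?num_real // expr2 mulrA.
  have [->|tn] := eqVneq t 0; first by rewrite mulr0 subr0.
  by rewrite mulVf // mul1r subrr.
apply/le_anti; rewrite le_cs q'v sumr_ge0 // => d _.
exact: sqr_ge0.
Qed.

(** Positivity at b x + y, with b unimodular and b q(x, y) negative. *)
Lemma psd_le q x y : sesquilinear q -> hermitian_form q ->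
  (forall z, 0 <= Re (q z z)) -> 2 * nrm (q x y) <= Re (q x x) + Re (q y y).
Proof.
move=> sq hq pq; have [lq rq] := sq.
have [q0|q0] := eqVneq (nrm (q x y)) 0.
  by rewrite q0 mulr0 addr_ge0.
pose b : C := - ((nrm (q x y))^-1%:C * (q x y)^*).
have nb : b * b^* = 1.
  by rewrite mulJ /b nrmN nrmM nrmR nrmJ ger0_norm ?invr_ge0 ?nrm_ge0 // mulVf // expr1n.
have bq : b * q x y = - (nrm (q x y))%:C.
  by rewrite /b mulNr -mulrA [_^* * _]mulrC mulJ -rcM expr2 mulrA mulVf // mul1r.
have := pq (b *: x + y); rewrite (lq _) rq sesqDr // sesqZr //.
have -> : b * (b^* * q x x + q x y) + (b^* * q y x + q y y) =
    (b * b^*) * q x x + b * q x y + (b * q x y)^* + q y y.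
  by rewrite (hq y x) (conjM b); ring.
rewrite nb mul1r bq ReD ReD ReD ReJ ReN ReR; lra.
Qed.

End Sesquilinear.

(** * Toeplitz forms and their windows *)

Section ToeplitzForms.
Context {R : realType} {V : lmodType R[i]}.
Notation C := R[i].
Implicit Types (kap : nat -> V -> V -> C) (h : nat -> V).

(** A kernel is given for non-negative lags only; the entries below the diagonal
are filled in hermitianly. *)
Definition toep kap (n m : nat) (f g : V) : C :=
  if (n <= m)%N then kap (m - n)%N f g else (kap (n - m)%N g f)^*.

Definition tform kap (N : nat) (h g : nat -> V) : C :=
  \sum_(n < N) \sum_(m < N) toep kap n m (h n) (g m).

(** The truncated subtractions make this the absolute difference. *)
Definition lag (n m : nat) : nat := ((n - m) + (m - n))%N.

Lemma sesquilinearJ (q : V -> V -> C) :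
  sesquilinear q -> sesquilinear (fun x y => (q y x)^*).
Proof.
move=> sq; have [lq rq] := sq; split=> [z a x y|a x y z] /=.
  by rewrite rq conjD conjM conjK.
by rewrite (lq z) conjD conjM.
Qed.

Lemma toep_sesquilinear kap n m :
  (forall k, sesquilinear (kap k)) -> sesquilinear (toep kap n m).
Proof.
move=> sk; rewrite /toep; case: (n <= m)%N; first exact: sk.
exact: sesquilinearJ.
Qed.

Lemma toep_hermitian kap n m f g :
  hermitian_form (kap 0%N) -> toep kap n m f g = (toep kap m n g f)^*.
Proof.
move=> h0; rewrite /toep; case: (ltngtP n m) => [_|_|->]; first by rewrite conjK.
  by [].
by rewrite subnn.
Qed.

Lemma tform_sesquilinear kap N :
  (forall k, sesquilinear (kap k)) -> sesquilinear (tform kap N).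
Proof.
move=> sk; split=> [z a x y|a x y z]; rewrite /tform.
- rewrite mulr_sumr -big_split; apply: eq_bigr => n _ /=.
  rewrite mulr_sumr -big_split; apply: eq_bigr => m _ /=.
  by case: (toep_sesquilinear n m sk) => lt _; rewrite (lt _).
- rewrite mulr_sumr -big_split; apply: eq_bigr => n _ /=.
  rewrite mulr_sumr -big_split; apply: eq_bigr => m _ /=.
  by case: (toep_sesquilinear n m sk) => _ rt; rewrite rt.
Qed.

Lemma tform_hermitian kap N :
  hermitian_form (kap 0%N) -> hermitian_form (tform kap N).
Proof.
move=> h0 x y; rewrite /tform exchange_big conj_sum; apply: eq_bigr => n _.
by rewrite conj_sum; apply: eq_bigr => m _; apply: toep_hermitian.
Qed.

Lemma toep_shift kap n m p p' f g :
  (n + p' = m + p)%N -> toep kap p p' f g = toep kap n m f g.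
Proof.
move=> E; rewrite /toep.
have -> : (p <= p')%N = (n <= m)%N by lia.
have -> : (p' - p = m - n)%N by lia.
by have -> : (p - p' = n - m)%N by lia.
Qed.

(** The l entries of h that end at index s, h being read as zero outside the
first N places. Indices are moved by l so that windows overlapping the beginning
are counted with natural numbers. *)
Definition window (l N : nat) h (s p : nat) : V :=
  \sum_(n < N) ((n + l == s + p.+1)%N)%:R *: h n.

(** Places p and p' of a window hold the entries n and m for exactly one window
if n - p = m - p', and for none otherwise. *)
Lemma count_shift (l N n m p p' : nat) : (n < N)%N -> (p < l)%N -> (p' < l)%N ->
  \sum_(s < N + l) ((n + l == s + p.+1)%N)%:R * ((m + l == s + p'.+1)%N)%:R
  = ((n + p' == m + p)%N)%:R :> C.
Proof.
move=> nN pl p'l; have sP : (n + l - p.+1 < N + l)%N by lia.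
rewrite (bigD1 (Ordinal sP)) //= big1 ?addr0 => [|s /eqP sn].
  have -> : (n + l == n + l - p.+1 + p.+1)%N by lia.
  by rewrite mul1r; congr (nat_of_bool _)%:R; lia.
have -> : (n + l == s + p.+1)%N = false.
  by apply/negP => /eqP E; apply: sn; apply/val_inj => /=; lia.
by rewrite mul0r.
Qed.

Lemma exchange_big4 (l N : nat) (F : 'I_l -> 'I_l -> 'I_N -> 'I_N -> C) :
  \sum_p \sum_p' \sum_n \sum_m F p p' n m =
  \sum_n \sum_m \sum_p \sum_p' F p p' n m.
Proof.
transitivity (\sum_p \sum_n \sum_p' \sum_m F p p' n m).
  by apply: eq_bigr => p _; rewrite exchange_big.
rewrite exchange_big; apply: eq_bigr => n _.
transitivity (\sum_p \sum_m \sum_p' F p p' n m).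
  by apply: eq_bigr => p _; rewrite exchange_big.
by rewrite exchange_big.
Qed.

Lemma window_sum (phi : nat -> nat -> V -> V -> C) (l N : nat) h :
  (forall p p', sesquilinear (phi p p')) ->
  \sum_(s < N + l) \sum_(p < l) \sum_(p' < l)
    phi p p' (window l N h s p) (window l N h s p') =
  \sum_(n < N) \sum_(m < N) \sum_(p < l) \sum_(p' < l)
    ((n + p' == m + p)%N)%:R * phi p p' (h n) (h m).
Proof.
move=> sphi.
transitivity (\sum_(s < N + l) \sum_(n < N) \sum_(m < N) \sum_(p < l) \sum_(p' < l)
   (((n + l == s + p.+1)%N)%:R * ((m + l == s + p'.+1)%N)%:R) *
     phi p p' (h n) (h m)).
  apply: eq_bigr => s _; rewrite -exchange_big4.
  apply: eq_bigr => p _; apply: eq_bigr => p' _.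
  rewrite /window sesq_suml //; apply: eq_bigr => n _.
  rewrite sesq_sumr // mulr_sumr; apply: eq_bigr => m _.
  by rewrite conjE conjc_nat mulrA.
rewrite exchange_big; apply: eq_bigr => n _.
rewrite exchange_big; apply: eq_bigr => m _.
rewrite exchange_big; apply: eq_bigr => p _.
rewrite exchange_big; apply: eq_bigr => p' _.
by rewrite -mulr_suml count_shift.
Qed.

Lemma count_lag (l n m : nat) :
  \sum_(p < l) \sum_(p' < l) ((n + p' == m + p)%N)%:R = (l - lag n m)%:R :> C.
Proof.
have half a b : (a <= b)%N ->
    \sum_(p < l) \sum_(p' < l) ((a + p' == b + p)%N)%:R = (l - lag a b)%:R :> C.
  move=> ab.
  transitivity (\sum_(p < l) ((p < l - (b - a))%N)%:R : C).
    apply: eq_bigr => p _; case: ltnP => pl.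
      have p'P : (b + p - a < l)%N by lia.
      rewrite (bigD1 (Ordinal p'P)) //= big1 ?addr0 => [|p' /eqP ne].
        by have -> : (a + (b + p - a) == b + p)%N by lia.
      have -> // : (a + p' == b + p)%N = false.
      by apply/negP => /eqP E; apply: ne; apply/val_inj => /=; lia.
    apply: big1 => p' _; have -> // : (a + p' == b + p)%N = false.
    by have := ltn_ord p'; lia.
  rewrite -natr_sum; congr _%:R.
  have -> : (l - lag a b)%N = (l - (b - a))%N by rewrite /lag; lia.
  have le : (l - (b - a) <= l)%N by lia.
  transitivity (\sum_(p < l | (p < l - (b - a))%N) 1)%N.
    by rewrite [RHS]big_mkcond; apply: eq_bigr => p _; case: (_ < _)%N.
  by rewrite -(big_ord_widen l (fun=> 1%N) le) sum1_card card_ord.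
case: (leqP n m) => [/half//|/ltnW mn].
rewrite exchange_big /=.
transitivity (\sum_(p < l) \sum_(p' < l) ((m + p' == n + p)%N)%:R : C).
  by apply: eq_bigr => p _; apply: eq_bigr => p' _; rewrite eq_sym.
by rewrite half // /lag addnC.
Qed.

(** The weights l - |n - m| are those of the Fejer kernel. *)
Lemma tform_window kap (l N : nat) h : (forall k, sesquilinear (kap k)) ->
  \sum_(s < N + l) tform kap l (window l N h s) (window l N h s) =
  \sum_(n < N) \sum_(m < N) (l - lag n m)%:R * toep kap n m (h n) (h m).
Proof.
move=> sk; rewrite window_sum => [|p p']; last exact: toep_sesquilinear.
apply: eq_bigr => n _; apply: eq_bigr => m _.
rewrite -count_lag mulr_suml; apply: eq_bigr => p _.
rewrite mulr_suml; apply: eq_bigr => p' _.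
by case: eqP => [E|]; rewrite ?mul0r // !mul1r (toep_shift _ _ _ E).
Qed.

(** The kernel <S^k v(f), v(g)> of the vectors v(f) with coordinates gam_p(f) under
the unweighted shift S. *)
Definition gram (l : nat) (gam : nat -> V -> C) (k : nat) (f g : V) : C :=
  \sum_(p < l) gam p f * (gam (p + k)%N g)^*.

(** A Gram kernel is a sum over windows of squares of one functional. *)
Lemma tform_gram (l N : nat) gam h : (forall p, linear_functional (gam p)) ->
  (forall p f, (l <= p)%N -> gam p f = 0) ->
  tform (gram l gam) N h h =
  (\sum_(s < N + l) nrm (\sum_(p < l) gam p (window l N h s p)) ^+ 2)%:C.
Proof.
move=> lg g0.
have := window_sum l N h (fun p p' => rank_one_sesquilinear (lg p) (lg p')).
have -> : \sum_(s < N + l) \sum_(p < l) \sum_(p' < l)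
     gam p (window l N h s p) * (gam p' (window l N h s p'))^* =
   (\sum_(s < N + l) nrm (\sum_(p < l) gam p (window l N h s p)) ^+ 2)%:C.
  rewrite rc_sum; apply: eq_bigr => s _; rewrite -mulJ conj_sum mulr_suml.
  by apply: eq_bigr => p _; rewrite mulr_sumr.
move=> ->; apply: eq_bigr => n _; apply: eq_bigr => m _.
have half a b f g : (a <= b)%N -> gram l gam (b - a) f g =
    \sum_(p < l) \sum_(p' < l) ((a + p' == b + p)%N)%:R * (gam p f * (gam p' g)^*).
  move=> ab; apply: eq_bigr => p _; case: (ltnP (p + (b - a)) l) => pl.
    rewrite (bigD1 (Ordinal pl)) //= big1 ?addr0 => [|p' /eqP ne].
      have -> : (a + (p + (b - a)) == b + p)%N by lia.
      by rewrite mul1r.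
    have -> : (a + p' == b + p)%N = false.
      by apply/negP => /eqP E; apply: ne; apply/val_inj => /=; lia.
    by rewrite mul0r.
  rewrite (g0 (p + (b - a))%N) // conj0 mulr0 big1 // => p' _.
  have -> : (a + p' == b + p)%N = false by have := ltn_ord p'; lia.
  by rewrite mul0r.
rewrite /toep; case: (leqP n m) => [nm|/ltnW mn]; first by rewrite half.
rewrite half // exchange_big conj_sum; apply: eq_bigr => p _.
rewrite conj_sum; apply: eq_bigr => p' _.
by rewrite conjM conjE conjc_nat conjM conjK [_^* * _]mulrC eq_sym.
Qed.

Definition spike (p : nat) (f : V) : nat -> V := fun i => if i == p then f else 0.

Lemma spike_linear p b f g : spike p (b *: f + g) = b *: spike p f + spike p g.
Proof.
apply/funext => i; rewrite -[RHS]/(b *: spike p f i + spike p g i) /spike.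
case: ifP => // _.
by rewrite scaler0 addr0.
Qed.

Lemma tform_spike kap N p p' f g : (forall k, sesquilinear (kap k)) ->
  (p < N)%N -> (p' < N)%N -> tform kap N (spike p f) (spike p' g) = toep kap p p' f g.
Proof.
move=> sk pN p'N; have st n m := toep_sesquilinear n m sk.
rewrite /tform (bigD1 (Ordinal pN)) //= [X in _ + X]big1 ?addr0 => [|n /eqP ne].
  rewrite (bigD1 (Ordinal p'N)) //= big1 ?addr0 => [|m /eqP ne].
    by rewrite /spike !eqxx.
  rewrite {2}/spike ifF ?sesq0r //; apply/negP => /eqP E; apply: ne.
  exact: val_inj.
apply: big1 => m _; rewrite {1}/spike ifF.
  by case: (st n m) => lt _; exact: (linear_functional0 (lt _)).
by apply/negP => /eqP E; apply: ne; apply: val_inj.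
Qed.

Lemma tform_recr kap N h : hermitian_form (kap 0%N) ->
  Re (tform kap N.+1 h h) = Re (tform kap N h h) +
    2 * Re (\sum_(n < N) toep kap n N (h n) (h N)) + Re (kap 0%N (h N) (h N)).
Proof.
move=> h0; rewrite {1}/tform big_ord_recr /=.
under eq_bigr do rewrite big_ord_recr /=.
rewrite big_split /= big_ord_recr /= {4}/toep leqnn subnn !ReD.
have -> : \sum_(i < N) toep kap N i (h N) (h i) =
    (\sum_(n < N) toep kap n N (h n) (h N))^*.
  by rewrite conj_sum; apply: eq_bigr => n _; apply: toep_hermitian.
by rewrite ReJ; ring.
Qed.

End ToeplitzForms.

Section ToeplitzBound.
Context {R : realType} {V : normedModType R[i]}.
Notation C := R[i].

Lemma sum_lag_le (eps : nat -> R) (d : R) n N : (forall k, 0 <= eps k) ->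
  (forall M, \sum_(k < M) eps k <= d) -> (n < N)%N ->
  \sum_(m < N) eps (lag n m) <= 2 * d.
Proof.
move=> e0 ed nN.
rewrite -(big_mkord xpredT (fun m => eps (lag n m))) (big_cat_nat (n := n)) //=; last by lia.
rewrite mulr2n mulrDl !mul1r; apply: lerD; last first.
  apply: le_trans (ed (N - n)%N).
  rewrite -{1}(add0n n) big_addn -(big_mkord xpredT eps) ler_sum_nat // => m _.
  by rewrite (_ : lag n (m + n) = m) // /lag; lia.
apply: le_trans (ed n.+1).
rewrite big_ord_recl ler_wpDl // -(big_mkord xpredT (fun k => eps k.+1)).
rewrite big_nat_rev ler_sum_nat // => m /andP[_ mn].
by rewrite (_ : lag n (0 + n - m.+1) = m.+1) // /lag; lia.
Qed.

(** The Schur test: the bounds eps (lag n m) in a row add up to at most 2 d. *)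
Lemma tform_bound (kap : nat -> V -> V -> C) (eps : nat -> R) (d : R) N h :
  (forall k, 0 <= eps k) -> (forall M, \sum_(k < M) eps k <= d) ->
  (forall k f g, nrm (kap k f g) <= eps k * (nrm f ^+ 2 + nrm g ^+ 2)) ->
  nrm (tform kap N h h) <= 4 * d * \sum_(n < N) nrm (h n) ^+ 2.
Proof.
move=> e0 ed kb.
have tb n m f g : nrm (toep kap n m f g) <= eps (lag n m) * (nrm f ^+ 2 + nrm g ^+ 2).
  rewrite /toep /lag; case: (leqP n m) => nm.
    by rewrite (_ : n - m = 0)%N ?add0n //; lia.
  by rewrite (_ : m - n = 0)%N ?addn0 ?nrmJ; [rewrite addrC|lia].
have step : nrm (tform kap N h h) <=
   \sum_(n < N) \sum_(m < N) (eps (lag n m) * nrm (h n) ^+ 2 +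
                              eps (lag n m) * nrm (h m) ^+ 2).
  apply: le_trans (nrm_sum _ _ _) _; apply: ler_sum => n _.
  apply: le_trans (nrm_sum _ _ _) _; apply: ler_sum => m _.
  by rewrite -mulrDr.
apply: le_trans step _.
have half : \sum_(n < N) \sum_(m < N) eps (lag n m) * nrm (h n) ^+ 2 <=
    2 * d * \sum_(n < N) nrm (h n) ^+ 2.
  rewrite mulr_sumr; apply: ler_sum => n _; rewrite -mulr_suml ler_wpM2r ?sqr_ge0 //.
  exact: sum_lag_le.
under eq_bigr do rewrite big_split /=.
rewrite big_split /= [X in _ + X]exchange_big /=.
have -> : \sum_(j < N) \sum_(i < N) eps (lag i j) * nrm (h j) ^+ 2 =
    \sum_(n < N) \sum_(m < N) eps (lag n m) * nrm (h n) ^+ 2.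
  by apply: eq_bigr => n _; apply: eq_bigr => m _; rewrite /lag addnC.
by have := lerD half half; move/le_trans; apply; rewrite -mulrDl; lra.
Qed.

End ToeplitzBound.

(** * The remainder of a partial dilation *)

Section Remainder.
Context {R : realType} {K : hilbertType R}.
Notation C := R[i].
Variables (A : K -> K) (a : R) (w : nat -> R).
Hypotheses (linA : linear A) (a_ge0 : 0 <= a) (a_lt1 : a < 1)
  (leA : forall f, nrm (A f) <= a * nrm f)
  (w_ge0 : forall n, 0 <= w n) (w_le1 : forall n, w n <= 1).
Implicit Types (u gam : nat -> K -> C) (B : nat).

(** T^k e_n = wprod n k *: e_(n + k) for the shift T with weights w. *)
Definition wprod (n k : nat) : R := \prod_(i < k) w (n + i).

(** What the construction needs from the weights: beyond every B there is a place b
such that products of weights leading from before B to b or beyond are small,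
while products staying among the l weights from b on are close to one. *)
Definition blocks_available := forall (l B : nat) (del : R), 0 < del ->
  exists b, [/\ (B <= b)%N,
    forall n k, (n < B)%N -> (b <= n + k)%N -> wprod n k <= del &
    forall p k, (p + k < l)%N -> 1 - del <= wprod (b + p) k].

(** What is still missing from the kernel <A^k f, g> when U f is the sum of the
vectors u_n(f) e_n with n < B. *)
Definition remainder u B (k : nat) (f g : K) : C :=
  dot (iter k A f) g - \sum_(n < B) (wprod n k)%:C * u n f * (u (n + k)%N g)^*.

Definition supported u B :=
  [/\ forall n, linear_functional (u n),
      forall n f, nrm (u n f) <= nrm f &
      forall n f, (B <= n)%N -> u n f = 0].

Definition coercive (c : R) u B := forall N (h : nat -> K),
  c * \sum_(n < N) nrm (h n) ^+ 2 <= Re (tform (remainder u B) N h h).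

Lemma wprod_ge0 n k : 0 <= wprod n k.
Proof. by apply: prodr_ge0 => i _. Qed.

Lemma wprod_le1 n k : wprod n k <= 1.
Proof. by apply: prodr_ile1 => i; rewrite w_ge0 w_le1. Qed.

Lemma iterA_linear k : linear (iter k A).
Proof. by elim: k => // k IH b x y; rewrite !iterS IH linA. Qed.

Lemma nrm_iterA k f : nrm (iter k A f) <= a ^+ k * nrm f.
Proof.
elim: k => [|k IH]; first by rewrite mul1r.
by rewrite iterS exprS -mulrA (le_trans (leA _)) // ler_wpM2l.
Qed.

Lemma remainder_sesquilinear u B k : supported u B -> sesquilinear (remainder u B k).
Proof.
move=> [lu _ _]; split=> [z b x y|b x y z]; rewrite /remainder.
- rewrite iterA_linear dotDl dotZl mulrBr mulr_sumr addrACA -opprD -big_split.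
  by congr (_ - _); apply: eq_bigr => n _ /=; rewrite lu; ring.
- rewrite dotDr dotZr mulrBr mulr_sumr addrACA -opprD -big_split.
  by congr (_ - _); apply: eq_bigr => n _ /=; rewrite lu conjD conjM; ring.
Qed.

Lemma wprod0 n : wprod n 0 = 1.
Proof. by rewrite /wprod big_ord0. Qed.

Lemma remainder0_hermitian u B : hermitian_form (remainder u B 0).
Proof.
move=> f g; rewrite /remainder conjD conjN conj_sum /= -dotC; congr (_ - _).
apply: eq_bigr => n _; rewrite wprod0 addn0 !conjM conjK conjR; ring.
Qed.

Lemma remainder0E u B f :
  Re (remainder u B 0 f f) = nrm f ^+ 2 - \sum_(n < B) nrm (u n f) ^+ 2.
Proof.
rewrite /remainder /= ReD ReN dotxx ReR Re_sum; congr (_ - _).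
by apply: eq_bigr => n _; rewrite wprod0 addn0 mul1r mulJ ReR.
Qed.

Lemma coercive_psd c u B N (h : nat -> K) : 0 <= c -> coercive c u B ->
  0 <= Re (tform (remainder u B) N h h).
Proof.
move=> c0 /(_ N h); apply: le_trans; rewrite mulr_ge0 // sumr_ge0 // => n _.
exact: sqr_ge0.
Qed.

(** The form evaluated at the sequence with f in place 0 and g in place k. *)
Lemma coercive_remainder c u B k f g : supported u B -> 0 <= c -> coercive c u B ->
  2 * nrm (remainder u B k f g) <=
    Re (remainder u B 0 f f) + Re (remainder u B 0 g g).
Proof.
move=> su c0 cu.
have sr k' := remainder_sesquilinear k' su.
have := @psd_le _ _ _ (spike 0 f) (spike k g) (tform_sesquilinear k.+1 sr)
  (tform_hermitian k.+1 (remainder0_hermitian u B))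
  (fun h => coercive_psd k.+1 h c0 cu).
by rewrite !tform_spike // /toep !leqnn leq0n !subnn subn0.
Qed.

(** With y_n = h_n + A y_(n-1) the form is the sum of |y_n|^2 - |A y_(n-1)|^2, which
is at least (1 - a^2) times the sum of |y_n|^2, and h is controlled by y. *)
Lemma coercive_start :
  coercive ((1 - a ^+ 2) / 4) (fun _ _ => 0) 0.
Proof.
move=> N h.
pose z := fix z n := if n is m.+1 then A (z m + h m) else 0.
have A0 : A 0 = 0.
  by have := linA (-1) 0 0; rewrite scaler0 addr0 scaleN1r addNr.
have AD x y : A (x + y) = A x + A y.
  by have := linA 1 x y; rewrite !scale1r.
have zE n : z n = \sum_(m < n) iter (n - m) A (h m).
  elim: n => [|n IH]; first by rewrite big_ord0.
  rewrite big_ord_recr /= subSnn IH AD; congr (_ + _).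
  have A_sum (F : 'I_n -> K) : A (\sum_(i < n) F i) = \sum_(i < n) A (F i).
    by elim/big_rec2: _ => // i x y _ <-; rewrite AD.
  rewrite A_sum; apply: eq_bigr => m _.
  by rewrite subSn // ltnW.
have rE k f g : remainder (fun _ _ => 0) 0 k f g = dot (iter k A f) g.
  by rewrite /remainder big_ord0 subr0.
have QE : Re (tform (remainder (fun _ _ => 0) 0) N h h) =
    \sum_(n < N) (nrm (z n + h n) ^+ 2 - nrm (z n) ^+ 2).
  elim: N => [|N IH]; first by rewrite /tform !big_ord0.
  rewrite (tform_recr _ _ (remainder0_hermitian _ _)) big_ord_recr /= -IH.
  rewrite nrm2D (_ : \sum_(n < N) _ = dot (z N) (h N)); last first.
    rewrite zE dot_suml; apply: eq_bigr => n _.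
    by rewrite /toep ltnW // rE.
  by rewrite rE dotxx ReR; ring.
have zle n : nrm (z n.+1) ^+ 2 <= a ^+ 2 * nrm (z n + h n) ^+ 2.
  by rewrite /= -exprMn ler_pXn2r ?nnegrE ?mulr_ge0 ?nrm_ge0.
pose Y := \sum_(n < N) nrm (z n + h n) ^+ 2.
have Zle : \sum_(n < N) nrm (z n) ^+ 2 <= a ^+ 2 * Y.
  apply: (@le_trans _ _ (\sum_(n < N.+1) nrm (z n) ^+ 2)).
    by rewrite big_ord_recr /= lerDl sqr_ge0.
  rewrite big_ord_recl /= nrm0 expr0n add0r /Y mulr_sumr.
  by apply: ler_sum => n _; apply: zle.
have Hle : \sum_(n < N) nrm (h n) ^+ 2 <= 2 * Y + 2 * \sum_(n < N) nrm (z n) ^+ 2.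
  rewrite /Y !mulr_sumr -big_split /=; apply: ler_sum => n _.
  have {1}-> : h n = (z n + h n) - z n by rewrite addrC addKr.
  have := nrm2_par (z n + h n) (z n); have := sqr_ge0 (nrm (z n + h n + z n)).
  lra.
have Y0 : 0 <= Y by apply: sumr_ge0 => n _; apply: sqr_ge0.
have a2 : a ^+ 2 <= 1 by rewrite expr_le1 // ltW.
have a2' : 0 <= a ^+ 2 by exact: sqr_ge0.
rewrite QE sumrB -/Y.
have : \sum_(n < N) nrm (h n) ^+ 2 <= 4 * Y by nra.
move: Zle; move: (\sum_(n < N) nrm (z n) ^+ 2) (\sum_(n < N) nrm (h n) ^+ 2) => Z S.
nra.
Qed.

End Remainder.

(** * Appending blocks *)

Section Blocks.
Context {R : realType} {K : hilbertType R}.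
Notation C := R[i].
Variables (A : K -> K) (w : nat -> R).
Hypotheses (w_ge0 : forall n, 0 <= w n) (w_le1 : forall n, w n <= 1)
  (blocks : blocks_available w).
Implicit Types (u gam : nat -> K -> C) (B : nat).
Local Notation remainder := (remainder A w).

Lemma count_interval c l M :
  (\sum_(k < M) ((c <= k < c + l)%N : nat) = minn M (c + l) - c)%N.
Proof.
elim: M => [|M IH]; first by rewrite big_ord0 min0n.
by rewrite big_ord_recr /= IH; case: (boolP (c <= M < c + l)%N); lia.
Qed.

Lemma supported_mask u B b : supported u B ->
  supported (fun n f => if (b <= n)%N then u (n - b)%N f else 0) (b + B).
Proof.
move=> [lu bu zu]; split.
- move=> n x f g; case: ifP => _; [exact: lu|by rewrite mulr0 addr0].
- by move=> n f; case: ifP => _; [exact: bu|rewrite nrm0 nrm_ge0].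
- by move=> n f bn; rewrite ifT ?zu //; lia.
Qed.

Lemma sum_widen (F : nat -> C) B B' : (B <= B')%N ->
  (forall n, (B <= n < B')%N -> F n = 0) -> \sum_(n < B') F n = \sum_(n < B) F n.
Proof.
move=> BB' F0; rewrite (big_ord_widen B' F BB') [RHS]big_mkcond /=.
by apply: eq_bigr => n _; case: ltnP => // Bn; apply: F0; rewrite Bn ltn_ord.
Qed.

Lemma mul_le_sqr (x y : R) : 0 <= x -> 0 <= y -> x * y <= x ^+ 2 + y ^+ 2.
Proof. by move=> x0 y0; have := sqr_ge0 (x - y); rewrite sqrrB; nra. Qed.

(** The new block sits where the weights are close to one, so it contributes
almost exactly its Gram kernel, and far behind a stretch of small weights, so
it hardly interacts with what was there before. *)
Lemma add_block u B gam l del : supported u B -> supported gam l -> 0 < del ->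
  exists u' B', [/\ (B <= B')%N, supported u' B',
    forall n, (n < B)%N -> u' n = u n &
    exists eps : nat -> R, [/\ forall k, 0 <= eps k,
      forall M, \sum_(k < M) eps k <= del &
      forall k f g,
        nrm (remainder u' B' k f g - (remainder u B k f g - gram l gam k f g))
        <= eps k * (nrm f ^+ 2 + nrm g ^+ 2)]].
Proof.
move=> su sg del0.
pose d := del / ((B + l) * l + 1)%:R.
have cnt0 : 0 < ((B + l) * l + 1)%:R :> R by rewrite ltr0n addn1.
have d0 : 0 < d by rewrite divr_gt0.
have [b [Bb small near1]] := blocks l B d0.
pose gs n f := if (b <= n)%N then gam (n - b)%N f else 0.
have sgs : supported gs (b + l) := supported_mask b sg.
pose u' n f := u n f + gs n f.
have [lu bu zu] := su; have [lg bg zg] := sg; have [lgs bgs zgs] := sgs.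
have gs0 n f : (n < b)%N -> gs n f = 0 by rewrite /gs ltnNge => /negPf ->.
have gsE p f : gs (b + p)%N f = gam p f by rewrite /gs leq_addr addKn.
exists u', (b + l)%N; split; first by lia.
- split.
  + by move=> n x f g; rewrite /u' lu lgs; ring.
  + move=> n f; rewrite /u'; case: (ltnP n b) => nb.
      by rewrite gs0 // addr0.
    by rewrite zu ?add0r //; lia.
  + by move=> n f bn; rewrite /u' zu ?zgs ?addr0 //; lia.
- by move=> n nB; apply/funext => f; rewrite /u' gs0 ?addr0 //; lia.
pose eps k := \sum_(n < B) d * ((b <= n + k < b + l)%N : nat)%:R +
              \sum_(p < l) d * ((p + k < l)%N : nat)%:R.
exists eps; split.
- by move=> k; rewrite addr_ge0 // sumr_ge0 // => n _; rewrite mulr_ge0 ?ler0n ?ltW.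
- move=> M; rewrite big_split /= exchange_big [X in _ + X]exchange_big /=.
  have h1 (n : 'I_B) : \sum_(k < M) d * ((b <= n + k < b + l)%N : nat)%:R <= d * l%:R.
    rewrite -mulr_sumr ler_pM2l // -natr_sum ler_nat.
    rewrite (eq_bigr (fun k : 'I_M => ((b - n <= k < (b - n) + l)%N : nat))).
      by rewrite count_interval; lia.
    move=> k _; congr nat_of_bool; have := ltn_ord n; lia.
  have h2 (p : 'I_l) : \sum_(k < M) d * ((p + k < l)%N : nat)%:R <= d * l%:R.
    rewrite -mulr_sumr ler_pM2l // -natr_sum ler_nat.
    apply: (@leq_trans (\sum_(k < M) ((0 <= k < 0 + l)%N : nat))%N).
      by apply: leq_sum => k _; lia.
    by rewrite count_interval; lia.
  apply: le_trans (lerD (ler_sum _ (fun n _ => h1 n)) (ler_sum _ (fun p _ => h2 p))) _.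
  rewrite !sumr_const !card_ord -mulrnDr -[_ *+ (B + l)]mulr_natr -/d.
  have -> : del = d * ((B + l) * l + 1)%:R by rewrite divfK // gt_eqF.
  by rewrite -mulrA ler_pM2l // -natrM ler_nat; lia.
move=> k f g.
have -> : remainder u' (b + l) k f g - (remainder u B k f g - gram l gam k f g) =
  - (\sum_(n < B) (wprod w n k)%:C * u n f * (gs (n + k)%N g)^*)
  + \sum_(p < l) (1 - wprod w (b + p) k)%:C * (gam p f * (gam (p + k)%N g)^*).
  rewrite /remainder; set D := dot _ _.
  rewrite big_split_ord /=.
  have -> : \sum_(n < b) (wprod w n k)%:C * u' n f * (u' (n + k)%N g)^* =
      \sum_(n < B) (wprod w n k)%:C * u n f * (u (n + k)%N g)^* +
      \sum_(n < B) (wprod w n k)%:C * u n f * (gs (n + k)%N g)^*.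
    rewrite (@sum_widen (fun n => (wprod w n k)%:C * u' n f * (u' (n + k)%N g)^*) B) //.
      rewrite -big_split; apply: eq_bigr => n _ /=; rewrite /u' (gs0 n); last first.
        by have := ltn_ord n; lia.
      by rewrite addr0 conjD mulrDr.
    by move=> n /andP[Bn nb]; rewrite /u' zu // gs0 // addr0 mulr0 mul0r.
  have -> : \sum_(p < l) (wprod w (b + p) k)%:C * u' (b + p)%N f * (u' (b + p + k)%N g)^*
     = \sum_(p < l) (wprod w (b + p) k)%:C * (gam p f * (gam (p + k)%N g)^*).
    apply: eq_bigr => p _; rewrite /u' -addnA !gsE !zu ?add0r ?mulrA //; lia.
  rewrite /gram.
  have -> : \sum_(p < l) (1 - wprod w (b + p) k)%:C * (gam p f * (gam (p + k)%N g)^*) =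
    \sum_(p < l) gam p f * (gam (p + k)%N g)^* -
    \sum_(p < l) (wprod w (b + p) k)%:C * (gam p f * (gam (p + k)%N g)^*).
    by rewrite -sumrB; apply: eq_bigr => p _; rewrite rcB mulrBl mul1r.
  by ring.
apply: le_trans (nrmD _ _) _; rewrite nrmN mulrDl.
have fg0 := mul_le_sqr (nrm_ge0 f) (nrm_ge0 g).
have fg1 : 0 <= nrm f ^+ 2 + nrm g ^+ 2 by rewrite addr_ge0 ?sqr_ge0.
apply: lerD; apply: le_trans (nrm_sum _ _ _) _; rewrite mulr_suml; apply: ler_sum => n _.
- rewrite !nrmM nrmR nrmJ (ger0_norm (wprod_ge0 w_ge0 _ _)).
  have [nk|nk] := boolP (b <= n + k < b + l)%N; last first.
    suff -> : gs (n + k)%N g = 0 by rewrite nrm0 mulr0 /= mulr0 mul0r.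
    by move: nk; rewrite negb_and -!ltnNge => /orP[/gs0|/zgs].
  rewrite mulr1 -mulrA; apply: ler_pM; rewrite ?wprod_ge0 ?mulr_ge0 ?nrm_ge0 //.
    by apply: small => //; lia.
  by apply: le_trans fg0; apply: ler_pM; rewrite ?nrm_ge0.
- rewrite !nrmM nrmR nrmJ.
  have [nk|nk] := ltnP (n + k) l; last first.
    by rewrite (zg (n + k)%N) // nrm0 !mulr0 /= mul0r.
  rewrite ger0_norm ?subr_ge0 ?wprod_le1 // mulr1.
  apply: ler_pM; rewrite ?subr_ge0 ?wprod_le1 ?mulr_ge0 ?nrm_ge0 //.
    by have := near1 n k nk; lra.
  by apply: le_trans fg0; apply: ler_pM; rewrite ?nrm_ge0.
Qed.

Lemma add_blocks (gams : seq (nat -> K -> C)) l u B del : supported u B ->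
  (forall gam, List.In gam gams -> supported gam l) -> 0 < del ->
  exists u' B', [/\ (B <= B')%N, supported u' B',
    forall n, (n < B)%N -> u' n = u n &
    exists eps : nat -> R, [/\ forall k, 0 <= eps k,
      forall M, \sum_(k < M) eps k <= del &
      forall k f g,
        nrm (remainder u' B' k f g -
             (remainder u B k f g - \sum_(gam <- gams) gram l gam k f g))
        <= eps k * (nrm f ^+ 2 + nrm g ^+ 2)]].
Proof.
elim: gams u B del => [|gam gams IH] u B del su sg del0.
  exists u, B; split=> //; exists (fun=> 0); split=> // [M|k f g].
    by rewrite big1 // ltW.
  by rewrite big_nil subr0 subrr nrm0 mul0r.
have del2 : 0 < del / 2 by rewrite divr_gt0.
have [u1 [B1 [BB1 su1 E1 [e1 [e10 e1d e1P]]]]] :=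
  add_block su (sg _ (or_introl erefl)) del2.
have [u2 [B2 [BB2 su2 E2 [e2 [e20 e2d e2P]]]]] :=
  IH _ _ _ su1 (fun g gi => sg g (or_intror gi)) del2.
exists u2, B2; split=> //; first by lia.
  by move=> n nB; rewrite E2 ?E1 //; lia.
exists (fun k => e1 k + e2 k); split=> [k|M|k f g]; first by rewrite addr_ge0.
  by rewrite big_split /=; have := e1d M; have := e2d M; lra.
rewrite mulrDl [leRHS]addrC big_cons.
apply: (le_trans _ (lerD (e2P k f g) (e1P k f g))).
apply: (le_trans _ (nrmD _ _)).
by rewrite le_eqVlt; apply/orP; left; apply/eqP; congr nrm; ring.
Qed.

End Blocks.

(** * Absorbing half of the remainder *)

Section TformKernel.
Context {R : realType} {V : lmodType R[i]}.
Implicit Types (kap : nat -> V -> V -> R[i]).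

Lemma tform_eq kap1 kap2 N h : (forall k f g, kap1 k f g = kap2 k f g) ->
  tform kap1 N h h = tform kap2 N h h.
Proof.
move=> E; apply: eq_bigr => n _; apply: eq_bigr => m _.
by rewrite /toep !E.
Qed.

Lemma tformD kap1 kap2 N h :
  tform (fun k f g => kap1 k f g + kap2 k f g) N h h =
  tform kap1 N h h + tform kap2 N h h.
Proof.
rewrite /tform -big_split; apply: eq_bigr => n _ /=.
rewrite -big_split; apply: eq_bigr => m _ /=.
by rewrite /toep; case: ifP => //; rewrite conjD.
Qed.

Lemma tform_scale (r : R) kap N h :
  tform (fun k f g => r%:C * kap k f g) N h h = r%:C * tform kap N h h.
Proof.
rewrite /tform mulr_sumr; apply: eq_bigr => n _.
rewrite mulr_sumr; apply: eq_bigr => m _.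
by rewrite /toep; case: ifP => //; rewrite conjM conjR.
Qed.

Lemma toep_weighted (r : nat -> R) kap n m f g :
  toep (fun k f g => (r k)%:C * kap k f g) n m f g =
  (r (lag n m))%:C * toep kap n m f g.
Proof.
rewrite /toep /lag; case: leqP => nm; first by rewrite (_ : n - m = 0)%N ?add0n //; lia.
by rewrite (_ : m - n = 0)%N ?addn0 ?conjM ?conjR //; lia.
Qed.

Lemma tform_sum I (s : seq I) (kaps : I -> nat -> V -> V -> R[i]) N h :
  tform (fun k f g => \sum_(i <- s) kaps i k f g) N h h =
  \sum_(i <- s) tform (kaps i) N h h.
Proof.
elim: s => [|i s IH].
  rewrite big_nil /tform big1 // => n _; rewrite big1 // => m _.
  by rewrite /toep !big_nil conj0; case: ifP.
rewrite big_cons -IH -tformD; apply: tform_eq => k f g.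
by rewrite big_cons.
Qed.

Lemma tform_ext kap N h h' : (forall n, (n < N)%N -> h n = h' n) ->
  tform kap N h h = tform kap N h' h'.
Proof.
move=> E; apply: eq_bigr => n _; apply: eq_bigr => m _.
by rewrite !E.
Qed.

Lemma sum_spike l (h : nat -> V) n : (n < l)%N ->
  (\sum_(p < l) spike p (h p)) n = h n.
Proof.
move=> nl; rewrite fct_sumE (bigD1 (Ordinal nl)) //= big1 ?addr0.
  by rewrite /spike eqxx.
move=> p /eqP ne; rewrite /spike ifF //; apply/negP => /eqP E; apply: ne.
exact: val_inj.
Qed.

End TformKernel.

Lemma in_sum_le (R : realType) (T : Type) (s : seq T) (F : T -> R) c :
  (forall d, 0 <= F d) -> List.In c s -> F c <= \sum_(d <- s) F d.
Proof.
move=> F0; elim: s => //= d s IH [->|/IH le]; rewrite big_cons.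
  by rewrite lerDl sumr_ge0.
by apply: le_trans le _; rewrite lerDr.
Qed.

Lemma In_map (T : eqType) (S : Type) (F : T -> S) (s : seq T) x :
  x \in s -> List.In (F x) [seq F y | y <- s].
Proof.
by elim: s => //= y s IH; rewrite in_cons => /orP[/eqP->|/IH]; [left|right].
Qed.

(** The sum telescopes: (1 - a)^2 k a^k is the decrement at k of
a^k (k (1 - a) + a). *)
Lemma sum_arith_geom (R : realType) (a : R) N : 0 <= a -> a < 1 ->
  \sum_(k < N) k%:R * a ^+ k <= ((1 - a) ^+ 2)^-1.
Proof.
move=> a0 a1; have a1' : 0 < 1 - a by rewrite subr_gt0.
have E M : (1 - a) ^+ 2 * \sum_(k < M) k%:R * a ^+ k +
    a ^+ M * (M%:R * (1 - a) + a) = a.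
  elim: M => [|M IH]; first by rewrite big_ord0 expr0; ring.
  rewrite big_ord_recr /= -[RHS]IH (exprS a M) -(natr1 M); ring.
rewrite -[leRHS]mul1r ler_pdivlMr ?exprn_gt0 // mulrC.
have := E N; have : 0 <= a ^+ N * (N%:R * (1 - a) + a).
  by rewrite mulr_ge0 ?exprn_ge0 // addr_ge0 // mulr_ge0 // ltW.
move: (\sum_(k < N) _) => S; lra.
Qed.

Section Step.
Context {R : realType} {K : hilbertType R}.
Notation C := R[i].
Variables (A : K -> K) (a : R) (w : nat -> R).
Hypotheses (linA : linear A) (a_ge0 : 0 <= a) (a_lt1 : a < 1)
  (leA : forall f, nrm (A f) <= a * nrm f)
  (w_ge0 : forall n, 0 <= w n) (w_le1 : forall n, w n <= 1)
  (blocks : blocks_available w).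
Implicit Types (u gam : nat -> K -> C) (B : nat).
Local Notation remainder := (remainder A w).
Local Notation coercive := (coercive A w).

Lemma remainder_late u B k f g : supported u B -> (B <= k)%N ->
  remainder u B k f g = dot (iter k A f) g.
Proof.
move=> [_ _ zu] Bk; rewrite /remainder big1 ?subr0 // => n _.
by rewrite (zu (n + k)%N) ?conj0 ?mulr0 //; lia.
Qed.

Lemma remainder0_le u B f : Re (remainder u B 0 f f) <= nrm f ^+ 2.
Proof. by rewrite remainder0E lerBlDr lerDl sumr_ge0 // => n _; rewrite sqr_ge0. Qed.

(** Summable in k, uniformly in f and g: the lags below B are controlled by
positivity, and at larger lags only A contributes. *)
Lemma remainder_bound c u B k f g : supported u B -> 0 <= c -> coercive c u B ->
  nrm (remainder u B k f g) <=
    ((k < B)%N%:R + a ^+ k) * (nrm f ^+ 2 + nrm g ^+ 2).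
Proof.
move=> su c0 cu; have fg0 := mul_le_sqr (nrm_ge0 f) (nrm_ge0 g).
have s0 : 0 <= nrm f ^+ 2 + nrm g ^+ 2 by rewrite addr_ge0 ?sqr_ge0.
have ak : 0 <= a ^+ k by rewrite exprn_ge0.
case: ltnP => kB.
  rewrite [leRHS]mulrDl [1%:R * _]mul1r.
  have := coercive_remainder linA k f g su c0 cu.
  have := remainder0_le u B f; have := remainder0_le u B g.
  have := nrm_ge0 (remainder u B k f g).
  have : 0 <= a ^+ k * (nrm f ^+ 2 + nrm g ^+ 2) by rewrite mulr_ge0.
  move: (a ^+ k * _) => Z; lra.
rewrite remainder_late // add0r; apply: le_trans (nrm_dot _ _) _.
apply: (@le_trans _ _ (a ^+ k * (nrm f * nrm g))); last by rewrite ler_wpM2l.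
by rewrite mulrA ler_wpM2r ?nrm_ge0 // (nrm_iterA a_ge0 leA).
Qed.

Lemma coercive_le c u B f : coercive c u B ->
  c * nrm f ^+ 2 <= Re (remainder u B 0 f f).
Proof.
by move=> /(_ 1%N (fun=> f)); rewrite /tform !big_ord_recr !big_ord0 /= !add0r.
Qed.

(** Half of the remainder, restricted to the multiples of f, is split off as a
sum of squares of functionals on sequences of length l; realised by blocks and
averaged over the windows of length l it costs a Fejer mean of the remainder,
which for large l is close to half of the remainder itself. *)
Lemma absorb_half c u B f0 : supported u B -> 0 < c -> coercive c u B ->
  exists c' u' B', [/\ 0 < c', supported u' B', coercive c' u' B',
    (B <= B')%N /\ (forall n, (n < B)%N -> u' n = u n) &
    Re (remainder u' B' 0 f0 f0) <= 3 / 4 * Re (remainder u B 0 f0 f0)].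
Proof.
move=> su c0 cu; have sr k := remainder_sesquilinear w linA k su.
have hr := remainder0_hermitian A w u B.
have c0' := ltW c0.
pose S : R := (B * B)%:R + ((1 - a) ^+ 2)^-1.
(* S bounds the sum of k |R_k|, so a Fejer mean over windows of length l differs
   from the remainder by at most S / l <= c / 16 in that norm. *)
pose l := (Num.truncn (16 * S / c)).+1.
have l0 : 0 < l%:R :> R by rewrite ltr0n.
have Sl : S / l%:R <= c / 16.
  have : 16 * S / c < l%:R by exact: truncnS_gt.
  rewrite ltr_pdivrMr // ler_pdivrMr //; lra.
pose q := tform (remainder u B) l.
have [cs [lcs le_cs eq_cs]] := sum_of_squares [seq spike p f0 | p <- iota 0 l]
  (tform_sesquilinear l sr) (tform_hermitian l hr)
  (fun h => coercive_psd l h c0' cu).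
(* Each entry is seen by l windows; s^2 = 1/(2l) turns their sum into half an
   average. *)
pose s : R := Num.sqrt (2 * l%:R)^-1.
have s2 : s ^+ 2 = (2 * l%:R)^-1 by rewrite sqr_sqrtr // invr_ge0 mulr_ge0.
have s0 : 0 <= s by exact: sqrtr_ge0.
have s1 : s <= 1.
  rewrite -(ler_pXn2r (_ : (0 < 2)%N)) ?nnegrE // s2 expr1n invf_le1 ?mulr_gt0 //.
  have : 1 <= l%:R :> R by rewrite ler1n.
  lra.
pose gamc (c : (nat -> K) -> C) p f := if (p < l)%N then s%:C * c (spike p f) else 0.
have spikel p f : (p < l)%N -> Re (q (spike p f) (spike p f)) = Re (remainder u B 0 f f).
  by move=> pl; rewrite /q tform_spike // /toep leqnn subnn.
have sgam d : List.In d cs -> supported (gamc d) l.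
  move=> dcs; split; rewrite /gamc.
  - move=> p b f g; case: ifP => _; last by rewrite mulr0 addr0.
    by rewrite spike_linear (lcs _ dcs); ring.
  - move=> p f; case: ifP => pl; last by rewrite nrm0 nrm_ge0.
    rewrite nrmM nrmR ger0_norm // -[leRHS]mul1r; apply: ler_pM; rewrite ?nrm_ge0 //.
    rewrite -(ler_pXn2r (_ : (0 < 2)%N)) ?nnegrE ?nrm_ge0 //.
    apply: le_trans (remainder0_le u B f); rewrite -(spikel p) //.
    apply: le_trans (le_cs _).
    by apply: (in_sum_le (F := fun d => nrm (d (spike p f)) ^+ 2)) => // d'; rewrite sqr_ge0.
  - by move=> p f; rewrite ltnNge => ->.
pose del := c / 32.
have del0 : 0 < del by rewrite divr_gt0.
have [|u' [B' [BB' su' Eu [eps [e0 ed eP]]]]] :=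
    @add_blocks _ _ A w w_ge0 w_le1 blocks [seq gamc d | d <- cs] l u B del su _ del0.
  have H (ds : seq ((nat -> K) -> C)) : (forall d, List.In d ds -> List.In d cs) ->
      forall gam, List.In gam [seq gamc d | d <- ds] -> supported gam l.
    elim: ds => //= d ds IH dc gam [<-|]; first by apply: sgam; apply: dc; left.
    by apply: IH => d' d'i; apply: dc; right.
  exact: H.
pose Dl k f g := remainder u' B' k f g -
   (remainder u B k f g - \sum_(gam <- [seq gamc d | d <- cs]) gram l gam k f g).
have remE k f g : remainder u' B' k f g = (remainder u B k f g +
    (-1)%:C * \sum_(d <- cs) gram l (gamc d) k f g) + Dl k f g.
  by rewrite /Dl big_map rmorphN rmorph1; ring.
exists (c / 4), u', B'; split=> //; first by rewrite divr_gt0.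
- move=> N h; rewrite (tform_eq N h remE).
  pose G k f g := \sum_(d <- cs) gram l (gamc d) k f g.
  rewrite (tformD (fun k f g => remainder u B k f g + (-1)%:C * G k f g) Dl).
  rewrite (tformD (remainder u B) (fun k f g => (-1)%:C * G k f g)) tform_scale.
  rewrite tform_sum.
  set Sh := \sum_(n < N) _.
  have Sh0 : 0 <= Sh by apply: sumr_ge0 => n _; rewrite sqr_ge0.
  have Dbound := tform_bound N h e0 ed eP; rewrite -/Sh in Dbound.
  (* The remainder minus its Fejer mean. *)
  pose k2 k f g := (1 - (l - k)%:R / l%:R : R)%:C * remainder u B k f g.
  have half : Re (\sum_(d <- cs) tform (gram l (gamc d)) N h h) <=
     2^-1 * Re (tform (remainder u B) N h h) - 2^-1 * Re (tform k2 N h h).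
    pose win s := \sum_(p < l) spike p (window l N h s p) : nat -> K.
    apply: (@le_trans _ _ ((2 * l%:R)^-1 * \sum_(t < N + l) Re (q (win t) (win t)))).
      rewrite Re_sum.
      have cE d : List.In d cs -> Re (tform (gram l (gamc d)) N h h) =
          (2 * l%:R)^-1 * \sum_(t < N + l) nrm (d (win t)) ^+ 2.
        move=> dcs; have [lg _ zg] := sgam d dcs; rewrite tform_gram // ReR mulr_sumr.
        apply: eq_bigr => t _; rewrite -s2 -(ger0_norm s0) -nrmR -exprMn -nrmM.
        congr (nrm _ ^+ 2); rewrite /win (linear_functional_sum _ _ _ (lcs d dcs)) mulr_sumr.
        by apply: eq_bigr => p _; rewrite /gamc ltn_ord.
      have -> : \sum_(d <- cs) Re (tform (gram l (gamc d)) N h h) =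
          \sum_(d <- cs) (2 * l%:R)^-1 * \sum_(t < N + l) nrm (d (win t)) ^+ 2.
        elim: (cs) cE => [|d ds IH] cE; first by rewrite !big_nil.
        rewrite !big_cons cE; last by left.
        by rewrite IH // => d' d'i; apply: cE; right.
      rewrite -mulr_sumr ler_wpM2l ?invr_ge0 ?mulr_ge0 // exchange_big /=.
      by apply: ler_sum => t _; apply: le_cs.
    rewrite -Re_sum (eq_bigr (fun t : 'I_(N + l) =>
        tform (remainder u B) l (window l N h t) (window l N h t))); last first.
      by move=> t _; apply: tform_ext => n nl; rewrite /win sum_spike.
    have E : tform (remainder u B) N h h - tform k2 N h h = (l%:R^-1)%:C *
        \sum_(n < N) \sum_(m < N) (l - lag n m)%:R * toep (remainder u B) n m (h n) (h m).
      rewrite /tform -sumrB mulr_sumr; apply: eq_bigr => n _.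
      rewrite -sumrB mulr_sumr; apply: eq_bigr => m _.
      by rewrite toep_weighted rcB rcM rcV !rc_nat; ring.
    rewrite tform_window // invfM -mulrA -Re_scale -E ReD ReN.
    by rewrite le_eqVlt; apply/orP; left; apply/eqP; ring.
  pose e2 k : R := k%:R / l%:R * ((k < B)%N%:R + a ^+ k).
  have e20 k : 0 <= e2 k.
    by rewrite /e2 mulr_ge0 ?divr_ge0 // addr_ge0 // exprn_ge0.
  have e2d M : \sum_(k < M) e2 k <= c / 16.
    apply: le_trans Sl; rewrite mulrC.
    have -> : \sum_(k < M) e2 k = l%:R^-1 * (\sum_(k < M) (k * (k < B))%N%:R +
        \sum_(k < M) k%:R * a ^+ k).
      rewrite -big_split mulr_sumr; apply: eq_bigr => k _ /=.
      by rewrite /e2 natrM; ring.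
    rewrite ler_wpM2l ?invr_ge0 // lerD ?sum_arith_geom // -natr_sum ler_nat.
    apply: (@leq_trans (\sum_(k < M) B * ((0 <= k < 0 + B)%N : nat))%N).
      apply: leq_sum => k _; rewrite leq0n add0n /=.
      by case: ltnP => kB; rewrite ?muln0 ?muln1 // ltnW.
    by rewrite -big_distrr (count_interval 0 B M) leq_mul2l subn0 add0n geq_minr orbT.
  have e2P k f g : nrm (k2 k f g) <= e2 k * (nrm f ^+ 2 + nrm g ^+ 2).
    rewrite /k2 nrmM nrmR /e2 -(mulrA (k%:R / l%:R)); apply: ler_pM; rewrite ?nrm_ge0 //; last first.
      exact: (remainder_bound k f g su c0' cu).
    have kl : (l - k)%:R / l%:R <= 1 :> R.
      by rewrite ler_pdivrMr // mul1r ler_nat leq_subr.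
    rewrite ger0_norm ?subr_ge0 // lerBlDr -mulrDl ler_pdivlMr // mul1r -natrD ler_nat.
    by rewrite -leq_subLR.
  have kbound := tform_bound N h e20 e2d e2P; rewrite -/Sh in kbound.
  have := cu N h; rewrite -/Sh => cuS.
  have := ge_Re_nrm (tform k2 N h h); have := ge_Re_nrm (tform Dl N h h).
  rewrite ReD ReD Re_scale.
  move: half kbound Dbound; rewrite /del.
  move: (Re (tform k2 N h h)) (Re (tform Dl N h h)) (Re (\sum_(d <- cs) _)).
  move: (nrm (tform k2 N h h)) (nrm (tform Dl N h h)).
  move: (Re (tform (remainder u B) N h h)) cuS => r0 cuS n2 nD r2 rD rG. lra.
- rewrite remE ReD ReD Re_scale.
  have -> : Re (\sum_(d <- cs) gram l (gamc d) 0 f0 f0) =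
      2^-1 * Re (remainder u B 0 f0 f0).
    rewrite Re_sum.
    have -> : \sum_(d <- cs) Re (gram l (gamc d) 0 f0 f0) =
        \sum_(p < l) \sum_(d <- cs) s ^+ 2 * nrm (d (spike p f0)) ^+ 2.
      rewrite exchange_big /=; apply: eq_bigr => d _; rewrite /gram Re_sum.
      apply: eq_bigr => p _; rewrite addn0 mulJ ReR /gamc ltn_ord nrmM nrmR.
      by rewrite ger0_norm // exprMn.
    rewrite (eq_bigr (fun=> s ^+ 2 * Re (remainder u B 0 f0 f0))); last first.
      move=> p _; rewrite -mulr_sumr eq_cs ?spikel //.
      by apply: (@In_map _ _ (fun i => spike i f0)); rewrite mem_iota add0n leq0n ltn_ord.
    rewrite sumr_const card_ord -mulr_natr s2 invfM; field.
    by rewrite gt_eqF.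
  have D0 : Re (Dl 0%N f0 f0) <= c / 16 * nrm f0 ^+ 2.
    apply: le_trans (le_Re_nrm _) _; apply: le_trans (eP _ _ _) _.
    have := ed 1%N; rewrite big_ord_recr big_ord0 /= add0r /del => e1.
    have := sqr_ge0 (nrm f0); move: (nrm f0 ^+ 2) => n; nra.
  have := coercive_le f0 cu; move: D0.
  have := sqr_ge0 (nrm f0); have := mulr_ge0 c0' (sqr_ge0 (nrm f0)).
  move: (Re (Dl _ _ _)) (Re (remainder _ _ _ _ _)) => D r.
  move: (nrm f0 ^+ 2) => n; nra.
Qed.

End Step.

(** * The power dilation *)

(** The 2-adic valuation schedules countably many tasks so that each of them
recurs for ever. *)
Lemma schedule_infinite i M : exists2 m, (M <= m)%N & logn 2 m.+1 = i.
Proof.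
have pos : (0 < 2 ^ i * (2 * M + 1))%N by rewrite muln_gt0 expn_gt0 addn1.
exists (2 ^ i * (2 * M + 1)).-1.
  rewrite -ltnS prednK //; apply: (@leq_trans (2 * M + 1)); first by lia.
  by rewrite leq_pmull // expn_gt0.
rewrite prednK // lognM ?expn_gt0 ?addn1 // pfactorK // lognE.
by rewrite dvdn2 /= oddM /= addn0.
Qed.

Section Dilation.
Context {R : realType} {K H : hilbertType R}.
Notation C := R[i].
Variables (A : K -> K) (a : R) (w : nat -> R).
Hypotheses (linA : linear A) (a_ge0 : 0 <= a) (a_lt1 : a < 1)
  (leA : forall f, nrm (A f) <= a * nrm f)
  (w_ge0 : forall n, 0 <= w n) (w_le1 : forall n, w n <= 1)
  (blocks : blocks_available w).
Variables (e : nat -> H) (T : H -> H) (t : R).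
Hypotheses (orthoe : forall i j, dot (e i) (e j) = (i == j)%:R)
  (linT : linear T) (leT : forall x, nrm (T x) <= t * nrm x)
  (Te : forall n, T (e n) = (w n)%:C *: e n.+1).
Variable fs : nat -> K.
Hypothesis fs_total : forall M : set K, closed_subspace M ->
  (forall n, M (fs n)) -> forall x, M x.
Implicit Types (u : nat -> K -> C) (B : nat).
Local Notation remainder := (remainder A w).

Lemma iterT_linear k : linear (iter k T).
Proof. by elim: k => // k IH b x y; rewrite !iterS IH linT. Qed.

Lemma iterT_sum k I (s : seq I) (b : I -> C) (F : I -> H) :
  iter k T (\sum_(i <- s) b i *: F i) = \sum_(i <- s) b i *: iter k T (F i).
Proof.
have T0 : iter k T 0 = 0.
  by have := iterT_linear k (-1) 0 0; rewrite scaler0 addr0 scaleN1r addNr.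
by elim/big_rec2: _ => [|i x y _ <-]; rewrite ?iterT_linear.
Qed.

Lemma iterT_e k n : iter k T (e n) = (wprod w n k)%:C *: e (n + k)%N.
Proof.
have TZ b x : T (b *: x) = b *: T x.
  have T0 : T 0 = 0 by have := linT (-1) 0 0; rewrite scaler0 addr0 scaleN1r addNr.
  by have := linT b x 0; rewrite T0 !addr0.
elim: k => [|k IH]; first by rewrite addn0 /wprod big_ord0 scale1r.
by rewrite iterS IH TZ Te scalerA -rcM addnS /wprod big_ord_recr.
Qed.

Lemma nrm_iterT k x : nrm (iter k T x) <= `|t| ^+ k * nrm x.
Proof.
elim: k => [|k IH]; first by rewrite mul1r.
rewrite iterS exprS -mulrA (le_trans (leT _)) //.
apply: (@le_trans _ _ (`|t| * nrm (iter k T x))).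
  by rewrite ler_wpM2r ?nrm_ge0 ?ler_norm.
by rewrite ler_wpM2l.
Qed.

Definition synth u B f : H := \sum_(n < B) u n f *: e n.

Lemma synth_linear u B : supported u B -> linear (synth u B).
Proof.
move=> [lu _ _] b f g; rewrite /synth scaler_sumr -big_split.
by apply: eq_bigr => n _; rewrite lu scalerDl scalerA.
Qed.

Lemma dot_synth u B k f g : supported u B ->
  dot (iter k T (synth u B f)) (synth u B g) =
  dot (iter k A f) g - remainder u B k f g.
Proof.
move=> [_ _ zu]; rewrite /remainder opprB addrC subrK /synth.
rewrite iterT_sum dot_suml; apply: eq_bigr => n _.
rewrite iterT_e scalerA dotZl dot_sumr mulrC.
have [nB|nB] := ltnP (n + k) B; last first.
  rewrite (zu (n + k)%N) // conj0 mulr0 big1 ?mul0r // => m _; rewrite dotZr orthoe.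
  by rewrite (_ : (n + k == m)%N = false) ?mulr0 //; have := ltn_ord m; lia.
rewrite (bigD1 (Ordinal nB)) //= dotZr orthoe eqxx mulr1 big1 ?addr0.
  by ring.
move=> m /eqP ne; rewrite dotZr orthoe (_ : (n + k == m)%N = false) ?mulr0 //.
by apply/negP => /eqP E; apply: ne; exact: val_inj.
Qed.

Lemma nrm_synthB u u' B B' f : (B <= B')%N -> (forall n, (n < B)%N -> u' n = u n) ->
  nrm (synth u' B' f - synth u B f) ^+ 2 =
  \sum_(n < B') nrm (u' n f) ^+ 2 - \sum_(n < B) nrm (u n f) ^+ 2.
Proof.
move=> BB' E.
have -> : synth u' B' f - synth u B f = \sum_(B <= n < B') u' n f *: e n.
  rewrite /synth -(big_mkord xpredT (fun n => u' n f *: e n)).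
  rewrite (big_cat_nat (n := B)) //= big_mkord addrC (eq_bigr (fun n : 'I_B => u n f *: e n)).
    by rewrite addrK.
  by move=> n _; rewrite E.
have -> : \sum_(n < B') nrm (u' n f) ^+ 2 - \sum_(n < B) nrm (u n f) ^+ 2 =
    \sum_(B <= n < B') nrm (u' n f) ^+ 2.
  rewrite -(big_mkord xpredT (fun n => nrm (u' n f) ^+ 2)).
  rewrite (big_cat_nat (n := B)) //= big_mkord addrC (eq_bigr (fun n : 'I_B => nrm (u n f) ^+ 2)).
    by rewrite addrK.
  by move=> n _; rewrite E.
apply: complexI; rewrite -dotxx rc_sum dot_suml; apply: eq_big_nat => n nB.
rewrite dotZl dot_sumr (bigD1_seq n) ?iota_uniq ?mem_index_iota //= dotZr orthoe eqxx mulr1.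
rewrite big1_seq ?addr0 ?mulJ // => m /andP[mn _].
by rewrite dotZr orthoe eq_sym (negPf mn) mulr0.
Qed.

Theorem power_dilation : exists U : K -> H, linear U /\
  forall k f g, dot (iter k T (U f)) (U g) = dot (iter k A f) g.
Proof.
pose good (s : (nat -> K -> C) * nat) := exists c,
  [/\ 0 < c, supported s.1 s.2 & coercive A w c s.1 s.2].
pose state := {s | good s}.
have next (sf : state * K) : exists s' : state,
    [/\ ((sval sf.1).2 <= (sval s').2)%N,
     forall n, (n < (sval sf.1).2)%N -> (sval s').1 n = (sval sf.1).1 n &
     Re (remainder (sval s').1 (sval s').2 0 sf.2 sf.2) <=
       3 / 4 * Re (remainder (sval sf.1).1 (sval sf.1).2 0 sf.2 sf.2)].
  case: sf => -[[u B] /= [c [c0 su cu]]] f0.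
  have [c' [u' [B' [c'0 su' cu' [BB' E] le34]]]] :=
    absorb_half linA a_ge0 a_lt1 leA w_ge0 w_le1 blocks f0 su c0 cu.
  have gd : good (u', B') by exists c'.
  by exists (exist _ (u', B') gd).
have [step stepP] := choice next.
have good0 : good ((fun _ _ => 0), 0%N).
  exists ((1 - a ^+ 2) / 4); split.
  - by rewrite divr_gt0 // subr_gt0 expr_lt1.
  - split=> // [n b f g|n f]; first by rewrite mulr0 addr0.
    by rewrite nrm0 nrm_ge0.
  - exact: coercive_start.
(* Stage m works on the vector with index the 2-adic valuation of m + 1. *)
pose st := fix st m : state :=
  if m is p.+1 then step (st p, fs (logn 2 p.+1)) else exist _ _ good0.
pose u m := (sval (st m)).1; pose B m := (sval (st m)).2.
have su m : supported (u m) (B m) by have [c []] := svalP (st m).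
have BS m : (B m <= B m.+1)%N by have [] := stepP (st m, fs (logn 2 m.+1)).
have uS m n : (n < B m)%N -> u m.+1 n = u m n.
  by have [_ + _] := stepP (st m, fs (logn 2 m.+1)); apply.
pose r m f := Re (remainder (u m) (B m) 0 f f).
have r34 m : r m.+1 (fs (logn 2 m.+1)) <= 3 / 4 * r m (fs (logn 2 m.+1)).
  by have [_ _ +] := stepP (st m, fs (logn 2 m.+1)); apply.
have Bmono m d : (B m <= B (m + d))%N.
  by elim: d => [|d IH]; rewrite ?addn0 // addnS (leq_trans IH).
have umono m d n : (n < B m)%N -> u (m + d)%N n = u m n.
  move=> nB; elim: d => [|d IH]; first by rewrite addn0.
  by rewrite addnS uS // (leq_trans nB).
have r_ge0 m f : 0 <= r m f.
  have [c [c0 _ cu]] := svalP (st m).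
  by apply: le_trans (coercive_le f cu); rewrite mulr_ge0 ?sqr_ge0 // ltW.
have rle m f : r m f <= nrm f ^+ 2 by exact: remainder0_le.
pose U_ m := synth (u m) (B m).
have UB m d f : nrm (U_ (m + d)%N f - U_ m f) ^+ 2 = r m f - r (m + d)%N f.
  rewrite /U_ nrm_synthB // => [|n nB]; last by rewrite umono.
  by rewrite /r !remainder0E; ring.
have rmono m d f : r (m + d)%N f <= r m f.
  by rewrite -subr_ge0 -UB sqr_ge0.
have rZ m b f : r m (b *: f) = nrm b ^+ 2 * r m f.
  rewrite /r !remainder0E nrmZ exprMn mulrBr mulr_sumr; congr (_ - _).
  apply: eq_bigr => n _; have [lu _ _] := su m.
  by rewrite (linear_functionalZ _ _ (lu n)) nrmM exprMn.
have rD m f g : r m (f + g) <= 2 * r m f + 2 * r m g.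
  have sr := remainder_sesquilinear w linA 0 (su m); have [lr _] := sr.
  have := r_ge0 m (f + (-1) *: g); rewrite /r.
  rewrite !(linear_functionalD _ _ (lr _)) !(linear_functionalZ _ _ (lr _)).
  rewrite !(sesqDr _ _ _ sr) !(sesqZr _ _ _ sr).
  rewrite conjN (conj_nat 1) !mulN1r.
  move: (remainder _ _ _ f f) (remainder _ _ _ f g) (remainder _ _ _ g f)
    (remainder _ _ _ g g) => x y z v.
  rewrite !(ReD, ReN); lra.
(* The vectors with vanishing remainder form a closed subspace, and the f_i are
   in it. *)
have vanish f (eps : R) : 0 < eps -> exists m, r m f <= eps.
  move: f eps; apply: (fs_total (M := [set f | forall eps : R, 0 < eps ->
     exists m, r m f <= eps])).
    split.
    - move=> eps e0; exists 0%N; apply: le_trans (rle _ _) _.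
      by rewrite nrm0 expr0n ltW.
    - move=> b f g /= zf zg eps e0.
      have [m1 h1] := zf (eps / (4 * (nrm b ^+ 2 + 1)))
        (ltac:(by rewrite divr_gt0 // mulr_gt0 // ltr_wpDl ?sqr_ge0)).
      have [m2 h2] := zg (eps / 4) (ltac:(by rewrite divr_gt0)).
      exists (m1 + m2)%N; apply: le_trans (rD _ _ _) _; rewrite rZ.
      have := rmono m1 m2 f; have := rmono m2 m1 g; rewrite (addnC m2) => g2 f1.
      have nb : 0 <= nrm b ^+ 2 by rewrite sqr_ge0.
      have : nrm b ^+ 2 * r (m1 + m2)%N f <= eps / 4.
        apply: (@le_trans _ _ ((nrm b ^+ 2 + 1) * (eps / (4 * (nrm b ^+ 2 + 1))))).
          by apply: ler_pM => //; [rewrite lerDl|apply: le_trans f1 h1].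
        rewrite le_eqVlt; apply/orP; left; apply/eqP; field.
        by rewrite gt_eqF // ltr_wpDl.
      lra.
    - apply: approx_closed => f ap eps e0 /=.
      have d0 : 0 < Num.sqrt (eps / 4) by rewrite sqrtr_gt0 divr_gt0.
      have [y zy fy] := ap _ d0.
      have [m hm] := zy (eps / 4) (ltac:(by rewrite divr_gt0)).
      exists m; rewrite -[f](subrK y); apply: le_trans (rD _ _ _) _.
      have : r m (f - y) <= eps / 4.
        apply: le_trans (rle _ _) _; rewrite -[leRHS]sqr_sqrtr ?divr_ge0 ?ltW //.
        by rewrite ltr_pXn2r ?nnegrE ?nrm_ge0 // ltW.
      lra.
  move=> i eps e0 /=.
  have decay j : exists m, r m (fs i) <= (3 / 4) ^+ j * nrm (fs i) ^+ 2.
    elim: j => [|j [m IH]]; first by exists 0%N; rewrite expr0 mul1r.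
    have [p mp pi] := schedule_infinite i m.
    exists p.+1; have := r34 p; rewrite pi => h; apply: le_trans h _.
    rewrite (exprS (3 / 4) j) -[leRHS]mulrA ler_pM2l //; apply: le_trans IH.
    by rewrite -(subnKC mp).
  have [j hj] : exists j, (3 / 4) ^+ j * nrm (fs i) ^+ 2 <= eps.
    have q1 : `|3 / 4 : R| < 1 by rewrite ger0_norm; lra.
    have n1 : 0 < nrm (fs i) ^+ 2 + 1 by rewrite ltr_wpDl ?sqr_ge0.
    have /cvgrPdist_lt /(_ _ (divr_gt0 e0 n1)) [j _ /(_ j (leqnn j))] := cvg_expr q1.
    rewrite /= sub0r normrN ger0_norm; last by rewrite exprn_ge0.
    rewrite ltr_pdivlMr // => /ltW h; exists j; apply: le_trans h.
    by rewrite ler_wpM2l ?exprn_ge0 // lerDl.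
  by have [m hm] := decay j; exists m; apply: le_trans hm hj.
have late f (eps : R) : 0 < eps -> exists m0, forall m, (m0 <= m)%N -> r m f <= eps.
  move=> /vanish-/(_ f)[m0 h0]; exists m0 => m mm.
  by rewrite -(subnKC mm); apply: le_trans (rmono _ _ _) h0.
have limU f : exists l, forall eps : R, 0 < eps ->
    exists N, forall m, (N <= m)%N -> nrm (l - U_ m f) < eps.
  apply: hilbert_complete => eps e0.
  have [m0 h0] := late f (eps ^+ 2 / 2) (ltac:(by rewrite divr_gt0 ?exprn_gt0)).
  exists m0.
  (* Consecutive pieces are orthogonal, so their squared norms add up to the
   decrease of the remainder. *)
have half m d : (m0 <= m)%N -> nrm (U_ (m + d)%N f - U_ m f) < eps.
    move=> mm; rewrite -(ltr_pXn2r (_ : (0 < 2)%N)) ?nnegrE ?nrm_ge0 ?(ltW e0) // UB.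
    have := h0 m mm; have := r_ge0 (m + d)%N f.
    have : 0 < eps ^+ 2 by rewrite exprn_gt0.
    lra.
  move=> m n mm nn; case: (leqP m n) => [mn|/ltnW nm].
    by rewrite nrmB -(subnKC mn) half.
  by rewrite -(subnKC nm) half.
have [U UP] := choice limU.
exists U; split.
  move=> b f g; apply/eqP; rewrite -subr_eq0; apply/eqP.
  apply: (@nrm_le_eps _ _ _ (1 + nrm b + 1)) => eps e0.
  have [N1 h1] := UP (b *: f + g) eps e0.
  have [N2 h2] := UP f eps e0; have [N3 h3] := UP g eps e0.
  pose m := (N1 + N2 + N3)%N.
  have := h1 m; have := h2 m; have := h3 m => /(_ _)/ltW-H3 /(_ _)/ltW-H2 /(_ _)/ltW-H1.
  have -> : U (b *: f + g) - (b *: U f + U g) =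
     (U (b *: f + g) - U_ m (b *: f + g)) - b *: (U f - U_ m f) - (U g - U_ m g).
    rewrite (synth_linear (su m) b f g : U_ m _ = _) scalerBr.
    by rewrite !opprB -[RHS]addrA [X in _ = _ + X]addrACA -[X in _ = _ + (_ + X)]opprD subrKA.
  apply: le_trans (nrmD _ _) _; rewrite nrmN !mulrDl !mul1r; apply: lerD; last first.
    by apply: H3; rewrite /m; lia.
  apply: le_trans (nrmD _ _) _; rewrite nrmN nrmZ; apply: lerD; last first.
    by rewrite ler_wpM2l ?nrm_ge0 // H2 // /m; lia.
  by apply: H1; rewrite /m; lia.
move=> k f g; apply/eqP; rewrite -subr_eq0; apply/eqP.
pose c := `|t| ^+ k.
have c0 : 0 <= c by rewrite exprn_ge0.
apply: (@nrm_le_eps _ _ _ (c * nrm (U g) + c * nrm f + 1)) => eps e0.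
have [N1 h1] := UP f eps e0; have [N2 h2] := UP g eps e0.
have [N3 h3] := late f eps e0; have [N4 h4] := late g eps e0.
pose m := (N1 + N2 + N3 + N4)%N.
have H1 : nrm (U f - U_ m f) <= eps by apply/ltW/h1; rewrite /m; lia.
have H2 : nrm (U g - U_ m g) <= eps by apply/ltW/h2; rewrite /m; lia.
have H3 : r m f <= eps by apply: h3; rewrite /m; lia.
have H4 : r m g <= eps by apply: h4; rewrite /m; lia.
have nU : nrm (U_ m f) <= nrm f.
  rewrite -(ler_pXn2r (_ : (0 < 2)%N)) ?nnegrE ?nrm_ge0 //.
  have := dot_synth 0 f f (su m); rewrite /= !dotxx => /(congr1 (@complex.Re R)).
  rewrite ReD ReN !ReR -/(U_ m f) -/(r m f) => ->.
  by have := r_ge0 m f; lra.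
have itB x y : iter k T (x - y) = iter k T x - iter k T y.
  by rewrite [x - y]addrC -[- y]scaleN1r iterT_linear scaleN1r addrC.
have -> : dot (iter k T (U f)) (U g) - dot (iter k A f) g =
   dot (iter k T (U f - U_ m f)) (U g) + dot (iter k T (U_ m f)) (U g - U_ m g)
   - remainder (u m) (B m) k f g.
  by rewrite itB dotBl dotBr (dot_synth k f g (su m)); ring.
apply: le_trans (nrmD _ _) _; rewrite nrmN !mulrDl !mul1r; apply: lerD; last first.
  have [d [d0 _ cu]] := svalP (st m).
  have := coercive_remainder linA k f g (su m) (ltW d0) cu.
  rewrite -/(r m f) -/(r m g); lra.
apply: le_trans (nrmD _ _) _; apply: lerD; apply: le_trans (nrm_dot _ _) _.
  rewrite mulrAC ler_wpM2r ?nrm_ge0 //; apply: le_trans (nrm_iterT _ _) _.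
  by rewrite ler_wpM2l.
apply: ler_pM; rewrite ?nrm_ge0 //; apply: le_trans (nrm_iterT _ _) _.
by rewrite ler_wpM2l.
Qed.

End Dilation.

(** * Compressions to semi-invariant subspaces *)

Section Hull.
Context {R : realType} {H : hilbertType R}.
Variables (T : H -> H) (t : R).
Hypotheses (linT : linear T) (leT : forall x, nrm (T x) <= t * nrm x).
Implicit Types (S M : set H).

Lemma linTB x y : T (x - y) = T x - T y.
Proof. by rewrite [x - y]addrC -[- y]scaleN1r linT scaleN1r addrC. Qed.

Lemma closed_subspace_preimage M : closed_subspace M -> closed_subspace (T @^-1` M).
Proof.
move=> cM; have [M0 lM clM] := cM; split.
- by rewrite /= (_ : T 0 = 0) // -[X in T X](subrr 0) linTB subrr.
- by move=> b x y Mx My; rewrite /= linT; apply: lM.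
- apply: approx_closed => x ap /=; apply: closed_approx => // eps e0.
  have t1 : 0 < `|t| + 1 by rewrite ltr_wpDl.
  have [y My xy] := ap (eps / (`|t| + 1)) (divr_gt0 e0 t1).
  exists (T y) => //; rewrite -linTB; apply: le_lt_trans (leT _) _.
  apply: (@le_lt_trans _ _ ((`|t| + 1) * nrm (x - y))).
    rewrite ler_wpM2r ?nrm_ge0 //; apply: le_trans (ler_norm _) _.
    by rewrite lerDl.
  by rewrite mulrC -ltr_pdivlMr.
Qed.

Definition orbit_hull S : set H :=
  smallest closed_subspace [set y | exists k x, S x /\ y = iter k T x].

Lemma orbit_hull_Lat S : Lat T (orbit_hull S).
Proof.
have cM := smallest_closed_subspace [set y | exists k x, S x /\ y = iter k T x].
split=> // _ [x hx <-].
apply: (hx (T @^-1` orbit_hull S)); split; first exact: closed_subspace_preimage.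
move=> _ /= [k [y [Sy ->]]].
suff : orbit_hull S (iter k.+1 T y) by [].
by apply: sub_gen_smallest; exists k.+1, y.
Qed.

Lemma sub_orbit_hull S : S `<=` orbit_hull S.
Proof. by move=> x Sx; apply: sub_gen_smallest; exists 0%N, x. Qed.

End Hull.

Section Compression.
Context {R : realType} {K H : hilbertType R}.
Variables (A : K -> K) (a : R) (T : H -> H) (t : R) (U : K -> H).
Hypotheses (linA : linear A) (leA : forall f, nrm (A f) <= a * nrm f)
  (linT : linear T) (leT : forall x, nrm (T x) <= t * nrm x) (linU : linear U)
  (dilU : forall k f g, dot (iter k T (U f)) (U g) = dot (iter k A f) g).

Lemma dilation_isometry f g : dot (U f) (U g) = dot f g.
Proof. exact: dilU 0%N f g. Qed.

Lemma nrmU f : nrm (U f) = nrm f.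
Proof.
have /(congr1 (@complex.Re R)) := dilation_isometry f f.
rewrite !dotxx !ReR => /eqP; rewrite eqrXn2 ?nrm_ge0 //.
by move/eqP.
Qed.

Lemma linUB f g : U (f - g) = U f - U g.
Proof. by rewrite [f - g]addrC -[- g]scaleN1r linU scaleN1r addrC. Qed.

(** An isometry carries Cauchy sequences back to the complete space K. *)
Lemma range_closed : closed_subspace (range U).
Proof.
split.
- by exists 0 => //; rewrite -[X in U X](subrr 0) linUB subrr.
- by move=> b _ _ [f _ <-] [g _ <-]; exists (b *: f + g); rewrite ?linU.
apply: approx_closed => x ap.
have [u uP] : {u : nat -> K & forall n, nrm (x - U (u n)) < n.+1%:R^-1}.
  apply: (@choice nat K (fun n f => nrm (x - U f) < n.+1%:R^-1)) => n.
  have [_ [f _ <-] xf] := ap n.+1%:R^-1 (ltac:(by rewrite invr_gt0)).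
  by exists f.
have small (e : R) : 0 < e -> exists N, forall n, (N <= n)%N -> n.+1%:R^-1 < e.
  move=> e0; exists (Num.truncn e^-1) => n Nn.
  rewrite invf_plt ?posrE //.
  by apply: lt_le_trans (truncnS_gt _) _; rewrite ler_nat ltnS.
have [l lP] : exists l, forall eps : R, 0 < eps ->
     exists N, forall n, (N <= n)%N -> nrm (l - u n) < eps.
  apply: hilbert_complete => eps e0.
  have [N NP] := small (eps / 2) (ltac:(by rewrite divr_gt0)).
  exists N => m n /NP Nm /NP Nn; rewrite -nrmU linUB.
  apply: le_lt_trans (nrm_triangle x _ _) _; rewrite nrmB.
  have := uP m; have := uP n; move: Nm Nn.
  by move: (m.+1%:R^-1) (n.+1%:R^-1) => x1 x2; lra.
exists l => //; apply/esym/eqP; rewrite -subr_eq0; apply/eqP.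
apply: (@nrm_le_eps _ _ _ 1) => eps e0; rewrite mul1r.
have [N1 h1] := lP (eps / 2) (ltac:(by rewrite divr_gt0)).
have [N2 h2] := small (eps / 2) (ltac:(by rewrite divr_gt0)).
have l1 := h1 _ (leq_addr N2 N1); have l2 := h2 _ (leq_addl N1 N2).
apply: le_trans (nrm_triangle (U (u (N1 + N2)%N)) _ _) _.
rewrite -linUB nrmU (nrmB _ l); have := uP (N1 + N2)%N.
move: l1 l2; move: ((N1 + N2).+1%:R^-1) => b; lra.
Qed.

Let L := range U.

(** On the hull of the orbits of L the operator T intertwines the projection onto
L with A; this holds on orbits and passes to limits. *)
Lemma hull_intertwines m : orbit_hull T L m -> forall f,
  orthocomplement L (m - U f) -> orthocomplement L (T m - U (A f)).
Proof.
have dist x y f g : orthocomplement L (x - U f) -> orthocomplement L (y - U g) ->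
    nrm (f - g) <= nrm (x - y).
  move=> ox oy; rewrite -nrmU linUB.
  have o : dot (x - U f - (y - U g)) (U f - U g) = 0.
    by rewrite dotBl ox ?oy ?subrr // -linUB; exists (f - g).
  rewrite -(ler_pXn2r (_ : (0 < 2)%N)) ?nnegrE ?nrm_ge0 //.
  have -> : x - y = x - U f - (y - U g) + (U f - U g).
    by rewrite opprB addrAC subrKA subrKA.
  by rewrite (nrm2D_orth o) lerDr sqr_ge0.
(* By [dist], the projection of x onto L determines its preimage under U. *)
have uniq x f g : orthocomplement L (x - U f) -> orthocomplement L (x - U g) -> f = g.
  move=> of_ og; apply/eqP; rewrite -subr_eq0 -nrm_eq0.
  apply/eqP/le_anti; rewrite nrm_ge0 andbT.
  by have := dist _ _ _ _ of_ og; rewrite subrr nrm0.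
move=> hm f of_.
suff : [set m | exists2 g, orthocomplement L (m - U g) &
    orthocomplement L (T m - U (A g))] m.
  by case=> g og oT; rewrite (uniq _ _ _ of_ og).
apply: hm; split; last first.
  move=> _ [k [_ [[g _ <-] ->]]]; exists (iter k A g).
    move=> _ [h _ <-]; rewrite dotBl dilation_isometry.
    by rewrite dilU subrr.
  move=> _ [h _ <-]; rewrite -!iterS dotBl dilation_isometry.
  by rewrite dilU subrr.
have cO := @orthocomplement_closed R H L.
have [z0 lO _] := cO.
have A0 : A 0 = 0 by have := linA (-1) 0 0; rewrite scaler0 addr0 scaleN1r addNr.
have T0 : T 0 = 0 by have := linT (-1) 0 0; rewrite scaler0 addr0 scaleN1r addNr.
have U0 : U 0 = 0 by have := linU (-1) 0 0; rewrite scaler0 addr0 scaleN1r addNr.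
split.
- by exists 0; rewrite ?A0 ?T0 U0 subr0.
- move=> b x y [g og oTg] [h oh oTh]; exists (b *: g + h).
    rewrite linU opprD addrACA -scalerBr; exact: lO.
  rewrite linA linU linT opprD addrACA -scalerBr; exact: lO.
apply: approx_closed => x ap.
have [_ [g _ <-] og] := projection_theorem x range_closed.
exists g => // _ [h _ <-].
apply: (@nrm_le_eps _ _ _ ((`|t| + `|a|) * nrm h)) => eps /ap[y [gy oy oTy] xy].
have -> : dot (T x - U (A g)) (U h) = dot (T (x - y)) (U h) - dot (U (A (g - gy))) (U h).
  have AB : A (g - gy) = A g - A gy.
    by rewrite [g - gy]addrC -[- gy]scaleN1r linA scaleN1r addrC.
  have := oTy (U h) (ex_intro2 _ _ h I erefl); rewrite dotBl => /eqP.
  rewrite subr_eq0 => /eqP E.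
  by rewrite (linTB linT) AB linUB !dotBl E; ring.
apply: le_trans (nrmD _ _) _; rewrite nrmN mulrDl mulrDl; apply: lerD.
  apply: le_trans (nrm_dot _ _) _; rewrite nrmU mulrAC ler_wpM2r ?nrm_ge0 //.
  apply: le_trans (leT _) _; apply: (@le_trans _ _ (`|t| * nrm (x - y))).
    by rewrite ler_wpM2r ?nrm_ge0 ?ler_norm.
  by rewrite ler_wpM2l // ltW.
apply: le_trans (nrm_dot _ _) _; rewrite !nrmU mulrAC ler_wpM2r ?nrm_ge0 //.
apply: le_trans (leA _) _; apply: (@le_trans _ _ (`|a| * nrm (g - gy))).
  by rewrite ler_wpM2r ?nrm_ge0 ?ler_norm.
by rewrite ler_wpM2l //; apply: le_trans (dist _ _ _ _ og oy) _; apply: ltW.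
Qed.

(** The part N of M orthogonal to L = range U is invariant because a vector with
projection 0 is mapped to one with projection A 0 = 0. *)
Theorem compression_of_dilation : exists N M : set H,
  [/\ Lat T N, Lat T M, N `<=` M &
      let L := M `&` orthocomplement N in
      unitarily_equivalent L (compression L T) A].
Proof.
pose M := orbit_hull T L; pose N := M `&` orthocomplement L.
have LatM := orbit_hull_Lat linT leT L; have [cM TM] := LatM.
have LM : L `<=` M := sub_orbit_hull (S := L).
have cO := @orthocomplement_closed R H L; have [_ lO _] := cO.
have cN : closed_subspace N by apply: closed_subspace_cap.
have LE : M `&` orthocomplement N = L.
  apply/seteqP; split=> x.
    move=> [Mx xN]; have [p Lp xp] := projection_theorem x range_closed.
    have Nxp : N (x - p).
      by split=> //; exact: (closed_subspaceB cM Mx (LM _ Lp)).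
    suff -> : x = p by [].
    apply/eqP; rewrite -subr_eq0; apply/eqP/dot_self_eq0.
    rewrite dotBl (xN _ Nxp) sub0r; apply/eqP; rewrite oppr_eq0; apply/eqP.
    by apply: dot_eq0C; apply: xp.
  move=> Lx; split; first exact: LM.
  by move=> y [_ Ly]; apply/dot_eq0C/Ly.
exists N, M; split=> //.
- split=> // _ [x [Mx ox] <-]; split; first by apply: TM; exists x.
  have U0 : U 0 = 0 by have := linU (-1) 0 0; rewrite scaler0 addr0 scaleN1r addNr.
  have A0 : A 0 = 0 by have := linA (-1) 0 0; rewrite scaler0 addr0 scaleN1r addNr.
  have := @hull_intertwines x Mx 0; rewrite A0 U0 !subr0; exact.
- by move=> x [].
rewrite /= LE; exists U; split=> //.
  by move=> f g; apply: dilation_isometry.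
move=> f; apply: orthoproj_eq; last exact: range_closed.
  by exists (A f).
move=> _ [g _ <-]; rewrite dotBl dilation_isometry.
by rewrite -[T (U f)]/(iter 1 T (U f)) dilU subrr.
Qed.

End Compression.

(** * Invariant subspaces of prescribed index *)

Section Index.
Context {R : realType} {H : hilbertType R}.
Variables (T : H -> H) (t : R).
Hypotheses (linT : linear T) (leT : forall x, nrm (T x) <= t * nrm x).

(** A vector of the hull M orthogonal to all x_i and to T M is orthogonal to every
generator T^k x_i, hence to M; so the x_i span the wandering space. *)
Lemma index_of_wandering (x : nat -> H) (n : option nat) :
  (forall k i j, dot (iter k T (x i)) (x j) = ((k == 0)%N && (i == j))%:R) ->
  exists2 M, Lat T M & has_index T M n.
Proof.
move=> xo; set D := if n is Some k then `I_k else setT.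
pose M := orbit_hull T (x @` D).
have LatM := orbit_hull_Lat linT leT (x @` D); have [cM TM] := LatM.
exists M => //; exists x; split.
  by move=> i j _ _; rewrite (xo 0%N).
have cW : closed_subspace (M `&` orthocomplement (T @` M)).
  exact: closed_subspace_cap (orthocomplement_closed _).
have xM i : D i -> M (x i) by move=> Di; apply: sub_orbit_hull; exists i.
have ortho_gen q : (forall i, D i -> dot q (x i) = 0) ->
    (forall y, M y -> dot q (T y) = 0) -> forall y, M y -> dot q y = 0.
  move=> qx qT y My; apply: dot_eq0C.
  apply: (My [set y | dot y q = 0]); split; first exact: dot_kerl.
  move=> _ [[|k] [_ [[i Di <-] ->]]] /=; apply: dot_eq0C; first exact: qx.
  apply: qT; apply: sub_gen_smallest; exists k, (x i); split=> //; exists i.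
have LW : smallest closed_subspace (x @` D) `<=` M `&` orthocomplement (T @` M).
  apply: smallest_sub => // _ [i Di <-]; split; first exact: xM.
  move=> _ [y My <-]; apply: dot_eq0C.
  apply: (My [set y | dot (T y) (x i) = 0]); split.
    exact: (closed_subspace_preimage linT leT (dot_kerl (x i))).
  by move=> _ [k [_ [[j Dj <-] ->]]] /=; rewrite (xo k.+1).
apply/seteqP; split=> // m [Mm mo].
have cL := smallest_closed_subspace (x @` D).
have [p Lp pm] := projection_theorem m cL.
have [Mp po] := LW p Lp.
suff -> : m = p by [].
apply/eqP; rewrite -subr_eq0; apply/eqP/dot_self_eq0.
apply: (ortho_gen (m - p)); last exact: (closed_subspaceB cM Mm Mp).
- by move=> i Di; apply: pm; apply: sub_gen_smallest; exists i.
- by move=> y My; rewrite dotBl mo ?po ?subrr //; exists y.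
Qed.

End Index.

(** * The weak operator topology *)

Section WeakOperatorTopology.
Context {R : realType} {H : hilbertType R}.
Implicit Types (Z : H -> H).

Lemma WOT_cvg_dot Z x y :
  (fun Y : WOT => dot (Y x) y : R[i]^o) @ nbhs (Z : WOT) --> (dot (Z x) y : R[i]^o).
Proof.
have := @initial_continuous _ _ (@matrix_coefficients R H) Z.
move/pointwise_cvgP => h; have h2 := h (fmap_filter _ (nbhs_filter (Z : WOT))) (x, y); exact: h2.
Qed.

Lemma WOT_closure_dot (S : set (H -> H)) Z x y : closure (S : set WOT) Z ->
  (forall Y, S Y -> dot (Y x) y = 0) -> dot (Z x) y = 0.
Proof.
move=> clZ S0; apply: (@nrm_le_eps _ _ _ 1) => eps e0; rewrite mul1r.
have e0C : 0 < eps%:C :> R[i] by rewrite ltcR.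
have /cvgrPdist_lt /(_ _ e0C) nZ := @WOT_cvg_dot Z x y.
have [Y [SY ZY]] := clZ _ nZ.
have : `|dot (Z x) y - dot (Y x) y : R[i]| < eps%:C := ZY.
by rewrite (S0 _ SY) (subr0 (dot (Z x) y)) nrmE ltcR => /ltW.
Qed.

Lemma WOT_closure_seq (S : set (H -> H)) Z (F : nat -> H -> H) :
  (forall n, S (F n)) ->
  (forall x y (eps : R), 0 < eps -> exists N, forall n, (N <= n)%N ->
     nrm (dot (F n x) y - dot (Z x) y) < eps) ->
  closure (S : set WOT) Z.
Proof.
move=> SF FZ B.
have Fc : (fun n => @matrix_coefficients R H (F n)) @ \oo -->
    (@matrix_coefficients R H Z).
  apply/pointwise_cvgP => -[x y]; apply/cvgrPdist_lt => e /gt0_rc[eE e0].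
  have [N hN] := FZ x y _ e0; exists N => // n /= Nn.
  by rewrite distrC nrmE eE ltcR; apply: hN.
rewrite nbhsE => -[G [[G' oG' GE] GZ] GB].
have nG' : nbhs (@matrix_coefficients R H Z) G'.
  apply: open_nbhs_nbhs; split=> //.
  by move: GZ; rewrite -GE.
have [N _ hN] := Fc _ nG'.
exists (F N); split; first exact: SF.
by apply: GB; rewrite -GE; apply: (hN N) => /=.
Qed.

End WeakOperatorTopology.

(** * Operators that leave the invariant subspaces of a shift invariant *)

Section OrthonormalBasis.
Context {R : realType} {H : hilbertType R}.
Notation C := R[i].
Variables (e : nat -> H).
Hypotheses (orthoe : forall i j, dot (e i) (e j) = (i == j)%:R)
  (totale : smallest closed_subspace (e @` setT) = setT).

Lemma functional_eq0 (phi : H -> C) (c : R) :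
  (forall b x y, phi (b *: x + y) = b * phi x + phi y) ->
  (forall x, nrm (phi x) <= c * nrm x) -> (forall n, phi (e n) = 0) ->
  forall x, phi x = 0.
Proof.
move=> lphi bphi phie x.
have : smallest closed_subspace (e @` setT) x by rewrite totale.
move=> /(_ [set x | phi x = 0]); apply; split; first exact: (closed_subspace_ker lphi bphi).
by move=> _ [n _ <-]; apply: phie.
Qed.

Lemma dot_sum_e (c : nat -> C) B n :
  dot (\sum_(j < B) c j *: e j) (e n) = if (n < B)%N then c n else 0.
Proof.
rewrite dot_suml; case: ltnP => nB.
  rewrite (bigD1 (Ordinal nB)) //= dotZl orthoe eqxx mulr1 big1 ?addr0 // => j /eqP jn.
  rewrite dotZl orthoe (_ : (j == n :> nat) = false) ?mulr0 //.
  by apply/negP => /eqP E; apply: jn; apply: val_inj.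
apply: big1 => j _; rewrite dotZl orthoe (_ : (j == n :> nat) = false) ?mulr0 //.
by have := ltn_ord j; lia.
Qed.

Lemma nrm2_sum (c : nat -> C) B :
  nrm (\sum_(j < B) c j *: e j) ^+ 2 = \sum_(j < B) nrm (c j) ^+ 2.
Proof.
apply: complexI; rewrite -dotxx rc_sum dot_sumr; apply: eq_bigr => j _.
by rewrite dotZr dot_sum_e ltn_ord mulrC mulJ.
Qed.

Definition finsupp D x := forall j, (D <= j)%N -> dot x (e j) = 0.

Lemma finsuppE D x : finsupp D x -> x = \sum_(j < D) dot x (e j) *: e j.
Proof.
move=> fx; apply/eqP; rewrite -subr_eq0; apply/eqP/(onb_eq0 totale) => n.
rewrite dotBl (dot_sum_e (fun j => dot x (e j))); case: ltnP => nD.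
  by rewrite subrr.
by rewrite fx // subrr.
Qed.

Lemma finsupp_dense x (eps : R) : 0 < eps ->
  exists2 y, (exists D, finsupp D y) & nrm (x - y) < eps.
Proof.
have : smallest closed_subspace (e @` setT) x by rewrite totale.
move=> /(_ [set x | forall eps : R, 0 < eps ->
   exists2 y, (exists D, finsupp D y) & nrm (x - y) < eps]) /= h.
move: eps; apply: h; split.
  split.
  - move=> eps e0; exists 0; last by rewrite subr0 nrm0.
    by exists 0%N => j _; rewrite dot0l.
  - move=> b x1 x2 f1 f2 eps e0.
    have b1 : 0 < nrm b + 1 by rewrite ltr_wpDl ?nrm_ge0.
    have [y1 [D1 fy1] n1] := f1 (eps / 2 / (nrm b + 1)) (ltac:(by rewrite !divr_gt0)).
    have [y2 [D2 fy2] n2] := f2 (eps / 2) (ltac:(by rewrite divr_gt0)).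
    exists (b *: y1 + y2).
      exists (D1 + D2)%N => j Dj; rewrite dotDl dotZl fy1 ?fy2 ?mulr0 ?addr0 //; lia.
    rewrite opprD addrACA -scalerBr; apply: le_lt_trans (nrmD _ _) _.
    rewrite nrmZ; have : nrm b * nrm (x1 - y1) <= eps / 2.
      apply: (@le_trans _ _ ((nrm b + 1) * nrm (x1 - y1))).
        by rewrite ler_wpM2r ?nrm_ge0 // lerDl.
      by rewrite mulrC -ler_pdivlMr // ltW.
    lra.
  - apply: approx_closed => x1 ap eps e0.
    have e2 : 0 < eps / 2 by rewrite divr_gt0.
    have [y yf xy] := ap _ e2; have [z zf yz] := yf _ e2; exists z => //.
    by apply: le_lt_trans (nrm_triangle y _ _) _; lra.
move=> _ [n _ <-] eps e0; exists (e n); last by rewrite subrr nrm0.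
by exists n.+1 => j nj; rewrite orthoe (_ : (n == j) = false) //; lia.
Qed.

Lemma nrm_e n : nrm (e n) = 1.
Proof.
have := congr1 (@complex.Re R) (orthoe n n); rewrite dotxx ReR eqxx /= => E.
apply/eqP; rewrite -(eqrXn2 (_ : (0 < 2)%N)) ?nrm_ge0 // E expr1n //.
Qed.

(** Geometric decay gives an explicit rate of convergence of the partial sums,
which square summability would not. *)
Lemma geometric_vector (c : nat -> R) (q : R) : 0 <= q -> q <= 1 / 2 ->
  (forall n, `|c n| <= q ^+ n) ->
  exists k : H, (forall n, dot k (e n) = (c n)%:C) /\
    forall N, nrm (k - \sum_(n < N) (c n)%:C *: e n) <= 2 * q ^+ N.
Proof.
move=> q0 q2 cq.
pose K N := \sum_(n < N) (c n)%:C *: e n.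
have tail N d : nrm (K (N + d)%N - K N) <= 2 * q ^+ N - 2 * q ^+ (N + d).
  elim: d => [|d IH]; first by rewrite addn0 !subrr nrm0.
  rewrite addnS /K big_ord_recr /= -/(K _) addrAC.
  apply: le_trans (nrmD _ _) _; rewrite nrmZ nrmR nrm_e mulr1.
  have := cq (N + d)%N; have : 2 * q ^+ (N + d).+1 <= q ^+ (N + d).
    rewrite exprS mulrA ler_piMl ?exprn_ge0 //; lra.
  move: IH; move: (q ^+ (N + d).+1) (q ^+ (N + d)) (nrm _) => x y z; lra.
have qn N : 0 <= q ^+ N by rewrite exprn_ge0.
have small (eps : R) : 0 < eps -> exists N, 2 * q ^+ N < eps.
  move=> e0; have q1 : `|q| < 1 by rewrite ger0_norm //; lra.
  have /cvgrPdist_lt /(_ (eps / 2) (divr_gt0 e0 (ltr0n _ 2))) [N _ /(_ N (leqnn N))] := cvg_expr q1.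
  rewrite /= sub0r normrN ger0_norm // => h; exists N; lra.
have mono N n : (N <= n)%N -> q ^+ n <= q ^+ N.
  by move=> Nn; apply: ler_wiXn2l => //; lra.
have [k kP] : exists k, forall eps : R, 0 < eps ->
    exists N, forall n, (N <= n)%N -> nrm (k - K n) < eps.
  apply: hilbert_complete => eps e0; have [N hN] := small _ e0; exists N.
  have half m n : (N <= m)%N -> (m <= n)%N -> nrm (K n - K m) < eps.
    move=> Nm mn; rewrite -(subnKC mn); apply: le_lt_trans (tail _ _) _.
    by have := mono _ _ Nm; have := qn (m + (n - m))%N; lra.
  move=> m n Nm Nn; case: (leqP m n) => mn; first by rewrite nrmB half.
  by rewrite half // ltnW.
have kK N : nrm (k - K N) <= 2 * q ^+ N.
  apply/ler_addgt0Pl => eps e0; have [M hM] := kP _ e0.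
  apply: le_trans (nrm_triangle (K (N + M)%N) _ _) _.
  have := hM (N + M)%N (leq_addl _ _); have := tail N M; have := qn (N + M)%N; lra.
exists k; split=> // n.
apply/eqP; rewrite -subr_eq0; apply/eqP/(@nrm_le_eps _ _ _ 1) => eps e0.
have [N hN] := small _ e0; rewrite mul1r.
have -> : dot k (e n) - (c n)%:C = dot (k - K (N + n.+1)%N) (e n).
  by rewrite dotBl (dot_sum_e (fun n => (c n)%:C)) ifT //; lia.
apply: le_trans (nrm_dot _ _) _; rewrite nrm_e mulr1.
apply: le_trans (kK _) _; have := mono N (N + n.+1)%N (leq_addr _ _); lra.
Qed.

End OrthonormalBasis.

Section Commutant.
Context {R : realType} {H : hilbertType R}.
Notation C := R[i].
Variables (e : nat -> H) (w : nat -> R) (rho : R) (T : H -> H) (t : R).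
Hypotheses (orthoe : forall i j, dot (e i) (e j) = (i == j)%:R)
  (totale : smallest closed_subspace (e @` setT) = setT)
  (rho_gt0 : 0 < rho) (w_ge : forall n, rho <= w n)
  (linT : linear T) (leT : forall x, nrm (T x) <= t * nrm x)
  (Te : forall n, T (e n) = (w n)%:C *: e n.+1).

Local Notation p := (wprod w 0).

Lemma w_gt0 n : 0 < w n.
Proof. exact: lt_le_trans (w_ge n). Qed.

Lemma wprod_gt0 n k : 0 < wprod w n k.
Proof. by apply: prodr_gt0 => i _; apply: w_gt0. Qed.

Lemma wprod_ge n k : rho ^+ k <= wprod w n k.
Proof.
elim: k => [|k IH]; first by rewrite /wprod big_ord0.
rewrite /wprod big_ord_recr /= exprSr; apply: ler_pM => //.
  by rewrite exprn_ge0 // ltW.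
exact: ltW.
Qed.

Lemma wprodS n k : wprod w n k.+1 = wprod w n k * w (n + k)%N.
Proof. by rewrite /wprod big_ord_recr. Qed.

Lemma wprod_cat n k l : wprod w n (k + l) = wprod w n k * wprod w (n + k) l.
Proof.
elim: l => [|l IH]; first by rewrite addn0 wprod0 mulr1.
by rewrite addnS !wprodS IH mulrA addnA.
Qed.

Lemma nrmB_le (u v : C) (c d r : R) : nrm u <= c * r -> nrm v <= d * r ->
  nrm (u - v) <= (c + d) * r.
Proof.
move=> h1 h2; apply: le_trans (nrmD _ _) _; rewrite nrmN mulrDl.
exact: lerD.
Qed.

Lemma dot_bound (B : H -> H) (c : R) x y : nrm (B x) <= c * nrm x ->
  nrm (dot (B x) y) <= c * nrm y * nrm x.
Proof.
move=> h; apply: le_trans (nrm_dot _ _) _; rewrite mulrAC.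
by rewrite ler_wpM2r ?nrm_ge0.
Qed.

(** For small l the vector of coordinates l^n / p_n is an eigenvector of the
adjoint of T, so that its orthogonal complement is invariant under T. *)
Lemma adjoint_eigenvector (l : R) : 0 < l -> l <= rho / 2 ->
  exists k : H, [/\ forall n, dot k (e n) = (l ^+ n / p n)%:C,
    forall N, nrm (k - \sum_(n < N) (l ^+ n / p n)%:C *: e n) <= 2 * (l / rho) ^+ N &
    forall x, dot (T x) k = l%:C * dot x k].
Proof.
move=> l0 lr.
have lr0 : 0 <= l / rho by rewrite divr_ge0 // ltW.
have lr2 : l / rho <= 1 / 2 by rewrite ler_pdivrMr //; lra.
have cq n : `|l ^+ n / p n| <= (l / rho) ^+ n.
  rewrite ger0_norm ?divr_ge0 ?exprn_ge0 ?(ltW (wprod_gt0 _ _)) ?(ltW l0) //.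
  rewrite expr_div_n ler_pM2l ?exprn_gt0 // lef_pV2 ?posrE ?wprod_gt0 ?exprn_gt0 //.
  exact: wprod_ge.
have [k [ke kK]] := geometric_vector orthoe lr0 lr2 cq.
exists k; split=> // x; apply/eqP; rewrite -subr_eq0; apply/eqP.
move: x; apply: (functional_eq0 totale (c := t * nrm k + l * nrm k)).
- by move=> b x y; rewrite linT !dotDl !dotZl; ring.
- move=> x; apply: nrmB_le; first exact: dot_bound.
  by rewrite nrmM nrmR gtr0_norm // -mulrA ler_pM2l // mulrC nrm_dot.
move=> n; rewrite Te dotZl (dotC _ k) (dotC (e n)) !ke !conjR -!rcM -rcB.
rewrite (_ : w n * _ - _ = 0) // wprodS add0n exprS.
by field; rewrite !gt_eqF ?w_gt0 ?wprod_gt0.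
Qed.

(** Since x - <x, k> e_0 is in the complement of an eigenvector k, Z multiplies
<-, k> by a constant, as T does; so Z T x - T Z x is orthogonal to all these k.
Its coordinates vanish one after the other: the first nonzero one would dominate
<-, k> as the eigenvalue tends to zero. *)
Lemma commutes_of_Lat (Z : H -> H) (z : R) : linear Z ->
  (forall x, nrm (Z x) <= z * nrm x) -> Lat T `<=` Lat Z ->
  forall x, Z (T x) = T (Z x).
Proof.
move=> linZ leZ LTZ x; apply/eqP; rewrite -subr_eq0; apply/eqP.
set y := _ - _.
have yk (l : R) k : 0 < l -> l <= rho / 2 ->
    dot k (e 0%N) = (l ^+ 0 / p 0)%:C ->
    (forall x, dot (T x) k = l%:C * dot x k) -> dot y k = 0.
  move=> l0 lr k0 kT.
  have LT : Lat T [set x | dot x k = 0].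
    split; first exact: dot_kerl.
    by move=> _ [v /= vk <-]; rewrite /= kT vk mulr0.
  have [_ LZ] := LTZ _ LT.
  have eZ v : dot (Z v) k = dot v k * dot (Z (e 0%N)) k.
    have ek : dot (e 0%N) k = 1.
      by rewrite dotC k0 conjR expr0 wprod0 divr1.
    have vk : dot (- dot v k *: e 0%N + v) k = 0.
      by rewrite dotDl dotZl ek mulr1 addNr.
    have := LZ (Z (- dot v k *: e 0%N + v)) (ex_intro2 _ _ _ vk erefl).
    rewrite /= linZ dotDl dotZl mulNr addrC => /eqP.
    by rewrite subr_eq0 => /eqP.
  by rewrite /y dotBl (eZ (T x)) (kT x) (kT (Z x)) (eZ x); ring.
apply: (onb_eq0 totale) => n.
elim/ltn_ind: n => n IH.
pose c := 2 * nrm y * p n / rho ^+ n.+1.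
apply: (@nrm_le_eps _ _ _ c) => eps e0.
(* The eigenvalue tends to zero with eps. *)
pose l := Num.min eps (rho / 2).
have l0 : 0 < l by rewrite lt_min e0 divr_gt0.
have lr : l <= rho / 2 by rewrite ge_min lexx orbT.
have le_eps : l <= eps by rewrite ge_min lexx.
have [k [ke kK kT]] := adjoint_eigenvector l0 lr.
pose S := \sum_(j < n.+1) (l ^+ j / p j)%:C *: e j.
have yS : dot y S = (l ^+ n / p n)%:C * dot y (e n).
  rewrite /S dot_sumr big_ord_recr /= big1 ?add0r ?dotZr ?conjR // => j _.
  by rewrite dotZr IH ?mulr0.
have := yk l k l0 lr (ke 0%N) kT.
rewrite -[k](subrK S) dotDr yS => /eqP; rewrite addrC addr_eq0 => /eqP E.
have c0 : 0 <= c.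
  by rewrite /c !mulr_ge0 ?nrm_ge0 ?invr_ge0 ?exprn_ge0 ?(ltW (wprod_gt0 _ _)) ?(ltW rho_gt0).
apply: (@le_trans _ _ (c * l)); last by rewrite ler_wpM2l.
have pn := wprod_gt0 0 n; have ln : 0 < l ^+ n by rewrite exprn_gt0.
have -> : nrm (dot y (e n)) = p n / l ^+ n * nrm ((l ^+ n / p n)%:C * dot y (e n)).
  rewrite nrmM nrmR gtr0_norm ?divr_gt0 //; field.
  by rewrite !gt_eqF.
rewrite E nrmN.
apply: (@le_trans _ _ (p n / l ^+ n * (nrm y * (2 * (l / rho) ^+ n.+1)))).
  rewrite ler_pM2l ?divr_gt0 //; apply: le_trans (nrm_dot _ _) _.
  by rewrite ler_wpM2l ?nrm_ge0 //; exact: kK n.+1.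
rewrite le_eqVlt; apply/orP; left; apply/eqP.
rewrite /c expr_div_n [l ^+ n.+1]exprS; field.
by rewrite !gt_eqF ?exprn_gt0.
Qed.

End Commutant.

(** * Fejer means and reflexivity *)

Section Reflexivity.
Context {R : realType} {H : hilbertType R}.
Notation C := R[i].
Variables (e : nat -> H) (w : nat -> R) (rho : R) (T : H -> H) (t : R).
Hypotheses (orthoe : forall i j, dot (e i) (e j) = (i == j)%:R)
  (totale : smallest closed_subspace (e @` setT) = setT)
  (rho_gt0 : 0 < rho) (w_ge : forall n, rho <= w n)
  (linT : linear T) (leT : forall x, nrm (T x) <= t * nrm x)
  (Te : forall n, T (e n) = (w n)%:C *: e n.+1).

Local Notation p := (wprod w 0).
Let wgt0 := wprod_gt0 rho_gt0 w_ge.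

Lemma dot_T x i : dot (T x) (e i.+1) = (w i)%:C * dot x (e i) /\ dot (T x) (e 0%N) = 0.
Proof.
split; last first.
  move: x; apply: (functional_eq0 totale (c := t * nrm (e 0%N))).
  - by move=> b x y; rewrite linT dotDl dotZl.
  - by move=> x; apply: dot_bound.
  - by move=> n; rewrite Te dotZl orthoe mulr0.
apply/eqP; rewrite -subr_eq0; apply/eqP; move: x.
apply: (functional_eq0 totale (c := t * nrm (e i.+1) + `|w i| * nrm (e i))).
- by move=> b x y; rewrite linT !dotDl !dotZl; ring.
- move=> x; apply: nrmB_le; first exact: dot_bound.
  by rewrite nrmM nrmR -mulrA ler_wpM2l // mulrC nrm_dot.
move=> n; rewrite Te !dotZl !orthoe eqSS; case: eqP => [->|_].
  by rewrite subrr.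
by rewrite !mulr0 subrr.
Qed.

(** The adjoint of T is a weighted backward shift. *)
Lemma dot_iterT j x i : dot (iter j T x) (e i) =
  if (j <= i)%N then (wprod w (i - j) j)%:C * dot x (e (i - j)%N) else 0.
Proof.
elim: j i => [|j IH] i; first by rewrite leq0n subn0 wprod0 mul1r.
case: i => [|i]; first by rewrite iterS; case: (dot_T (iter j T x) 0).
rewrite iterS (dot_T _ i).1 IH ltnS subSS; case: ifP => ji; last by rewrite mulr0.
by rewrite mulrA -rcM wprodS subnK // [w i * _]mulrC.
Qed.

Section Commuting.
Variables (Z : H -> H) (z : R).
Hypotheses (linZ : linear Z) (leZ : forall x, nrm (Z x) <= z * nrm x)
  (z_ge0 : 0 <= z) (commZ : forall x, Z (T x) = T (Z x)).

(** Z is formally the sum of the b_n T^n. *)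
Let b n : C := dot (Z (e 0%N)) (e n) / (p n)%:C.

(** Z is determined by its value at e_0, since e_j is a multiple of T^j e_0. *)
Lemma commuting_matrix i j : dot (Z (e j)) (e i) =
  if (j <= i)%N then b (i - j)%N * (wprod w j (i - j))%:C else 0.
Proof.
have commZk k x : Z (iter k T x) = iter k T (Z x).
  by elim: k => // k IH; rewrite !iterS commZ IH.
have ZZ c x : Z (c *: x) = c *: Z x.
  have Z0 : Z 0 = 0 by have := linZ (-1) 0 0; rewrite scaler0 addr0 scaleN1r addNr.
  by have := linZ c x 0; rewrite Z0 !addr0.
have pnz n k : (wprod w n k)%:C != 0 :> C.
  by apply/eqP => -[] /eqP; rewrite gt_eqF ?wgt0.
have ej : e j = (p j)%:C^-1 *: iter j T (e 0%N).
  by rewrite (iterT_e linT Te) scalerA mulVf ?pnz // scale1r.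
rewrite {1}ej ZZ commZk dotZl dot_iterT; case: ifP => ji; last by rewrite mulr0.
have E : p j * wprod w j (i - j) = p (i - j) * wprod w (i - j) j.
  by rewrite -[in LHS](wprod_cat w 0 j) -(wprod_cat w 0 (i - j)) addnC.
have -> : (wprod w (i - j) j)%:C = (p j)%:C * (wprod w j (i - j))%:C / (p (i - j))%:C.
  by rewrite -rcM E rcM mulrAC divff ?mul1r ?pnz.
by rewrite /b; field; rewrite !pnz.
Qed.

Definition fejer_poly N : {poly C} := \poly_(n < N) (((N - n)%:R / N%:R) * b n).
Definition fejer N : H -> H := poly_op (fejer_poly N) T.

Lemma fejerE N x : fejer N x = \sum_(n < N) (((N - n)%:R / N%:R) * b n) *: iter n T x.
Proof.
rewrite /fejer /poly_op.
have le : (size (fejer_poly N) <= N)%N by exact: size_poly.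
transitivity (\sum_(n < N) (fejer_poly N)`_n *: iter n T x); last first.
  by apply: eq_bigr => n _; rewrite coef_poly ltn_ord.
rewrite (big_ord_widen N (fun n => (fejer_poly N)`_n *: iter n T x) le) big_mkcond /=.
by apply: eq_bigr => n _; case: ltnP => // /(nth_default 0) ->; rewrite scale0r.
Qed.

Lemma fejer_linear N : linear (fejer N).
Proof.
move=> c x y; rewrite !fejerE scaler_sumr -big_split; apply: eq_bigr => n _ /=.
by rewrite (iterT_linear linT) scalerDr !scalerA mulrC.
Qed.

Lemma fejer_bounded N : exists c : R, forall x, nrm (fejer N x) <= c * nrm x.
Proof.
exists (\sum_(n < N) nrm (((N - n)%:R / N%:R) * b n) * `|t| ^+ n) => x.
rewrite fejerE mulr_suml; apply: le_trans (nrm_sum _ _ _) _; apply: ler_sum => n _.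
by rewrite nrmZ -[leRHS]mulrA ler_wpM2l ?nrm_ge0 // nrm_iterT.
Qed.

Lemma fejer_matrix N i j : dot (fejer N (e j)) (e i) =
  ((N - lag j i)%:R / N%:R)%:C * dot (Z (e j)) (e i).
Proof.
rewrite fejerE dot_suml commuting_matrix.
have term n : dot ((((N - n)%:R / N%:R) * b n) *: iter n T (e j)) (e i) =
    (j + n == i)%N%:R * (((N - n)%:R / N%:R) * b n * (wprod w j n)%:C).
  by rewrite (iterT_e linT Te) scalerA dotZl orthoe mulrC.
under eq_bigr do rewrite term.
case: leqP => ji; last first.
  rewrite mulr0 big1 // => n _; rewrite (_ : (j + n == i)%N = false) ?mul0r //; lia.
rewrite rcM rcV !rc_nat (_ : lag j i = i - j)%N; last by rewrite /lag; lia.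
case: (ltnP (i - j) N) => ijN.
  rewrite (bigD1 (Ordinal ijN)) //= subnKC // eqxx mul1r big1 ?addr0 ?mulrA //.
  move=> n /eqP ne; rewrite (_ : (j + n == i)%N = false) ?mul0r //.
  by apply/negP => /eqP E; apply: ne; apply: val_inj => /=; lia.
rewrite (_ : N - (i - j) = 0)%N ?mul0r; last by lia.
by rewrite big1 // => n _; rewrite (_ : (j + n == i)%N = false) ?mul0r //; have := ltn_ord n; lia.
Qed.

Lemma lag_le i j D : (i < D)%N -> (j < D)%N -> (lag i j <= D)%N.
Proof. by rewrite /lag; lia. Qed.

Lemma count_common N D i j : (i < D)%N -> (j < D)%N ->
  (\sum_(s < D + N) ((j <= s < j + N)%N * (i <= s < i + N)%N) = N - lag j i)%N.
Proof.
move=> iD jD.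
rewrite (eq_bigr (fun s : 'I_(D + N) =>
   ((maxn i j <= s < maxn i j + (N - lag j i))%N : nat))).
  by rewrite count_interval /lag; lia.
move=> s _; rewrite mulnb; congr nat_of_bool; rewrite /lag; lia.
Qed.

Lemma dot_double (B : H -> H) D x y : linear B -> finsupp e D x -> finsupp e D y ->
  dot (B x) y = \sum_(j < D) \sum_(i < D)
    dot x (e j) * (dot y (e i))^* * dot (B (e j)) (e i).
Proof.
move=> linB fx fy; rewrite {1}(finsuppE orthoe totale fx) {1}(finsuppE orthoe totale fy).
have -> : B (\sum_(j < D) dot x (e j) *: e j) = \sum_(j < D) dot x (e j) *: B (e j).
  have B0 : B 0 = 0 by have := linB (-1) 0 0; rewrite scaler0 addr0 scaleN1r addNr.
  by elim/big_rec2: _ => [//|j u v _ <-]; rewrite linB.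
rewrite dot_suml; apply: eq_bigr => j _; rewrite dotZl dot_sumr mulr_sumr.
by apply: eq_bigr => i _; rewrite dotZr mulrA.
Qed.

(** A Fejer mean is an average of compressions of Z to windows of length N of
the basis, each of norm at most that of Z. *)
Lemma fejer_finsupp N D x y : (0 < N)%N -> finsupp e D x -> finsupp e D y ->
  nrm (dot (fejer N x) y) <= z / 2 * (nrm x ^+ 2 + nrm y ^+ 2).
Proof.
move=> N0 fx fy; have N0' : 0 < N%:R :> R by rewrite ltr0n.
pose P s v := \sum_(j < D) (((j <= s < j + N)%N : nat)%:R * dot v (e j)) *: e j.
have PP : dot (fejer N x) y =
    (N%:R^-1)%:C * \sum_(s < D + N) dot (Z (P s x)) (P s y).
  rewrite (dot_double (@fejer_linear N) fx fy) mulr_sumr.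
  transitivity (\sum_(s < D + N) \sum_(j < D) \sum_(i < D)
     ((j <= s < j + N)%N * (i <= s < i + N)%N)%:R *
     ((N%:R^-1)%:C * (dot x (e j) * (dot y (e i))^* * dot (Z (e j)) (e i)))).
    rewrite [RHS]exchange_big; apply: eq_bigr => j _.
    rewrite [RHS]exchange_big; apply: eq_bigr => i _.
    rewrite -mulr_suml -natr_sum count_common // fejer_matrix rcM rc_nat rcV; ring.
  apply: eq_bigr => s _.
  have fP v : finsupp e D (P s v).
    by move=> j Dj; rewrite (dot_sum_e orthoe (fun j => ((j <= s < j + N)%N : nat)%:R * dot v (e j))) ltnNge Dj.
  have Pe v (j : 'I_D) : dot (P s v) (e j) = ((j <= s < j + N)%N : nat)%:R * dot v (e j).
    by rewrite (dot_sum_e orthoe (fun j => ((j <= s < j + N)%N : nat)%:R * dot v (e j))) ltn_ord.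
  rewrite (dot_double linZ (fP x) (fP y)) mulr_sumr; apply: eq_bigr => j _.
  rewrite mulr_sumr; apply: eq_bigr => i _; rewrite !Pe conjM conj_nat natrM; ring.
have nP v : finsupp e D v -> \sum_(s < D + N) nrm (P s v) ^+ 2 = N%:R * nrm v ^+ 2.
  move=> fv; rewrite {2}(finsuppE orthoe totale fv) (nrm2_sum orthoe (fun j => dot v (e j))).
  under eq_bigr do rewrite (nrm2_sum orthoe (fun j => ((j <= _ < j + N)%N : nat)%:R * dot v (e j))).
  rewrite exchange_big mulr_sumr; apply: eq_bigr => j _ /=.
  have -> : N%:R = \sum_(s < D + N) ((j <= s < j + N)%N : nat)%:R :> R.
    rewrite -natr_sum count_interval; congr _%:R; have := ltn_ord j; lia.
  rewrite mulr_suml; apply: eq_bigr => s _.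
  by rewrite nrmM nrm_nat; case: (j <= s < j + N)%N; rewrite ?mul1r ?mul0r ?expr0n.
rewrite PP nrmM nrmR ger0_norm ?invr_ge0 ?(ltW N0') //.
rewrite ler_pdivrMl //.
apply: le_trans (nrm_sum _ _ _) _.
apply: (@le_trans _ _ (\sum_(s < D + N) z / 2 * (nrm (P s x) ^+ 2 + nrm (P s y) ^+ 2))).
  apply: ler_sum => s _; apply: le_trans (nrm_dot _ _) _.
  apply: (@le_trans _ _ (z * nrm (P s x) * nrm (P s y))).
    by rewrite ler_wpM2r ?nrm_ge0.
  have := sqr_ge0 (nrm (P s x) - nrm (P s y)); rewrite sqrrB.
  move: (nrm (P s x)) (nrm (P s y)) z_ge0 => u v z0 h; nra.
by rewrite -mulr_sumr big_split /= !nP // -mulrDr mulrCA.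
Qed.

(** The quadratic bound becomes a product by scaling both vectors to length one,
and extends from finitely supported vectors by density. *)
Lemma fejer_contractive N x y : (0 < N)%N ->
  nrm (dot (fejer N x) y) <= z * nrm x * nrm y.
Proof.
move=> N0; have linF := @fejer_linear N.
have F0 : fejer N 0 = 0 by have := linF (-1) 0 0; rewrite scaler0 addr0 scaleN1r addNr.
have FZ c v : fejer N (c *: v) = c *: fejer N v by have := linF c v 0; rewrite F0 !addr0.
have fin D u v : finsupp e D u -> finsupp e D v ->
    nrm (dot (fejer N u) v) <= z * nrm u * nrm v.
  move=> fu fv; have [->|u0] := eqVneq u 0; first by rewrite F0 dot0l !nrm0 mulr0 mul0r.
  have [->|v0] := eqVneq v 0; first by rewrite dot0r !nrm0 mulr0.
  have nu : 0 < nrm u by rewrite lt_def nrm_ge0 nrm_eq0 u0.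
  have nv : 0 < nrm v by rewrite lt_def nrm_ge0 nrm_eq0 v0.
  have fZ c q : finsupp e D q -> finsupp e D (c *: q).
    by move=> fq j Dj; rewrite dotZl fq // mulr0.
  have := fejer_finsupp N0 (fZ (nrm u)^-1%:C _ fu) (fZ (nrm v)^-1%:C _ fv).
  rewrite FZ dotZl dotZr conjR !nrmZ !nrmM !nrmR !ger0_norm ?invr_ge0 ?nrm_ge0 //.
  rewrite !mulVf ?gt_eqF // expr1n => h.
  have -> : nrm (dot (fejer N u) v) =
      (nrm u)^-1 * ((nrm v)^-1 * nrm (dot (fejer N u) v)) * nrm u * nrm v.
    by field; rewrite !gt_eqF.
  rewrite !ler_pM2r //; lra.
have [s sP] := fejer_bounded N.
pose c := z * (nrm x + nrm y + 1) + `|s| * nrm y + `|s| * (nrm x + 1).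
have c0 : 0 <= c.
  by rewrite /c !addr_ge0 // ?mulr_ge0 ?addr_ge0 ?nrm_ge0.
apply/ler_addgt0Pl => eps0 eps00.
pose eps := Num.min 1 (eps0 / (c + 1)).
have c1 : 0 < c + 1 by rewrite ltr_wpDl.
have e0 : 0 < eps by rewrite lt_min ltr01 divr_gt0.
have e1 : eps <= 1 by rewrite ge_min lexx.
have ec : eps * c <= eps0.
  apply: (@le_trans _ _ (eps0 / (c + 1) * (c + 1))); last by rewrite divfK // gt_eqF.
  by apply: ler_pM; rewrite ?(ltW e0) ?ge_min ?lexx ?orbT // lerDl.
have [x' [D1 fx'] xx'] := finsupp_dense orthoe totale x e0.
have [y' [D2 fy'] yy'] := finsupp_dense orthoe totale y e0.
have fx2 : finsupp e (D1 + D2) x'.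
  by move=> j Dj; apply: fx'; apply: leq_trans Dj; apply: leq_addr.
have fy2 : finsupp e (D1 + D2) y'.
  by move=> j Dj; apply: fy'; apply: leq_trans Dj; apply: leq_addl.
have F1 := fin _ _ _ fx2 fy2.
have FB u v : fejer N (u - v) = fejer N u - fejer N v.
  by rewrite [u - v]addrC -[- v]scaleN1r linF scaleN1r addrC.
have -> : dot (fejer N x) y = dot (fejer N x') y' + dot (fejer N (x - x')) y +
    dot (fejer N x') (y - y').
  by rewrite FB dotBl dotBr; ring.
have nx' : nrm x' <= nrm x + eps.
  have := nrmD (x' - x) x; rewrite subrK nrmB; lra.
have ny' : nrm y' <= nrm y + eps.
  have := nrmD (y' - y) y; rewrite subrK nrmB; lra.
have b1 : nrm (dot (fejer N x') y') <= z * nrm x * nrm y + eps * (z * (nrm x + nrm y + 1)).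
  apply: le_trans F1 _; apply: (@le_trans _ _ (z * ((nrm x + eps) * (nrm y + eps)))).
    by rewrite -mulrA ler_wpM2l // ler_pM ?nrm_ge0.
  have := nrm_ge0 x; have := nrm_ge0 y; move: (nrm x) (nrm y) => u v v0 u0.
  have : eps * eps <= eps by rewrite ler_piMl // ltW.
  move=> ee; have -> : z * u * v + eps * (z * (u + v + 1)) = z * (u * v + eps * (u + v + 1)) by ring.
  rewrite ler_wpM2l //; lra.
have b2 : nrm (dot (fejer N (x - x')) y) <= eps * (`|s| * nrm y).
  apply: le_trans (nrm_dot _ _) _; rewrite mulrA ler_wpM2r ?nrm_ge0 //.
  apply: le_trans (sP _) _; apply: (@le_trans _ _ (`|s| * nrm (x - x'))).
    by rewrite ler_wpM2r ?nrm_ge0 ?ler_norm.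
  by rewrite mulrC ler_wpM2r // ltW.
have b3 : nrm (dot (fejer N x') (y - y')) <= eps * (`|s| * (nrm x + 1)).
  apply: le_trans (nrm_dot _ _) _; rewrite mulrC; apply: ler_pM; rewrite ?nrm_ge0 //.
    exact: ltW.
  apply: le_trans (sP _) _; apply: (@le_trans _ _ (`|s| * nrm x')).
    by rewrite ler_wpM2r ?nrm_ge0 ?ler_norm.
  by rewrite ler_wpM2l //; lra.
apply: le_trans (nrmD _ _) _; apply: le_trans (lerD (nrmD _ _) (lexx _)) _.
move: ec; rewrite /c; lra.
Qed.

Lemma fejer_cvg x y (eps : R) : 0 < eps -> exists N0, forall N, (N0 <= N)%N ->
  nrm (dot (fejer N.+1 x) y - dot (Z x) y) < eps.
Proof.
move=> eps0; pose G N u v := dot (fejer N.+1 u) v - dot (Z u) v.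
have Gle N u v : nrm (G N u v) <= 2 * z * nrm u * nrm v.
  apply: le_trans (nrmD _ _) _; rewrite nrmN.
  have := fejer_contractive u v (ltn0Sn N).
  have : nrm (dot (Z u) v) <= z * nrm u * nrm v.
    by apply: le_trans (nrm_dot _ _) _; rewrite ler_wpM2r ?nrm_ge0.
  move: (nrm (dot (Z u) v)) (nrm (dot _ v)) => g1 g2.
  have -> : 2 * z * nrm u * nrm v = z * nrm u * nrm v + z * nrm u * nrm v by ring.
  lra.
pose c := 2 * z * (nrm y + nrm x + 1).
have c0 : 0 <= c by rewrite /c !mulr_ge0 // ?addr_ge0 ?nrm_ge0.
have c1 : 0 < c + 1 by rewrite ltr_wpDl.
pose d := Num.min 1 (eps / 2 / (c + 1)).
have d0 : 0 < d by rewrite lt_min ltr01 !divr_gt0.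
have d1 : d <= 1 by rewrite ge_min lexx.
have dc : c * d <= eps / 2.
  apply: (@le_trans _ _ ((c + 1) * (eps / 2 / (c + 1)))); last first.
    by rewrite mulrC divfK // gt_eqF.
  by apply: ler_pM; rewrite ?(ltW d0) ?ge_min ?lexx ?orbT // lerDl.
have [x' [D1 fx'] /ltW xx'] := finsupp_dense orthoe totale x d0.
have [y' [D2 fy'] /ltW yy'] := finsupp_dense orthoe totale y d0.
pose D := (D1 + D2)%N.
have fx : finsupp e D x'.
  by move=> j Dj; apply: fx'; apply: leq_trans Dj; apply: leq_addr.
have fy : finsupp e D y'.
  by move=> j Dj; apply: fy'; apply: leq_trans Dj; apply: leq_addl.
pose S := \sum_(j < D) \sum_(i < D) D%:R *
  nrm (dot x' (e j) * (dot y' (e i))^* * dot (Z (e j)) (e i)).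
exists (Num.truncn (S / (eps / 2))) => N NS.
have N1 : 0 < N.+1%:R :> R by rewrite ltr0n.
have Gfin : nrm (G N x' y') <= S / N.+1%:R.
  rewrite /G (dot_double (@fejer_linear N.+1) fx fy) (dot_double linZ fx fy).
  rewrite -sumrB /S mulr_suml; apply: le_trans (nrm_sum _ _ _) _.
  apply: ler_sum => j _; rewrite -sumrB mulr_suml.
  apply: le_trans (nrm_sum _ _ _) _; apply: ler_sum => i _.
  rewrite fejer_matrix; set q := dot x' _ * _; set m := dot (Z _) _.
  have -> : q * (((N.+1 - lag j i)%:R / N.+1%:R : R)%:C * m) - q * m =
      ((N.+1 - lag j i)%:R / N.+1%:R - 1 : R)%:C * (q * m).
    by rewrite rcB; ring.
  rewrite nrmM nrmR [leRHS]mulrAC ler_wpM2r ?nrm_ge0 //.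
  have le1 : (N.+1 - lag j i)%:R / N.+1%:R <= 1 :> R.
    by rewrite ler_pdivrMr // mul1r ler_nat leq_subr.
  rewrite distrC ger0_norm ?subr_ge0 // lerBlDr -mulrDl ler_pdivlMr // mul1r.
  rewrite -natrD ler_nat -leq_subLR leq_sub2l //.
  exact: lag_le.
have SN : S / N.+1%:R < eps / 2.
  rewrite ltr_pdivrMr // mulrC -ltr_pdivrMr ?divr_gt0 //.
  by apply: lt_le_trans (truncnS_gt _) _; rewrite ler_nat ltnS.
have -> : dot (fejer N.+1 x) y - dot (Z x) y =
    G N x' y' + G N (x - x') y + G N x' (y - y').
  rewrite /G (linTB (@fejer_linear N.+1)) (linTB linZ) !dotBl !dotBr; ring.
have nx' : nrm x' <= nrm x + 1.
  have := nrmD (x' - x) x; rewrite subrK nrmB; lra.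
have b2 : nrm (G N (x - x') y) <= 2 * z * nrm y * d.
  apply: le_trans (Gle _ _ _) _; rewrite mulrAC.
  by rewrite ler_wpM2l // !mulr_ge0 ?nrm_ge0.
have b3 : nrm (G N x' (y - y')) <= 2 * z * (nrm x + 1) * d.
  apply: le_trans (Gle _ _ _) _; apply: ler_pM; rewrite ?nrm_ge0 ?mulr_ge0 ?nrm_ge0 //.
  by rewrite ler_wpM2l // mulr_ge0.
apply: le_lt_trans (nrmD _ _) _; apply: le_lt_trans (lerD (nrmD _ _) (lexx _)) _.
have {}dc : 2 * z * nrm y * d + 2 * z * (nrm x + 1) * d <= eps / 2.
  by apply: le_trans dc; rewrite le_eqVlt; apply/orP; left; apply/eqP; rewrite /c; ring.
move: (le_lt_trans Gfin SN) (le_trans (lerD b2 b3) dc).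
by move: (nrm _) (nrm _) (nrm _) => g1 g2 g3; lra.
Qed.

End Commuting.

Lemma bounded_operatorP (B : H -> H) : bounded_operator B ->
  linear B /\ exists2 c : R, 0 <= c & forall x, nrm (B x) <= c * nrm x.
Proof.
move=> [linB [c cP]]; split=> //; exists `|c| => // x.
apply: (@le_trans _ _ (c * nrm x)); last by rewrite ler_wpM2r ?nrm_ge0 ?ler_norm.
by rewrite -lecR rcM -!nrmE.
Qed.

Theorem shift_reflexive : reflexive_operator T.
Proof.
apply/seteqP; split=> Z [bZ].
  move=> LTZ; split=> //; have [linZ [z z0 leZ]] := bounded_operatorP bZ.
  have commZ := commutes_of_Lat orthoe totale rho_gt0 w_ge linT leT Te linZ leZ LTZ.
  apply: (WOT_closure_seq (F := fun N => fejer Z N.+1)).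
    by move=> N; exists (fejer_poly Z N.+1).
  by move=> x y eps; apply: fejer_cvg.
move=> clZ; split=> // M [cM TM]; split=> // _ [x Mx <-].
apply: orthocomplementK => // y yM; apply: (WOT_closure_dot clZ) => _ [q _ <-].
have itM k : M (iter k T x).
  by elim: k => // k IH; apply: TM; exists (iter k T x).
rewrite /poly_op dot_suml big1 // => i _; rewrite dotZl.
by rewrite (dot_eq0C (yM _ (itM i))) mulr0.
Qed.

End Reflexivity.

(** * Recurrence of patterns of weights *)

Section Weights.
Context {R : realType}.
Variables (w : nat -> R) (r : R).
Hypotheses (w_ge0 : forall n, 0 <= w n) (w_le1 : forall n, w n <= 1)
  (r_ge0 : 0 <= r) (r_lt1 : r < 1).

(** A product of weights that crosses the first stretch is at most r^g, and by
Bernoulli's inequality a product inside the second one is at least 1 - l/(k+1). *)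
Lemma blocks_of_patterns :
  (forall g l k J, exists2 j, (J <= j)%N & forall i, (i < g + l)%N ->
     if (i < g)%N then w (j * (g + l) + i)%N <= r
     else 1 - k.+1%:R^-1 <= w (j * (g + l) + i)%N) ->
  blocks_available w.
Proof.
move=> pat l B del del0.
have [g hg] : exists g, r ^+ g <= del.
  have q1 : `|r| < 1 by rewrite ger0_norm.
  have /cvgrPdist_lt /(_ _ del0) [N _ /(_ N (leqnn N))] := cvg_expr q1.
  rewrite /= sub0r normrN ger0_norm; last by rewrite exprn_ge0.
  by move=> /ltW h; exists N.
pose k := Num.truncn (l%:R / del).
have hk : l%:R * k.+1%:R^-1 <= del.
  have : l%:R / del < k.+1%:R by exact: truncnS_gt.
  by rewrite ltr_pdivrMr // ler_pdivrMr // mulrC => /ltW.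
have [j Bj pj] := pat g.+1 l k B.
pose m := (g.+1 + l)%N; pose b := (j * m + g.+1)%N.
have jm : (j <= j * m)%N by rewrite leq_pmulr.
have wp1 n q : wprod w n q <= 1 by exact: wprod_le1.
have wp0 n q : 0 <= wprod w n q by exact: wprod_ge0.
exists b; split.
- by apply: leq_trans Bj _; apply: leq_trans jm _; apply: leq_addr.
- move=> n q nB bq.
  have njm : (n <= j * m)%N by apply: leq_trans (ltnW nB) (leq_trans Bj jm).
  have -> : q = ((j * m - n) + g.+1 + (n + q - b))%N.
    by move: bq njm; rewrite /b; move: (j * m)%N => x; lia.
  rewrite !wprod_cat (_ : n + (j * m - n) = j * m)%N ?subnKC //.
  apply: (@le_trans _ _ (wprod w (j * m) g.+1)).
    rewrite -mulrA mulrC -mulrA ler_piMr //.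
    by rewrite mulr_ile1.
  apply: (@le_trans _ _ (r ^+ g.+1)); last first.
    by apply: le_trans hg; rewrite exprS ler_piMl ?exprn_ge0 // ltW.
  rewrite /wprod -[in leRHS](card_ord g.+1) -prodr_const ler_prod // => i _.
  rewrite w_ge0 /=; have ig : (i < g.+1 + l)%N by apply: ltn_addr.
  by have := pj i ig; rewrite ltn_ord.
- move=> p q pql.
  apply: (@le_trans _ _ (1 - q%:R * k.+1%:R^-1)).
    rewrite lerD2l lerN2; apply: le_trans hk.
    by rewrite ler_wpM2r ?invr_ge0 // ler_nat; lia.
  have : forall i, (i < q)%N -> 1 - k.+1%:R^-1 <= w (b + p + i)%N.
    move=> i iq; have il : (g.+1 + (p + i) < g.+1 + l)%N by rewrite ltn_add2l; lia.
    have := pj _ il; rewrite ltnNge leq_addr /=.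
    by rewrite /b -!addnA.
  elim: q {pql} => [|q IH] wq; first by rewrite mul0r subr0 /wprod big_ord0.
  rewrite wprodS; have := IH (fun i iq => wq i (leqW iq)); have := wq q (ltnSn q).
  have := w_le1 (b + p + q)%N; have := wp1 (b + p)%N q; have := wp0 (b + p)%N q.
  rewrite -(natr1 q) mulrDl mul1r; move: (wprod _ _ _) (w _) (k.+1%:R^-1 : R) (q%:R : R).
  move=> x y v z; nra.
Qed.

End Weights.

Section Recurrence.
Context {R : realType} {d : measure_display} {Omega : measurableType d}
        {P : probability Omega R}.
Variable X : nat -> {RV P >-> R}.
Hypotheses (X_indep : mutually_independent X) (X_ident : identically_distributed X).

Let pr (S : set Omega) : R := fine (P S).

Let PE S : measurable S -> P S = (pr S)%:E.
Proof. by move=> mS; rewrite fineK // fin_num_measure. Qed.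

Let mX n (A : set R) : measurable A -> measurable (X n @^-1` A).
Proof. by move=> mA; rewrite -[_ @^-1` _]setTI; apply: measurable_funP. Qed.

Definition cylinder (a b : nat) (A : nat -> set R) : set Omega :=
  [set om | forall i, (a <= i < b)%N -> A i (X i om)].

Lemma cylinderE a b A :
  cylinder a b A = \bigcap_(i in [set` index_iota a b]) (X i @^-1` A i).
Proof.
apply/seteqP; split=> om h i /=.
  by rewrite mem_index_iota; apply: h.
by move=> ab; apply: h; rewrite /= mem_index_iota.
Qed.

Lemma measurable_cylinder a b A : (forall i, measurable (A i)) ->
  measurable (cylinder a b A).
Proof.
move=> mA; rewrite cylinderE; apply: bigcap_measurableType => i _; exact: mX.
Qed.

Let pr0 (S : set R) := pr (X 0%N @^-1` S).

Lemma pr_cylinder a b A : (forall i, measurable (A i)) ->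
  pr (cylinder a b A) = \prod_(a <= i < b) pr0 (A i).
Proof.
move=> mA; rewrite /pr cylinderE X_indep ?iota_uniq //.
have -> : (\prod_(a <= i < b) P (X i @^-1` A i) = (\prod_(a <= i < b) pr0 (A i))%:E)%E.
  elim: (index_iota a b) => [|i s IH]; first by rewrite !big_nil.
  rewrite !big_cons IH EFinM; congr (_ * _)%E.
  rewrite -PE; last exact: mX.
  exact: X_ident.
by [].
Qed.

Section Pattern.
Variables (A : nat -> set R) (m J : nat).
Hypotheses (mA : forall i, measurable (A i)) (A_pos : forall i, 0 < pr0 (A i)).

Let hit j := cylinder (j * m) (j.+1 * m) (fun i => A (i %% m)%N).
Let q := \prod_(0 <= i < m) pr0 (A i).

Lemma pr0_bounds S : measurable S -> 0 <= pr0 S <= 1.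
Proof.
move=> mS; have mXS := mX 0 mS.
rewrite -!lee_fin -PE // measure_ge0 /=; exact: probability_le1.
Qed.

Lemma q_bounds : 0 < q <= 1.
Proof.
apply/andP; split; first by apply: prodr_gt0.
by apply: prodr_ile1 => i _; apply: pr0_bounds.
Qed.

Definition miss n : set Omega :=
  [set om | forall j, (J <= j < J + n)%N -> ~ hit j om].

Lemma measurable_miss n : measurable (miss n).
Proof.
have -> : miss n = \bigcap_(j in [set j | (J <= j < J + n)%N]) ~` hit j by [].
apply: bigcap_measurableType => j _; apply: measurableC.
exact: measurable_cylinder.
Qed.

Lemma pr_glue s s' b (D1 D2 : nat -> set R) : (s <= s')%N -> (s' <= b)%N ->
  (forall i, measurable (D1 i)) -> (forall i, measurable (D2 i)) ->
  (forall i, (s' <= i)%N -> D1 i = D2 i) -> (forall i, (i < s')%N -> D1 i = setT) ->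
  pr (cylinder s b D2) = (\prod_(s <= i < s') pr0 (D2 i)) * pr (cylinder s b D1).
Proof.
move=> ss' s'b mD1 mD2 E12 E1.
rewrite (pr_cylinder _ _ mD1) (pr_cylinder _ _ mD2) (big_cat_nat ss' s'b).
rewrite [X in _ = _ * X](big_cat_nat ss' s'b); congr (_ * _).
have -> : \prod_(s <= i < s') pr0 (D1 i) = 1.
  apply: big1_seq => i; rewrite mem_index_iota => /andP[_ /andP[_ is']].
  by rewrite (E1 _ is') /pr0 preimage_setT /pr probability_setT.
rewrite /= mul1r; apply: eq_big_nat => i /andP[s'i _].
by rewrite E12.
Qed.

(** Blocks of indices are independent, so each further attempt fails with
probability 1 - q, whatever is asked of later variables. *)
Lemma pr_miss n b D : ((J + n) * m <= b)%N -> (forall i, measurable (D i)) ->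
  pr (miss n `&` cylinder ((J + n) * m) b D) =
  (1 - q) ^+ n * pr (cylinder ((J + n) * m) b D).
Proof.
elim: n D => [|n IH] D nb mD.
  rewrite expr0 mul1r (_ : miss 0 = setT) ?setTI //.
  by apply/seteqP; split=> // om _ j; lia.
pose s := ((J + n) * m)%N; pose s' := ((J + n).+1 * m)%N.
have ss' : (s <= s')%N by rewrite leq_mul2r leqnSn orbT.
have s'b : (s' <= b)%N by rewrite /s' -addnS.
pose D1 i := if (i < s')%N then setT else D i.
pose D2 i := if (i < s')%N then A (i %% m)%N else D i.
have mD1 i : measurable (D1 i) by rewrite /D1; case: ifP.
have mD2 i : measurable (D2 i) by rewrite /D2; case: ifP.
have C1 : cylinder s b D1 = cylinder s' b D.
  apply/seteqP; split=> om h i ib; last first.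
    by rewrite /D1; case: ltnP => // s'i; apply: h; lia.
  by have := h i; rewrite /D1 ifF; [apply; lia|lia].
have C2 : cylinder s b D2 = hit (J + n) `&` cylinder s' b D.
  apply/seteqP; split=> om h.
    split=> i ib.
      by have := h i; rewrite /D2 ifT; [apply; lia|lia].
    by have := h i; rewrite /D2 ifF; [apply; lia|lia].
  case: h => h1 h2 i ib; rewrite /D2; case: ltnP => is'; [apply: h1|apply: h2]; lia.
have E : miss n.+1 `&` cylinder s' b D =
    (miss n `&` cylinder s b D1) `\` (miss n `&` cylinder s b D2).
  rewrite C1 C2; apply/seteqP; split=> om.
    move=> [ms cs]; split; first by split=> // j jn; apply: ms; lia.
    by move=> [_ [hn _]]; apply: (ms (J + n)%N) => //; lia.
  move=> [[ms cs] no]; split=> // j; rewrite addnS ltnS => /andP[Jj].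
  rewrite leq_eqVlt => /orP[/eqP-> hJn|jn]; last by apply: ms; rewrite Jj.
  exact: no.
have sub : miss n `&` cylinder s b D2 `<=` miss n `&` cylinder s b D1.
  by rewrite C1 C2 => om [ms [_ cs]].
have mm1 : measurable (miss n `&` cylinder s b D1).
  by apply: measurableI; [exact: measurable_miss|exact: measurable_cylinder].
have mm2 : measurable (miss n `&` cylinder s b D2).
  by apply: measurableI; [exact: measurable_miss|exact: measurable_cylinder].
have prD : pr (miss n.+1 `&` cylinder s' b D) =
    pr (miss n `&` cylinder s b D1) - pr (miss n `&` cylinder s b D2).
  rewrite E /pr measureD //; last first.
    by apply: le_lt_trans (probability_le1 P _) _; rewrite ?ltry.
  by rewrite (setIidr sub) fineB // fin_num_measure.
have sb : (s <= b)%N by lia.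
rewrite addnS -/s' prD (IH D1 sb mD1) (IH D2 sb mD2) -/s.
have -> : pr (cylinder s b D2) = q * pr (cylinder s b D1).
  rewrite (pr_glue ss' s'b mD1 mD2).
  - congr (_ * _); rewrite /q -{1}[s]add0n big_addn (_ : s' - s = m)%N; last first.
      by rewrite /s /s' mulSn addnK.
    apply: eq_big_nat => i im; rewrite /D2 /s [X in (X %% m)%N]addnC modnMDl modn_small //.
    by rewrite (_ : (i + (J + n) * m < s')%N) // /s' mulSn ltn_add2r.
  - by move=> i s'i; rewrite /D1 /D2 ltnNge s'i.
  - by move=> i is'; rewrite /D1 is'.
rewrite C1 exprS; ring.
Qed.

Lemma pattern_recurs :
  {ae P, forall om, exists2 j, (J <= j)%N &
    forall i, (i < m)%N -> A i (X (j * m + i)%N om)}.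
Proof.
have /andP[q0 q1] := q_bounds.
pose N := \bigcap_n miss n.
have mN : measurable N by apply: bigcap_measurableType => n _; exact: measurable_miss.
exists N; split=> //.
  apply/eqP; rewrite -measure_le0; apply/lee_addgt0Pr => eps eps0; rewrite add0e.
  have qq : `|1 - q| < 1 by rewrite ger0_norm ?subr_ge0 //; lra.
  have /cvgrPdist_lt /(_ _ eps0) [n _ /(_ n (leqnn n))] := cvg_expr qq.
  rewrite /= sub0r normrN ger0_norm ?exprn_ge0 ?subr_ge0 // => /ltW h.
  have Nn : N `<=` miss n by move=> om; apply.
  apply: (@le_trans _ _ (P (miss n))).
    by apply: le_measure; rewrite ?inE //; exact: measurable_miss.
  rewrite PE; last exact: measurable_miss.
  rewrite lee_fin; apply: le_trans h.
  have := @pr_miss n _ (fun=> setT) (leqnn _) (fun=> measurableT).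
  have -> : cylinder ((J + n) * m) ((J + n) * m) (fun=> setT) = setT.
    by apply/seteqP; split.
  by rewrite setIT => ->; rewrite /pr probability_setT mulr1.
move=> om no n _ j /andP[Jj _] hj; apply: no; exists j => // i im.
have := hj (j * m + i)%N; rewrite modnMDl modn_small //; apply.
by rewrite leq_addr mulSn addnC ltn_add2r.
Qed.

End Pattern.

(** Every point outside the essential range has a null neighbourhood, which
contains a null interval with rational end points; there are countably many. *)
Lemma ae_essran n : {ae P, forall om, essran (X 0%N) (X n om)}.
Proof.
pose I (ab : rat * rat) : set R := `]ratr ab.1, ratr ab.2[%classic.
pose F (k : nat) : set Omega := if unpickle k is Some ab then
  if P (X n @^-1` I ab) == 0%E then X n @^-1` I ab else set0 else set0.
apply: (negligibleS _ (negligible_bigcup (F := F) _)); last first.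
  move=> k; rewrite /F; case: unpickle => [ab|]; last exact: negligible_set0.
  case: eqP => [P0|_]; last exact: negligible_set0.
  by apply/negligibleP => //; apply: mX; exact: measurable_itv.
move=> om /= ness.
have [U [oU Ux /negP U0]] : exists U : set R,
    [/\ open U, U (X n om) & ~ (0 < distribution P (X 0%N) U)%E].
  apply: contrapT => no; apply: ness => U oU Ux; apply: contrapT => U0.
  by apply: no; exists U.
have [a [b [ab sub]]] : exists a b : rat, I (a, b) (X n om) /\ I (a, b) `<=` U.
  have : nbhs (X n om) U by rewrite nbhsE /=; exists U.
  rewrite -nbhs_ballE => -[e /= e0 eU].
  have [a aI] := rat_in_itvoo (ltac:(by rewrite ltrBlDr ltrDl) : X n om - e < X n om).
  have [b bI] := rat_in_itvoo (ltac:(by rewrite ltrDl) : X n om < X n om + e).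
  move: aI bI; rewrite !in_itv /= => /andP[a1 a2] /andP[b1 b2].
  exists a, b; split; first by rewrite /I /= in_itv /= a2 b1.
  move=> y; rewrite /I /= in_itv /= => /andP[ay yb]; apply: eU.
  rewrite /ball /= ltr_norml; apply/andP; split; lra.
have [k kE] : exists k, unpickle k = Some (a, b) by exists (pickle (a, b)); exact: pickleK.
exists k; first by [].
rewrite /F kE ifT; first by [].
rewrite eq_le measure_ge0 andbT.
have mI : measurable (I (a, b)) by exact: measurable_itv.
have -> : P (X n @^-1` I (a, b)) = distribution P (X 0%N) (I (a, b)) by exact: X_ident.
rewrite leNgt; apply/negP => lt0; move: U0; apply/negP; rewrite negbK.
apply: lt_le_trans lt0 _; apply: le_measure; rewrite ?inE //.
exact: open_measurable.
Qed.

End Recurrence.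

(** * Random shifts *)

(** Enumerate a countable dense set: a closed subspace containing it is everything. *)
Lemma separable_total (R : realType) (K : hilbertType R) : separable K ->
  exists fs : nat -> K, forall M : set K, closed_subspace M ->
    (forall n, M (fs n)) -> forall x, M x.
Proof.
move=> [D [/countable_injP[c cinj] dD]].
pose fs n := xget 0 [set x | D x /\ c x = n].
have fsD x : D x -> fs (c x) = x.
  move=> Dx; rewrite /fs; case: xgetP => [y -> [Dy cy]|none].
    by apply: cinj; rewrite ?inE.
  by case: (none x).
exists fs => M [_ _ cM] Mfs x; apply: contrapT => nMx.
have [y [nMy Dy]] : (~` M) `&` D !=set0.
  by apply: dD; [exists x|exact: closed_openC].
by apply: nMy; rewrite -(fsD _ Dy).
Qed.

Lemma opnorm_bound (R : realType) (K : hilbertType R) (A : K -> K) :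
  bounded_operator A ->
  0 <= opnorm A /\ forall f, nrm (A f) <= opnorm A * nrm f.
Proof.
move=> bA; have [linA [c c0 cP]] := bounded_operatorP bA.
have A0 : A 0 = 0 by have := linA (-1) 0 0; rewrite scaler0 addr0 scaleN1r addNr.
have AZ b x : A (b *: x) = b *: A x by have := linA b x 0; rewrite A0 !addr0.
have ub : has_sup [set Re `|A x| | x in [set x : K | `|x| <= 1]].
  split; first by exists (Re `|A 0|), 0 => //=; rewrite normr0 ler01.
  exists c => _ [x /= x1 <-]; apply: le_trans (cP x) _.
  by rewrite ler_piMr // -lecR -nrmE.
have le1 x : nrm x <= 1 -> nrm (A x) <= opnorm A.
  move=> x1; apply: ub_le_sup; first by case: ub.
  by exists x => //=; rewrite nrmE -(rmorph1 (real_complex R)) lecR.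
split; first by apply: le_trans (nrm_ge0 (A 0)) _; apply: le1; rewrite nrm0.
move=> f; have [->|f0] := eqVneq f 0; first by rewrite A0 !nrm0 mulr0.
have nf : 0 < nrm f by rewrite lt_def nrm_ge0 nrm_eq0 f0.
have := le1 ((nrm f)^-1%:C *: f).
rewrite AZ !nrmZ nrmR ger0_norm ?invr_ge0 ?nrm_ge0 // mulVf ?gt_eqF //.
by move=> /(_ (lexx 1)); rewrite ler_pdivrMl // mulrC.
Qed.

Theorem corollary1p4 (R : realType) (H : hilbertType R) (e : nat -> H)
    (he : orthonormal_basis_of setT e setT)
    (d : measure_display) (Omega : measurableType d) (P : probability Omega R)
    (X : nat -> {RV P >-> R})
    (X_ge0 : ae_nonnegative X) (X_bounded : ae_bounded X)
    (X_indep : mutually_independent X) (X_ident : identically_distributed X)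
    (T : Omega -> H -> H) (hT : weighted_shift_of e X T)
    (rmin rmax : R)
    (hrmin : essran (X 0%N) rmin /\ lbound (essran (X 0%N)) rmin)
    (hrmax : essran (X 0%N) rmax /\ ubound (essran (X 0%N)) rmax)
    (rmin_gt0 : 0 < rmin) (rmin_lt_rmax : rmin < rmax) (rmax_eq1 : rmax = 1) :
  [/\ {ae P, forall w, reflexive_operator (T w)},
      {ae P, forall w, forall n : option nat, n <> Some 0%N ->
         exists2 M, Lat (T w) M & has_index (T w) M n} &
      forall (K : hilbertType R), separable K ->
      forall A : K -> K, bounded_operator A -> opnorm A < 1 ->
      {ae P, forall w, exists N M : set H,
         [/\ Lat (T w) N, Lat (T w) M, N `<=` M &
             let L := M `&` orthocomplement N in
             unitarily_equivalent L (compression L (T w)) A]}].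
Proof.
have [ortho tot] := he.
have orthoe i j : dot (e i) (e j) = (i == j)%:R by exact: ortho.
pose r := (rmin + 1) / 2.
have r1 : rmin < 1 by rewrite -rmax_eq1.
have rr : rmin < r by rewrite /r; lra.
have r_lt1 : r < 1 by rewrite /r; lra.
(* Both small weights, below r, and weights as close to one as desired have
   positive probability, because rmin and 1 are essential values. *)
have lowP : (0 < P (X 0%N @^-1` [set x | x < r]%R))%E.
  by apply: hrmin.1 => //; exact: open_lt.
have highP k : (0 < P (X 0%N @^-1` [set x | 1 - k.+1%:R^-1 < x]%R))%E.
  apply: hrmax.1; first exact: open_gt.
  by rewrite /= rmax_eq1 ltrBlDr ltrDl invr_gt0.
pose pat g k (i : nat) := if (i < g)%N then [set x : R | x < r] else [set x | 1 - k.+1%:R^-1 < x].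
have mpat g k i : measurable (pat g k i).
  by apply: open_measurable; rewrite /pat; case: ifP => _; [exact: open_lt|exact: open_gt].
have pat_pos g k i : 0 < fine (P (X 0%N @^-1` pat g k i)).
  have lty : (P (X 0%N @^-1` pat g k i) < +oo)%E.
    by apply: le_lt_trans (probability_le1 P _) (ltry _); rewrite -[_ @^-1` _]setTI; apply: measurable_funP.
  rewrite fine_gt0 // lty andbT /pat.
  by case: ifP => _; [exact: lowP|exact: highP].
have recur : {ae P, forall om, forall g l k J, exists2 j, (J <= j)%N &
    forall i, (i < g + l)%N -> pat g k i (X (j * (g + l) + i)%N om)}.
  apply: ae_foralln => g; apply: ae_foralln => l; apply: ae_foralln => k.
  apply: ae_foralln => J.
  exact: (pattern_recurs X_indep X_ident (g + l) J (mpat g k) (pat_pos g k)).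
have ess : {ae P, forall om, forall n, essran (X 0%N) (X n om)}.
  by apply: ae_foralln => n; apply: ae_essran.
have good : {ae P, forall om, [/\ bounded_operator (T om),
    forall n, T om (e n) = (X n om)%:C *: e n.+1,
    forall n, rmin <= X n om <= 1 &
    blocks_available (fun n => X n om)]}.
  apply: filterS3 hT ess recur => om [bT Te] es pt.
  have w01 n : rmin <= X n om <= 1.
    by rewrite (hrmin.2 _ (es n)) -rmax_eq1 (hrmax.2 _ (es n)).
  split=> //; apply: (@blocks_of_patterns _ _ r) => //.
  - by move=> n; apply: le_trans (ltW rmin_gt0) _; case/andP: (w01 n).
  - by move=> n; case/andP: (w01 n).
  - by rewrite /r; lra.
  move=> g l k J; have [j Jj hj] := pt g l k J; exists j => // i il.
  by have := hj i il; rewrite /pat; case: ifP => _ /= /ltW.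
split.
- apply: filterS good => om [bT Te w01 blocks].
  have [linT [t t0 leT]] := bounded_operatorP bT.
  apply: (shift_reflexive orthoe tot rmin_gt0 _ linT leT Te).
  by move=> n; case/andP: (w01 n).
- apply: filterS good => om [bT Te w01 blocks] n _.
  have [linT [t t0 leT]] := bounded_operatorP bT.
  have w0 i : 0 <= X i om by case/andP: (w01 i) => h _; apply: le_trans h; apply: ltW.
  have w1 i : X i om <= 1 by case/andP: (w01 i).
  have lin0 : linear (fun _ : H => 0 : H) by move=> b x y; rewrite scaler0 addr0.
  have le0 (f : H) : nrm (0 : H) <= 0 * nrm f by rewrite nrm0 mul0r.
  have etot (M : set H) : closed_subspace M -> (forall n, M (e n)) -> forall x, M x.
    move=> cM Me x; have : smallest closed_subspace (e @` setT) x by rewrite tot.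
    by apply: (smallest_sub cM) => _ [i _ <-].
  have [U [linU dilU]] := power_dilation lin0 (lexx 0) ltr01 le0 w0 w1 blocks
    orthoe linT leT Te etot.
  apply: (index_of_wandering linT leT (x := fun i => U (e i))) => k i j.
  by rewrite dilU; case: k => [|k] /=; rewrite ?orthoe ?dot0l.
- move=> K sepK A bA A1; apply: filterS good => om [bT Te w01 blocks].
  have [linT [t t0 leT]] := bounded_operatorP bT.
  have w0 i : 0 <= X i om by case/andP: (w01 i) => h _; apply: le_trans h; apply: ltW.
  have w1 i : X i om <= 1 by case/andP: (w01 i).
  have [fs fst] := separable_total sepK.
  have [linA _] := bA; have [a0 leA] := opnorm_bound bA.
  have [U [linU dilU]] := power_dilation linA a0 A1 leA w0 w1 blocks
    orthoe linT leT Te fst.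
  exact: (compression_of_dilation linA leA linT leT linU dilU).
Qed.
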